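(* Let $x,y$ be roots of unity and $p_1\ge1$ an integer with $(p_1,y)\neq(1,1)$. Let $r_1(s)$ be a rational function with no poles at $-(n+1/2)$ for integers $n\geq 1$ and no poles at integers, let $r_2(s)$ be a rational function with no poles at $-(n+1/2)$ for integers $n\ge0$ and no poles at nonzero integers, and suppose $r_1(s)$ and $r_2(s)$ are $o(1)$ as $|s|\to\infty$. Let $S_1,S_2$ be the sets of poles of $r_1,r_2$ respectively. Suppose $r_1$ has a pole at $-1/2$ of order $q_1\ge0$ and $r_2$ has a pole at $0$ of order $q_2\ge0$ (order $0$ meaning no pole), and put $R_1(s)=(s+1/2)^{q_1}r_1(s)$ and $R_2(s)=s^{q_2}r_2(s)$. (i) Provided the infinite series in the following formula converge, \begin{align*} &-\sum_{\alpha\in S_1\setminus\{-1/2\}}\mathrm{Res}\left(\frac{\Phi(s;x)\phi^{(p_1-1)}(s+1/2;y)}{(p_1-1)!}r_1(s)(-1)^{p_1-1},\alpha\right)\\ &=\sum_{n=0}^\infty x^{-n}y^{-n-1}r_1(n)\big(\mathrm{ti}_{p_1}(y)-t_n(p_1;y)\big)+\sum_{n=1}^\infty(xy)^nr_1(-n)\Big(\mathrm{ti}_{p_1}(y)y^{-1}+(-1)^{p_1}t_n\big(p_1;y^{-1}\big)\Big)\\ &\quad+\sum_{m=0}^{p_1+q_1-1}\Big((-1)^m\mathrm{ti}_{m+1}(x)-x\,\mathrm{ti}_{m+1}\big(x^{-1}\big)\Big)\frac{R_1^{(p_1+q_1-m-1)}(-\frac12)}{(p_1+q_1-1-m)!}\\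 &\quad+\sum_{\substack{m+k\le q_1-1\\ m,k\ge0}}(-1)^k\binom{k+p_1-1}{p_1-1}\mathrm{Li}_{k+p_1}(y)\Big((-1)^m\mathrm{ti}_{m+1}(x)-x\,\mathrm{ti}_{m+1}\big(x^{-1}\big)\Big)\frac{R_1^{(q_1-m-k-1)}(-\frac12)}{(q_1-m-k-1)!}\\ &\quad+\sum_{n=1}^\infty\sum_{m=0}^{p_1-1}\Big((-1)^m\mathrm{ti}_{m+1}(x)-x\,\mathrm{ti}_{m+1}\big(x^{-1}\big)\Big)\frac{(xy)^nr_1^{(p_1-m-1)}(-n-\frac12)}{(p_1-m-1)!}. \end{align*} (ii) Provided the infinite series in the following formula converge, \begin{align*} &-\sum_{\alpha\in S_2\setminus\{0\}}\mathrm{Res}\left(\frac{\Phi(s;x)\phi^{(p_1-1)}(s+1/2;y)}{(p_1-1)!}r_2(s)(-1)^{p_1-1},\alpha\right)\\ &=\sum_{n=1}^\infty x^{-n}y^{-n-1}r_2(n)\big(\mathrm{ti}_{p_1}(y)-t_n(p_1;y)\big)+\sum_{n=1}^\infty(xy)^nr_2(-n)\Big(\mathrm{ti}_{p_1}(y)y^{-1}+(-1)^{p_1}t_n\big(p_1;y^{-1}\big)\Big)\\ &\quad+\sum_{k=0}^{q_2}\binom{k+p_1-1}{p_1-1}(-1)^k\,\mathrm{ti}_{k+p_1}(y)y^{-1}\frac{R_2^{(q_2-k)}(0)}{(q_2-k)!}\\ &\quad+\sum_{\substack{m+k\le q_2-1\\ m,k\ge0}}(-1)^k\binom{k+p_1-1}{p_1-1}\mathrm{ti}_{k+p_1}(y)y^{-1}\Big((-1)^m\mathrm{Li}_{m+1}(x)-\mathrm{Li}_{m+1}\big(x^{-1}\big)\Big)\frac{R_2^{(q_2-m-k-1)}(0)}{(q_2-m-k-1)!}\\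 &\quad+\sum_{n=0}^\infty\sum_{m=0}^{p_1-1}\Big((-1)^m\mathrm{ti}_{m+1}(x)-x\,\mathrm{ti}_{m+1}\big(x^{-1}\big)\Big)\frac{(xy)^nr_2^{(p_1-m-1)}(-n-\frac12)}{(p_1-m-1)!}. \end{align*} The double sums over $m+k\le q_j-1$ are empty when $q_j=0$.
   Context: $\mathrm{Res}(f(s),\alpha)$ is the residue of $f$ at $s=\alpha$. For a positive integer $p$ and a root of unity $z$: $t_n(p;z):=\sum_{k=1}^n\frac{z^k}{(k-1/2)^p}$; for $(p,z)\neq(1,1)$, $\mathrm{ti}_p(z):=\sum_{n=1}^\infty\frac{z^n}{(n-1/2)^p}$ and $\mathrm{Li}_p(z):=\sum_{n=1}^\infty\frac{z^n}{n^p}$. For a root of unity $z\neq1$, $\phi(s;z):=\sum_{k=0}^\infty\frac{z^k}{k+s}$ for $s\notin\{0,-1,-2,\ldots\}$, and $\phi^{(j)}(s;z)$ is its $j$-th derivative in $s$; for $z=1$ and $j\ge1$, $\phi^{(j)}(s;1)$ means the termwise derivative $(-1)^j j!\sum_{k=0}^\infty\frac1{(k+s)^{j+1}}$. For a root of unity $x$, $\Phi(s;x):=\phi(s;x)-\phi(-s;x^{-1})-\frac1s$, where for $x=1$ the difference is read as the convergent series $\Phi(s;1)=\frac1s+\sum_{k=1}^\infty\left(\frac{1}{k+s}-\frac1{k-s}\right)$. Conventions when $x=1$: the ($m=0$) expressions $\mathrm{ti}_1(x)-x\,\mathrm{ti}_1(x^{-1})$ and $\mathrm{Li}_1(x)-\mathrm{Li}_1(x^{-1})$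 are read as $0$. *)

(* Defs.v *)
From HB Require Import structures.
From mathcomp Require Export all_boot all_order all_algebra.
From mathcomp Require Export all_classical all_reals all_analysis.
From mathcomp Require Export complex.
Export Order.TTheory GRing.Theory Num.Theory.
Export numFieldNormedType.Exports.

Set Implicit Arguments.
Unset Strict Implicit.
Unset Printing Implicit Defensive.

Local Open Scope classical_set_scope.
Local Open Scope ring_scope.

(* The field K below is meant to be the complex field R[i], R : realType.
   The definitions are stated for an arbitrary numFieldType because
   MathComp-Analysis puts the norm topology on every K : numFieldType but
   declares none on R[i] itself. *)

Section Series.
Variable K : numFieldType.
Implicit Types (u : nat -> K).

Definition partial_sum (m : nat) u (N : nat) : K := \sum_(m <= n < N) u n.

Definition series_converges (m : nat) u : Prop := cvgn (partial_sum m u).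

Definition series_sum (m : nat) u : K := limn (partial_sum m u).

(* j-th (complex) derivative *)
Definition nderiv (j : nat) (f : K -> K) (s : K) : K := derive1n j f s.

End Series.

Section Residues.
Variable K : numFieldType.
Implicit Types (f : K -> K) (alpha c : K).

(* c is the coefficient of (s - alpha)^(-1) in a Laurent expansion
   f(s) = sum_(n >= 0) a_n (s - alpha)^(n - (N + 1)) with finite principal part,
   valid on a punctured neighbourhood of alpha. Shifting by N + 1 rather than N
   makes the exponent -1 (at n = N) always present, so that c is determined
   by f; it is 0 when f extends holomorphically to alpha. *)
Definition is_residue f alpha c : Prop :=
  exists (N : nat) (a : nat -> K), c = a N /\
    \forall s \near alpha^',
      partial_sum 0 (fun n => a n * (s - alpha) ^ (n%:Z - N.+1%:Z)) @ \oo
        --> f s.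

Definition Res f alpha : K := xget 0 [set c | is_residue f alpha c].

End Residues.

Section RationalFunctions.
Variable K : numFieldType.
Implicit Types (r : {fraction {poly K}}) (s alpha : K).

(* The representative chosen by [repr] need not be in lowest terms, hence the
   division by the gcd. *)
Definition ratnum r : {poly K} :=
  let: (n, d) := frac (repr r) in n %/ gcdp n d.
Definition ratden r : {poly K} :=
  let: (n, d) := frac (repr r) in d %/ gcdp n d.

(* Removable singularities are filled in; the value is 0 at a pole. *)
Definition rateval r s : K := (ratnum r).[s] / (ratden r).[s].

Definition poles r : set K := [set alpha | root (ratden r) alpha].

Definition pole_order r alpha : nat := mup alpha (ratden r).

(* f(s) = o(1) as |s| -> oo. The positivity of M matters: the order of R[i] is
   partial, and M < `|s| would be void for a non-real M. *)
Definition vanishes_at_infinity (f : K -> K) : Prop :=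
  forall e : K, 0 < e ->
    exists2 M : K, 0 < M & forall s, M < `|s| -> `|f s| < e.

End RationalFunctions.

Section Functions.
Variable K : numFieldType.
Implicit Types (s z x y : K).

(* [n.-unity_root z] alone is always true for n = 0. *)
Definition root_of_unity z : Prop :=
  exists2 n : nat, (0 < n)%N & n.-unity_root z.

Definition tsum (n p : nat) z : K :=
  \sum_(1 <= k < n.+1) z ^+ k / (k%:R - 2^-1) ^+ p.

Definition ti (p : nat) z : K :=
  series_sum 1 (fun n => z ^+ n / (n%:R - 2^-1) ^+ p).

Definition Li (p : nat) z : K := series_sum 1 (fun n => z ^+ n / n%:R ^+ p).

Definition phi z s : K := series_sum 0 (fun k => z ^+ k / (k%:R + s)).

(* The series phi diverges at z = 1, where phi^(j), j >= 1, is the termwise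
   derivative; the value for z = 1 and j = 0 is meaningless. *)
Definition phi_deriv (j : nat) z s : K :=
  if z == 1 then
    (-1) ^+ j * (j`!)%:R * series_sum 0 (fun k => 1 / (k%:R + s) ^+ j.+1)
  else nderiv j (phi z) s.

Definition Phi x s : K :=
  if x == 1 then
    1 / s + series_sum 1 (fun k => 1 / (k%:R + s) - 1 / (k%:R - s))
  else phi x s - phi x^-1 (- s) - 1 / s.

(* (-1)^m ti_(m+1)(x) - x ti_(m+1)(x^-1), read as 0 for m = 0 and x = 1. *)
Definition ti_coef (m : nat) x : K :=
  if (m == 0%N) && (x == 1) then 0
  else (-1) ^+ m * ti m.+1 x - x * ti m.+1 x^-1.

(* (-1)^m Li_(m+1)(x) - Li_(m+1)(x^-1), read as 0 for m = 0 and x = 1. *)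
Definition Li_coef (m : nat) x : K :=
  if (m == 0%N) && (x == 1) then 0
  else (-1) ^+ m * Li m.+1 x - Li m.+1 x^-1.

(* The function whose residues are taken; [rs] is the function s |-> r(s). *)
Definition integrand (p : nat) x y (rs : K -> K) s : K :=
  Phi x s * phi_deriv p.-1 y (s + 2^-1) / (p.-1`!)%:R * rs s * (-1) ^+ p.-1.

(* General terms of the series over the positive integers, the negative integers
   and the negative half-integers. *)
Definition pos_int_term (p : nat) x y (rs : K -> K) (n : nat) : K :=
  x ^- n * y ^- n.+1 * rs n%:R * (ti p y - tsum n p y).

Definition neg_int_term (p : nat) x y (rs : K -> K) (n : nat) : K :=
  (x * y) ^+ n * rs (- n%:R)
    * (ti p y * y^-1 + (-1) ^+ p * tsum n p y^-1).

Definition half_int_term (p : nat) x y (rs : K -> K) (n : nat) : K :=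
  \sum_(0 <= m < p)
    ti_coef m x * ((x * y) ^+ n
      * nderiv (p - m - 1) rs (- n%:R - 2^-1) / ((p - m - 1)`!)%:R).

End Functions.

(* Main.v *)
Require Import Defs.
From mathcomp Require Import ring lra zify.
Set Implicit Arguments.
Unset Strict Implicit.
Unset Printing Implicit Defensive.
Local Open Scope classical_set_scope.
Local Open Scope ring_scope.

(** The integrand is G(s) r(s), where G is the product of the symmetric sum of
x^k / (s + k) over all integers k ([bilerch]) and of the sum of
y^l / (s + l + 1/2)^p over l >= 0 ([lerch]).  Both formulas say that the
residues of G r at all its poles add up to zero, the poles of G being taken in
the order of the series.

Partial fractions write r as a finite combination of the functions
e(s) = 1 / (s - b)^(j+1) ([rational_expansion]), and both sides are linear in r.
For a single e the claim is a Mittag-Leffler expansion of G: the coefficient of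
(s - b)^j in the Laurent expansion of G at b is minus the sum of the residues of
G e at the poles of G other than b ([mittag_leffler], [core_term]).

This expansion needs no contour integral.  For one factor
1 / ((s + k) (s + l + 1/2)^p) of G it is an identity between binomial
coefficients ([prod_partial_fractions]).  It is summed over |k| <= M and l < N,
then M tends to infinity, then N.  The first limit is taken term by term: only
finitely many l occur, and the symmetric sums over k converge for every root of
unity x.  For the second limit, Abel summation bounds an incomplete sum over l
by a constant over its distance to the pole ([lerch_part_bound]), so the error
is at most a constant times the sum over k of 1 / ((|k| + 1) (|N - |k|| + 1/2)),
which is of the order of log N / N ([trunc_error]).  For a single e the three
series of the formula need not converge separately; their partial sums are kept
together, and the convergence assumptions are used after the sum over the
partial fractions of r has been formed.

Residues and higher derivatives are read off expansions whose remainders are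
bounded geometrically ([analytic]).  Such expansions are unique, can be
multiplied, and can be differentiated term by term ([analytic_uniq],
[analytic_mul], [nderiv_analytic]), and they determine the residue
([Res_analytic]).

At -1/2 in the first formula, and at 0 in the second, a pole of r may meet a pole
of G.  The finite sums of the formula express the Laurent coefficients of G
there ([laurent_coef_half], [laurent_coef_zero]).  As 0^-1 = 0 here, the
summand of G that is singular at b drops out of the sums by itself, and one
identity covers the ordinary and the exceptional points. *)

(** * Real-valued moduli *)

(** The proof uses only the modulus of a complex number as an element of [R], its
multiplicativity and the triangle inequality, so it is carried out over any
algebraically closed field with such a modulus. *)
Structure normField (R : realType) := NormField {
  nf_sort :> numClosedFieldType;
  rc : {rmorphism R -> nf_sort};
  nm : nf_sort -> R;
  nmE : forall z, `|z| = rc (nm z);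
  rc_le : {mono rc : a b / a <= b}
}.

Section Norm.
Variables (R : realType) (K : normField R).
Implicit Types (z w : K) (u : nat -> K) (f : K -> K).

Lemma rc_inj : injective (@rc R K).
Proof. exact: fmorph_inj. Qed.

Lemma rc_lt a b : (rc K a < rc K b) = (a < b).
Proof. by rewrite !lt_neqAle rc_le (inj_eq rc_inj). Qed.

Lemma nm_ge0 z : 0 <= nm z.
Proof. by rewrite -(@rc_le R K) rmorph0 -nmE. Qed.

Lemma nm_rc a : 0 <= a -> nm (rc K a) = a.
Proof.
by move=> a0; apply: rc_inj; rewrite -nmE ger0_norm // -(rmorph0 (rc K)) rc_le.
Qed.

Lemma nm0 : nm (0 : K) = 0.
Proof. by apply: rc_inj; rewrite -nmE normr0 rmorph0. Qed.
Lemma nm1 : nm (1 : K) = 1.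
Proof. by apply: rc_inj; rewrite -nmE normr1 rmorph1. Qed.
Lemma nmM z w : nm (z * w) = nm z * nm w.
Proof. by apply: rc_inj; rewrite -nmE normrM rmorphM !nmE. Qed.
Lemma nmV z : nm z^-1 = (nm z)^-1.
Proof. by apply: rc_inj; rewrite -nmE normfV fmorphV nmE. Qed.
Lemma nmN z : nm (- z) = nm z.
Proof. by apply: rc_inj; rewrite -!nmE normrN. Qed.
Lemma nmB z w : nm (z - w) = nm (w - z).
Proof. by rewrite -nmN opprB. Qed.
Lemma nmD z w : nm (z + w) <= nm z + nm w.
Proof. by rewrite -(@rc_le R K) rmorphD -!nmE ler_normD. Qed.
Lemma nm_eq0 z : (nm z == 0) = (z == 0).
Proof. by rewrite -(inj_eq rc_inj) -nmE rmorph0 normr_eq0. Qed.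
Lemma nm_gt0 z : (0 < nm z) = (z != 0).
Proof. by rewrite lt_def nm_ge0 andbT nm_eq0. Qed.
Lemma nmX z n : nm (z ^+ n) = nm z ^+ n.
Proof. by elim: n => [|n IH]; rewrite ?expr0 ?nm1 // !exprS nmM IH. Qed.
Lemma nm_nat n : nm (n%:R : K) = n%:R.
Proof. by apply: rc_inj; rewrite -nmE normr_nat rmorph_nat. Qed.
Lemma nm_sign n : nm ((-1) ^+ n : K) = 1.
Proof. by rewrite nmX nmN nm1 expr1n. Qed.
Lemma nm_sum (I : Type) (s : seq I) (P : pred I) (F : I -> K) :
  nm (\sum_(i <- s | P i) F i) <= \sum_(i <- s | P i) nm (F i).
Proof.
elim/big_rec2: _ => [|i y1 y2 _ h]; first by rewrite nm0.
by apply: (le_trans (nmD _ _)); rewrite lerD2l.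
Qed.
Lemma nm_ler_sub z w : nm z - nm w <= nm (z - w).
Proof. by rewrite lerBlDr; apply: le_trans (nmD _ _); rewrite subrK. Qed.

Lemma nm_lt z w : (nm z < nm w) = (`|z| < `|w|).
Proof. by rewrite -rc_lt -!nmE. Qed.

Lemma near_nm (a : K) (P : set K) :
  (\forall s \near a, P s) <-> exists2 e : R, 0 < e & forall s, nm (s - a) < e -> P s.
Proof.
split.
  case/nbhs_ballP => e /= e0 he.
  have er : e = rc K (nm e) by rewrite -nmE gtr0_norm.
  exists (nm e); first by rewrite nm_gt0 gt_eqF.
  move=> s hs; apply: he; rewrite -ball_normE /= distrC.
  by rewrite -(gtr0_norm e0) -nm_lt.
case=> e e0 he; have re0 : 0 < rc K e by rewrite -(rmorph0 (rc K)) rc_lt.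
apply/nbhs_ballP; exists (rc K e) => //=.
move=> s; rewrite -ball_normE /= => hs; apply: he.
by rewrite -(nm_rc (ltW e0)) nm_lt distrC (gtr0_norm re0).
Qed.

(** Turns limits in the field into limits of real numbers, where squeezing and
linear arithmetic apply. *)
Lemma cvg_nm (T : Type) (F : set_system T) {FF : Filter F} (g : T -> K) (l : K) :
  g @ F --> l <-> (fun t => nm (g t - l)) @ F --> (0 : R).
Proof.
split.
  move=> h; apply/cvgrPdist_lt => e e0.
  have /h : nbhs l [set s | nm (s - l) < e] by apply/near_nm; exists e.
  rewrite nbhs_simpl /=; apply: filterS => t /=.
  by rewrite sub0r normrN ger0_norm // nm_ge0.
move=> h A /near_nm [e e0 he].
move/cvgrPdist_lt: h => /(_ e e0) h; rewrite nbhs_simpl /=; apply: filterS h => t /=.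
rewrite sub0r normrN ger0_norm ?nm_ge0 //; exact: he.
Qed.

Lemma rcD (a b : R) : rc K (a + b) = rc K a + rc K b. Proof. exact: rmorphD. Qed.
Lemma rcB (a b : R) : rc K (a - b) = rc K a - rc K b. Proof. exact: rmorphB. Qed.
Lemma rcV (a : R) : rc K a^-1 = (rc K a)^-1. Proof. exact: fmorphV. Qed.
Lemma rcX (a : R) n : rc K (a ^+ n) = rc K a ^+ n. Proof. exact: rmorphXn. Qed.
Lemma rc_nat n : rc K n%:R = n%:R. Proof. exact: rmorph_nat. Qed.

Lemma cvg_of_bound u (l : K) (b : nat -> R) :
  (forall n, nm (u n - l) <= b n) -> b @ \oo --> (0 : R) -> u @ \oo --> l.
Proof.
move=> hb b0; apply/cvg_nm.
apply: (squeeze_cvgr (f := fun=> 0) (h := b)) => //; last exact: cvg_cst.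
by apply: nearW => n; rewrite nm_ge0 hb.
Qed.

End Norm.

(** Completeness enters only through the convergence of absolutely convergent
series. *)
Structure cpxField (R : realType) := CpxField {
  cf_norm :> normField R;
  abs_cvg : forall (a : nat -> cf_norm) (B : R),
    (forall n, \sum_(0 <= i < n) nm (a i) <= B) -> cvgn (partial_sum 0 a)
}.

(** * The complex numbers *)

Section ComplexInstance.
Variable R : realType.

Definition cnorm (z : R[i]) : R := ComplexField.Normc.normc z.

Lemma cnorm_ReIm (z : R[i]) :
  cnorm z = Num.sqrt (complex.Re (z : R[i]) ^+ 2 + complex.Im (z : R[i]) ^+ 2).
Proof. by rewrite /cnorm; case: z. Qed.

Lemma cnorm_le_ReIm (z : R[i]) : cnorm z <= `|complex.Re (z : R[i])| + `|complex.Im (z : R[i])|.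
Proof.
rewrite cnorm_ReIm; set p := complex.Re _; set q := complex.Im _.
rewrite -[leRHS]ger0_norm ?addr_ge0 // -[leRHS]sqrtr_sqr ler_wsqrtr //.
rewrite -(real_normK (num_real p)) -(real_normK (num_real q)).
have := normr_ge0 p; have := normr_ge0 q; nra.
Qed.

Lemma cnormE (z : R[i]) : `|z| = real_complex R (cnorm z).
Proof. by []. Qed.

Definition complex_normField : normField R :=
  @NormField R R[i] (real_complex R) cnorm cnormE (@lecR R).

(** The real and imaginary parts are absolutely convergent real series. *)
Lemma complex_abs_cvg (a : nat -> complex_normField) (B : R) :
  (forall n, \sum_(0 <= i < n) nm (a i) <= B) -> cvgn (partial_sum 0 a).
Proof.
move=> hB.
have real_part (g : nat -> R) : (forall i, `|g i| <= nm (a i)) -> cvgn (series g).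
  move=> hg; apply: normed_cvg; apply: nondecreasing_is_cvgn.
    by apply: nondecreasing_series => i _ _ /=.
  exists B => _ [n _ <-] /=.
  by apply: le_trans (hB n); rewrite /series /=; apply: ler_sum => i _; exact: hg.
have h1 : cvgn (series (fun i => complex.Re (a i : R[i]))).
  apply: real_part => i; rewrite [nm _]cnorm_ReIm -sqrtr_sqr ler_wsqrtr //.
  by rewrite lerDl sqr_ge0.
have h2 : cvgn (series (fun i => complex.Im (a i : R[i]))).
  apply: real_part => i; rewrite [nm _]cnorm_ReIm -sqrtr_sqr ler_wsqrtr //.
  by rewrite lerDr sqr_ge0.
move/cvg_ex: h1 => [l1 h1]; move/cvg_ex: h2 => [l2 h2].
apply/cvg_ex; exists ((l1 +i* l2)%C : complex_normField).
have h : (fun n => `|series (fun i => complex.Re (a i : R[i])) n - l1|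
     + `|series (fun i => complex.Im (a i : R[i])) n - l2|) @ \oo --> (0 : R).
  rewrite -[0]addr0; apply: cvgD; apply/norm_cvg0P/subr_cvg0 => //.
apply: (cvg_of_bound _ h) => n.
have re : complex.Re (partial_sum 0 a n : R[i]) = series (fun i => complex.Re (a i : R[i])) n.
  by rewrite /partial_sum /series /= raddf_sum.
have im : complex.Im (partial_sum 0 a n : R[i]) = series (fun i => complex.Im (a i : R[i])) n.
  by rewrite /partial_sum /series /= raddf_sum.
rewrite -re -im.
have -> : l1 = complex.Re ((l1 +i* l2)%C : R[i]) by [].
have -> : l2 = complex.Im ((complex.Re ((l1 +i* l2)%C : R[i]) +i* l2)%C : R[i]) by [].
rewrite -!raddfB; exact: cnorm_le_ReIm.
Qed.

Definition complex_cpxField : cpxField R := CpxField complex_abs_cvg.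

End ComplexInstance.

(** * Convergence of Lerch series *)

Section Convergence.
Variables (R : realType) (K : cpxField R).
Implicit Types (z w s : K) (u v a b : nat -> K).

Lemma cvg_lim_uniq u (l l' : K) : u @ \oo --> l -> u @ \oo --> l' -> l = l'.
Proof. exact: (cvg_unique (@norm_hausdorff K K)). Qed.

Lemma cvgKc (c : K) : (fun _ : nat => c) @ \oo --> c.
Proof. exact: cvg_cst. Qed.
Lemma cvgKD u v (l m : K) : u @ \oo --> l -> v @ \oo --> m ->
  (fun n => u n + v n) @ \oo --> l + m.
Proof. exact: cvgD. Qed.
Lemma cvgKB u v (l m : K) : u @ \oo --> l -> v @ \oo --> m ->
  (fun n => u n - v n) @ \oo --> l - m.
Proof. exact: cvgB. Qed.
Lemma cvgKM u v (l m : K) : u @ \oo --> l -> v @ \oo --> m ->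
  (fun n => u n * v n) @ \oo --> l * m.
Proof. exact: cvgM. Qed.
Lemma cvgK_ext u v (l : K) : (forall n, u n = v n) -> v @ \oo --> l -> u @ \oo --> l.
Proof. by move=> h; rewrite (funext h). Qed.
Lemma cvgKS u (l : K) : u @ \oo --> l -> (fun n => u n.+1) @ \oo --> l.
Proof. by move=> h; rewrite cvg_shiftS. Qed.
Lemma cvgKSI u (l : K) : (fun n => u n.+1) @ \oo --> l -> u @ \oo --> l.
Proof. by move=> h; rewrite -cvg_shiftS. Qed.
Lemma cvgKsum (I : Type) (s : seq I) (P : pred I) (u : I -> nat -> K) (l : I -> K) :
  (forall i, P i -> u i @ \oo --> l i) ->
  (fun n => \sum_(i <- s | P i) u i n) @ \oo --> \sum_(i <- s | P i) l i.
Proof.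
move=> h; elim: s => [|i s IH].
  rewrite big_nil (_ : (fun n => _) = fun=> 0); first exact: cvgKc.
  by apply/funext => n; rewrite big_nil.
rewrite big_cons.
have [Pi|nPi] := boolP (P i).
  rewrite (_ : (fun n => _) = fun n => u i n + \sum_(i <- s | P i) u i n).
    by apply: cvgKD; [exact: h|exact: IH].
  by apply/funext => n; rewrite big_cons Pi.
rewrite (_ : (fun n => _) = fun n => \sum_(i <- s | P i) u i n); first exact: IH.
by apply/funext => n; rewrite big_cons (negbTE nPi).
Qed.

Lemma limn_eq u (l : K) : u @ \oo --> l -> limn u = l.
Proof. by move=> h; apply: cvg_lim => //; exact: norm_hausdorff. Qed.

(** Passes to the limit in an error estimate without asking that the error itself
be expressed as a limit. *)
Lemma nm_lim_le u (l c : K) (b : R) :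
  u @ \oo --> l -> (\forall n \near \oo, nm (u n - c) <= b) -> nm (l - c) <= b.
Proof.
move=> /cvg_nm h hb.
have h2 : (fun n => b + nm (u n - l)) @ \oo --> b.
  by rewrite -[X in _ --> X]addr0; apply: cvgD => //; exact: cvg_cst.
apply: (cvgr_to_ge h2).
apply: filterS hb => n hn.
rewrite (_ : l - c = (u n - c) - (u n - l)); last by ring.
by apply: le_trans (nmD _ _) _; rewrite nmN; exact: lerD.
Qed.

Lemma nm_unity z : root_of_unity z -> nm z = 1.
Proof.
case=> n n0 /unity_rootP zn; apply/eqP.
by rewrite -(@pexpr_eq1 _ (nm z) n) ?nm_ge0 // -nmX zn nm1.
Qed.

(** Summation by parts, multiplied by [1 - z] to stay free of division. *)
Lemma abel_sum z b n :
  (1 - z) * (\sum_(0 <= i < n) z ^+ i * b i) =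
  b 0%N + \sum_(0 <= i < n) z ^+ i.+1 * (b i.+1 - b i) - z ^+ n * b n.
Proof.
elim: n => [|n IH]; first by rewrite !big_nil; ring.
by rewrite !big_nat_recr //= mulrDr IH !exprS; ring.
Qed.

Lemma sum_le_telescope (f b : nat -> R) n :
  (forall i, f i <= b i - b i.+1) -> \sum_(0 <= i < n) f i <= b 0%N - b n.
Proof.
move=> h; elim: n => [|n IH]; first by rewrite big_nil subrr.
by rewrite big_nat_recr //=; have := h n; lra.
Qed.

(** The partial sums of the powers of [z] stay bounded, so the first coefficient
alone controls the sum. *)
Lemma abel_bound z (b : nat -> R) n : nm z = 1 -> z != 1 ->
  (forall i, 0 <= b i) -> (forall i, b i.+1 <= b i) ->
  nm (\sum_(0 <= i < n) z ^+ i * rc K (b i)) <= 2 / nm (1 - z) * b 0%N.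
Proof.
move=> z1 zn1 b0 bd.
have d0 : 0 < nm (1 - z) by rewrite nm_gt0 subr_eq0 eq_sym.
rewrite mulrAC ler_pdivlMr // mulrC -nmM (abel_sum z (fun i => rc K (b i))).
apply: le_trans (nmD _ _) _; rewrite nmN nmM nmX z1 expr1n mul1r nm_rc //.
have h : nm (\sum_(0 <= i < n) z ^+ i.+1 * (rc K (b i.+1) - rc K (b i))) <= b 0%N - b n.
  apply: le_trans (nm_sum _ _ _) _.
  apply: sum_le_telescope => i.
  by rewrite nmM nmX z1 expr1n mul1r nmB -rcB nm_rc // subr_ge0.
have := nmD (rc K (b 0%N)) (\sum_(0 <= i < n) z ^+ i.+1 * (rc K (b i.+1) - rc K (b i))).
rewrite nm_rc //; lra.
Qed.

(** The estimate behind the limit in [mittag_leffler]: a block of the series is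
bounded by a constant over its first denominator, whatever its length and even
for exponent 1.  For [z <> 1] the powers of [z] oscillate.  For [z = 1] the
exponent is at least 2 and the block is compared with a telescoping sum.  The
shift [h] is bounded below by 1/2 because it will be the distance between an
integer and a half-integer. *)
Lemma lerch_part_bound z p : nm z = 1 -> (0 < p)%N -> (p, z) <> (1%N, 1) ->
  exists2 C : R, 0 <= C & forall (h : R) n, 2^-1 <= h ->
    nm (\sum_(0 <= i < n) z ^+ i * ((i%:R + rc K h)^-1) ^+ p) <= C / h.
Proof.
move=> z1 p0 pz.
have rcE (h : R) i : ((i%:R + rc K h)^-1) ^+ p = rc K ((i%:R + h)^-1 ^+ p).
  by rewrite rcX rcV rcD rc_nat.
have pow_le (h : R) k : 2^-1 <= h -> h^-1 ^+ k <= 2 ^+ k.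
  move=> h2; apply: lerXn2r; rewrite ?nnegrE ?invr_ge0 //; try lra.
  by rewrite -[leRHS]invrK lef_pV2 ?posrE; lra.
have [z1'|zn1] := eqVneq z 1.
  have p2 : (2 <= p)%N.
    by case: p p0 pz {rcE} => // -[|//] _; rewrite z1'.
  exists (3 * 2 ^+ (p - 2)); first by rewrite mulr_ge0 // exprn_ge0.
  move=> h n h2.
  apply: le_trans (nm_sum _ _ _) _.
  have -> : 3 * 2 ^+ (p - 2) / h = 3 * 2 ^+ (p - 2) / (0%:R + h) :> R by rewrite add0r.
  apply: (@le_trans _ _ (3 * 2 ^+ (p - 2) / (0%:R + h) - 3 * 2 ^+ (p - 2) / (n%:R + h))); last first.
    rewrite lerBlDr lerDl mulr_ge0 // ?invr_ge0 ?addr_ge0 ?ler0n ?mulr_ge0 ?exprn_ge0 //; lra.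
  apply: (sum_le_telescope (b := fun i => 3 * 2 ^+ (p - 2) / (i%:R + h))) => i.
  have ih : 2^-1 <= i%:R + h by have := ler0n R i; lra.
  have ip : 0 <= (i%:R + h)^-1 by rewrite invr_ge0; lra.
  rewrite nmM nmX z1 expr1n mul1r rcE nm_rc ?exprn_ge0 //.
  rewrite -[X in _ ^+ X](subnK p2) exprD.
  rewrite -mulrBr [3 * _]mulrC -mulrA.
  apply: ler_pM; rewrite ?exprn_ge0 ?pow_le //.
  rewrite -[i.+1%:R]natr1; set t := i%:R + h in ih *.
  have -> : i%:R + 1 + h = t + 1 by rewrite /t; ring.
  have t0 : 0 < t by lra.
  have t2 : t^-1 <= 2 by have := pow_le t 1%N ih; rewrite !expr1.
  have -> : 3 * (t^-1 - (t + 1)^-1) = 3 / (t * (t + 1)).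
    by field; rewrite !gt_eqF //; lra.
  rewrite ler_pdivlMr; last by rewrite mulr_gt0 //; lra.
  have -> : t^-1 ^+ 2 * (t * (t + 1)) = 1 + t^-1 by field; rewrite gt_eqF.
  lra.
exists (2 / nm (1 - z) * 2 ^+ p.-1).
  by rewrite !mulr_ge0 ?invr_ge0 ?nm_ge0 ?exprn_ge0.
move=> h n h2.
under eq_bigr => i _ do rewrite rcE.
have h0 : 0 < h by lra.
apply: le_trans (abel_bound (b := fun i => (i%:R + h)^-1 ^+ p) _ _ _ _ _) _ => //.
- by move=> i; rewrite exprn_ge0 // invr_ge0 addr_ge0 // ltW.
- move=> i; apply: lerXn2r; rewrite ?nnegrE ?invr_ge0 ?addr_ge0 ?(ltW h0) //.
  by rewrite lef_pV2 ?posrE ?ltr_wpDl // lerD2r ler_nat.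
rewrite add0r -[X in _ ^+ X](prednK p0) exprSr !mulrA ler_wpM2r ?invr_ge0 ?(ltW h0) //.
by rewrite ler_wpM2l ?pow_le // mulr_ge0 ?invr_ge0 ?nm_ge0.
Qed.

(** Large [k] are dominated by comparison with [k], and the finitely many others
are absorbed in the constant; a vanishing denominator contributes 0. *)
Lemma inv_shift_bound s : exists2 c : R, 1 <= c &
  forall k, nm ((k%:R + s)^-1) <= c / k.+1%:R.
Proof.
(* From M on, the modulus of k + s is at least (k + 1) / 2. *)
pose M := (Num.trunc (2 * nm s + 2)).+1.
have hM : 2 * nm s + 2 < M%:R by apply: truncnS_gt.
exists (2 + \sum_(0 <= k < M) nm ((k%:R + s)^-1) * k.+1%:R).
  have : 0 <= \sum_(0 <= k < M) nm ((k%:R + s)^-1) * k.+1%:R.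
    by apply: sumr_ge0 => i _; rewrite mulr_ge0 ?nm_ge0.
  lra.
move=> k; rewrite ler_pdivlMr ?ltr0n //.
case: (ltnP k M) => kM.
  rewrite big_mkord (bigD1 (Ordinal kM)) //=.
  have : 0 <= \sum_(i < M | i != Ordinal kM) nm ((i%:R + s)^-1) * i.+1%:R.
    by apply: sumr_ge0 => i _; rewrite mulr_ge0 ?nm_ge0.
  lra.
have h : 0 <= \sum_(0 <= k < M) nm ((k%:R + s)^-1) * k.+1%:R.
  by apply: sumr_ge0 => i _; rewrite mulr_ge0 ?nm_ge0.
apply: (@le_trans _ _ 2); last lra.
have kM' : M%:R <= k%:R :> R by rewrite ler_nat.
have := nm_ler_sub (k%:R : K) (- s); rewrite nm_nat nmN opprK => hk.
have s0 := nm_ge0 s.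
rewrite nmV mulrC ler_pdivrMr; last lra.
rewrite -[k.+1%:R]natr1; lra.
Qed.

(** Replacing the shift by 1 changes the terms by an absolutely summable amount.
This reduces conditional convergence to the single sequence of the [1 / (k+1)],
and makes the two halves of a symmetric sum cancel. *)
Lemma inv_shift_diff s : exists2 c : R, 0 <= c &
  forall k, nm ((k%:R + s)^-1 - k.+1%:R^-1) <= c / k.+1%:R ^+ 2.
Proof.
have [c c1 hc] := inv_shift_bound s.
exists (c * nm (1 - s) + nm s + 1).
  by have := nm_ge0 s; have := nm_ge0 (1 - s); nra.
move=> k; have k0 : 0 < k.+1%:R :> R by rewrite ltr0n.
have [ks|ks] := eqVneq (k%:R + s) 0.
  rewrite ks invr0 sub0r nmN nmV nm_nat.
  rewrite ler_pdivlMr ?exprn_gt0 // expr2 mulrA mulVf ?gt_eqF // mul1r.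
  have -> : s = - k%:R by apply/eqP; rewrite -addr_eq0 addrC ks.
  have := nm_ge0 (1 - - (k%:R : K)); rewrite nmN nm_nat -[k.+1%:R]natr1; nra.
have -> : (k%:R + s)^-1 - k.+1%:R^-1 = (1 - s) * (k%:R + s)^-1 * k.+1%:R^-1 :> K.
  by rewrite -[k.+1%:R]natr1; field; rewrite ks natr1 pnatr_eq0.
rewrite !nmM (nmV k.+1%:R) nm_nat expr2 invfM mulrA ler_wpM2r ?invr_ge0 ?(ltW k0) //.
have h := hc k.
apply: (@le_trans _ _ (nm (1 - s) * (c / k.+1%:R))); first by rewrite ler_wpM2l ?nm_ge0.
rewrite mulrA ler_wpM2r ?invr_ge0 ?(ltW k0) //.
have := nm_ge0 s; lra.
Qed.

Lemma sum_inv_sq n : \sum_(0 <= i < n) (i.+1%:R ^+ 2)^-1 <= 2 :> R.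
Proof.
case: n => [|n]; first by rewrite big_nil.
rewrite big_nat_recl //= expr1n invr1.
apply: (@le_trans _ _ (1 + (1%:R^-1 - n.+1%:R^-1))).
  rewrite lerD2l.
  apply: (sum_le_telescope (b := fun i => i.+1%:R^-1)) => i.
  have a0 : 0 < i.+1%:R :> R by rewrite ltr0n.
  have b0 : 0 < i.+2%:R :> R by rewrite ltr0n.
  have -> : i.+1%:R^-1 - i.+2%:R^-1 = (i.+1%:R * i.+2%:R)^-1 :> R.
    by rewrite -[i.+2%:R]natr1; field; rewrite nat1r natr1 !pnatr_eq0.
  rewrite lef_pV2 ?posrE ?exprn_gt0 ?mulr_gt0 // expr2.
  by rewrite ler_pM2r // ler_nat.
have : 0 <= n.+1%:R^-1 :> R by rewrite invr_ge0.
by rewrite invr1; move: (n.+1%:R^-1 : R) => t; lra.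
Qed.

(** The Lerch transcendent.  A vanishing denominator contributes nothing, since
[0^-1 = 0], so the definition also covers the poles in [s], with the singular
term left out. *)
Definition lerch z q s : K := series_sum 0 (fun k => z ^+ k * ((k%:R + s)^-1) ^+ q).

Lemma cvg_abel_inv z : nm z = 1 -> z != 1 ->
  cvgn (partial_sum 0 (fun k => z ^+ k * k.+1%:R^-1)).
Proof.
move=> z1 zn1; have zn1' : 1 - z != 0 by rewrite subr_eq0 eq_sym.
have h1 : cvgn (partial_sum 0 (fun i => z ^+ i.+1 * (i.+2%:R^-1 - i.+1%:R^-1))).
  apply: (@abs_cvg _ K _ 2) => n; apply: le_trans _ (sum_inv_sq n).
  apply: ler_sum => i _; rewrite nmM nmX z1 expr1n mul1r.
  have a0 : 0 < i.+1%:R :> R by rewrite ltr0n.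
  have b0 : 0 < i.+2%:R :> R by rewrite ltr0n.
  have -> : i.+2%:R^-1 - i.+1%:R^-1 = - (i.+1%:R * i.+2%:R)^-1 :> K.
    by rewrite -[i.+2%:R]natr1; field; rewrite nat1r natr1 !pnatr_eq0.
  rewrite nmN nmV nmM !nm_nat.
  rewrite lef_pV2 ?posrE ?exprn_gt0 ?mulr_gt0 // expr2.
  by rewrite ler_pM2l // ler_nat.
have h2 : (fun n => z ^+ n * n.+1%:R^-1) @ \oo --> (0 : K).
  apply: (cvg_of_bound (b := fun n => n.+1%:R^-1)); last exact: cvg_harmonic.
  by move=> n; rewrite subr0 nmM nmX z1 expr1n mul1r nmV nm_nat.
move/cvg_ex: h1 => [l h1].
apply/cvg_ex; exists ((1 - z)^-1 * (1 + l - 0)).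
rewrite (_ : partial_sum 0 _ = fun n => (1 - z)^-1 * (1 +
  partial_sum 0 (fun i => z ^+ i.+1 * (i.+2%:R^-1 - i.+1%:R^-1)) n - z ^+ n * n.+1%:R^-1)).
  apply: cvgKM; first exact: cvgKc.
  apply: cvgKB; last exact: h2.
  by apply: cvgKD; [exact: cvgKc|exact: h1].
apply/funext => n; apply: (mulfI zn1'); rewrite mulrA divff // mul1r /partial_sum.
by rewrite (abel_sum z (fun i => i.+1%:R^-1)) invr1.
Qed.

Lemma lerch_is_cvg z q s : nm z = 1 -> (0 < q)%N -> (q, z) <> (1%N, 1) ->
  cvgn (partial_sum 0 (fun k => z ^+ k * ((k%:R + s)^-1) ^+ q)).
Proof.
move=> z1 q0 qz; case: q q0 qz => // -[_ qz|q _ _].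
  have zn1 : z != 1 by apply/eqP => e; apply: qz; rewrite e.
  have [c c0 hc] := inv_shift_diff s.
  have h2 : cvgn (partial_sum 0 (fun k => z ^+ k * ((k%:R + s)^-1 - k.+1%:R^-1))).
    apply: (@abs_cvg _ K _ (c * 2)) => n.
    apply: (@le_trans _ _ (c * \sum_(0 <= i < n) (i.+1%:R ^+ 2)^-1)).
      rewrite mulr_sumr; apply: ler_sum => i _.
      by rewrite nmM nmX z1 expr1n mul1r.
    by rewrite ler_wpM2l // sum_inv_sq.
  move/cvg_ex: h2 => [l2 h2]; move/cvg_ex: (cvg_abel_inv z1 zn1) => [l1 h1].
  apply/cvg_ex; exists (l1 + l2).
  rewrite (_ : partial_sum 0 _ = fun n => partial_sum 0 (fun k => z ^+ k * k.+1%:R^-1) n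
    + partial_sum 0 (fun k => z ^+ k * ((k%:R + s)^-1 - k.+1%:R^-1)) n).
    by apply: cvgKD; [exact: h1|exact: h2].
  apply/funext => n /=; rewrite /partial_sum -big_split /=; apply: eq_bigr => i _.
  by rewrite expr1; ring.
have [c c1 hc] := inv_shift_bound s.
apply: (@abs_cvg _ K _ (c ^+ q.+2 * 2)) => n.
apply: (@le_trans _ _ (c ^+ q.+2 * \sum_(0 <= i < n) (i.+1%:R ^+ 2)^-1)).
  rewrite mulr_sumr; apply: ler_sum => i _.
  rewrite nmM nmX z1 expr1n mul1r nmX.
  have i1 : 1 <= i.+1%:R :> R by rewrite ler1n.
  apply: (@le_trans _ _ ((c / i.+1%:R) ^+ q.+2)).
    by apply: lerXn2r; rewrite ?nnegrE ?nm_ge0 //; apply: le_trans (nm_ge0 _) (hc i).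
  rewrite expr_div_n ler_wpM2l ?exprn_ge0 //; first lra.
  rewrite lef_pV2 ?posrE ?exprn_gt0 ?ltr0n // -[q.+2]addn2 exprD.
  by rewrite ler_peMl ?exprn_ge0 // exprn_ege1.
by rewrite ler_wpM2l ?sum_inv_sq // exprn_ge0 //; lra.
Qed.

Lemma lerch_cvg z q s : nm z = 1 -> (0 < q)%N -> (q, z) <> (1%N, 1) ->
  partial_sum 0 (fun k => z ^+ k * ((k%:R + s)^-1) ^+ q) @ \oo --> lerch z q s.
Proof. by move=> z1 q0 qz; apply: lerch_is_cvg. Qed.

End Convergence.

(** * Bilateral Lerch series *)

Section Lattice.
Variables (R : realType) (K : cpxField R).
Implicit Types (x y z s a : K) (F G : int -> K).

Lemma cvg_shift_sum (u : nat -> K) (l : K) :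
  partial_sum 0 (fun k => u k.+1) @ \oo --> l -> partial_sum 1 u @ \oo --> l.
Proof.
move=> h; apply: cvgKSI.
apply: (cvgK_ext (v := partial_sum 0 (fun k => u k.+1))); last first.
  exact: h.
by move=> n; rewrite /partial_sum /= big_add1.
Qed.

Lemma lerch_shift z q s : nm z = 1 -> (0 < q)%N -> (q, z) <> (1%N, 1) ->
  lerch z q s = (s^-1) ^+ q + z * lerch z q (s + 1).
Proof.
move=> z1 q0 qz.
apply: (cvg_lim_uniq (lerch_cvg z1 q0 qz)).
apply: cvgKSI.
apply: (cvgK_ext (v := fun n => (s^-1) ^+ q + z *
   partial_sum 0 (fun k => z ^+ k * ((k%:R + (s + 1))^-1) ^+ q) n)); last first.
  apply: cvgKD; first exact: cvgKc.
  by apply: cvgKM; [exact: cvgKc|exact: lerch_cvg].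
move=> n; rewrite /partial_sum /= big_nat_recl //= expr0 mul1r add0r.
congr (_ + _); rewrite mulr_sumr; apply: eq_bigr => i _.
by rewrite exprS mulrA -natr1 -addrA [1 + s]addrC.
Qed.

Lemma ti_lerch p z : nm z = 1 -> (0 < p)%N -> (p, z) <> (1%N, 1) ->
  ti p z = z * lerch z p 2^-1.
Proof.
move=> z1 p0 pz; apply: limn_eq; apply: cvg_shift_sum.
apply: (cvgK_ext (v := fun n => z *
   partial_sum 0 (fun k => z ^+ k * ((k%:R + 2^-1)^-1) ^+ p) n)); last first.
  by apply: cvgKM; [exact: cvgKc|exact: lerch_cvg].
move=> n; rewrite /partial_sum mulr_sumr; apply: eq_bigr => i _.
rewrite exprS -mulrA -exprVn; congr (_ * (_ * _^-1 ^+ _)).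
by rewrite -[i.+1%:R]natr1; field.
Qed.

Lemma Li_lerch p z : nm z = 1 -> (0 < p)%N -> (p, z) <> (1%N, 1) ->
  Li p z = lerch z p 0.
Proof.
move=> z1 p0 pz; rewrite lerch_shift // invr0 expr0n eqn0Ngt p0 add0r.
apply: limn_eq; apply: cvg_shift_sum.
apply: (cvgK_ext (v := fun n => z *
   partial_sum 0 (fun k => z ^+ k * ((k%:R + (0 + 1))^-1) ^+ p) n)); last first.
  by apply: cvgKM; [exact: cvgKc|exact: lerch_cvg].
move=> n; rewrite /partial_sum mulr_sumr; apply: eq_bigr => i _.
by rewrite exprS -mulrA -exprVn add0r natr1.
Qed.

Lemma nm_neq0 z : nm z = 1 -> z != 0.
Proof. by move=> h; rewrite -nm_gt0 h. Qed.

Lemma half_neq0 n : n%:R + 2^-1 != 0 :> K.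
Proof. by rewrite gt_eqF // ltr_wpDl ?ler0n // invr_gt0 ltr0n. Qed.

(** These are the coefficients attached to the poles of the integrand at the
nonnegative integers: shifting the argument by [n] removes [n] terms. *)
Lemma lerch_pos_half p y n : nm y = 1 -> (0 < p)%N -> (p, y) <> (1%N, 1) ->
  lerch y p (n%:R + 2^-1) = y ^- n.+1 * (ti p y - tsum n p y).
Proof.
move=> y1 p0 py; have yn0 := nm_neq0 y1.
elim: n => [|n IH].
  by rewrite /tsum big_geq // subr0 ti_lerch // expr1 mulKf // add0r.
have := lerch_shift (n%:R + 2^-1) y1 p0 py; rewrite IH => h.
have -> : n.+1%:R + 2^-1 = n%:R + 2^-1 + 1 :> K by rewrite -natr1; ring.
apply: (mulfI yn0).
rewrite -[LHS](addKr ((n%:R + 2^-1)^-1 ^+ p)) -h.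
rewrite /tsum [in RHS]big_nat_recr //= -/(tsum n p y).
have -> : n.+1%:R - 2^-1 = n%:R + 2^-1 :> K by rewrite -natr1; field.
rewrite exprVn [y ^+ n.+2]exprS invfM.
by field; rewrite yn0 !expf_neq0 // half_neq0.
Qed.

(** The same at the negative integers, where shifting adds [n] terms with negative
denominators. *)
Lemma lerch_neg_half p y n : nm y = 1 -> (0 < p)%N -> (p, y) <> (1%N, 1) ->
  lerch y p (2^-1 - n%:R) = y ^+ n * (ti p y * y^-1 + (-1) ^+ p * tsum n p y^-1).
Proof.
move=> y1 p0 py; have yn0 := nm_neq0 y1.
elim: n => [|n IH].
  by rewrite /tsum big_geq // mulr0 addr0 subr0 ti_lerch // mulrAC divff // !mul1r.
rewrite lerch_shift //.
have -> : 2^-1 - n.+1%:R + 1 = 2^-1 - n%:R :> K by rewrite -natr1; ring.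
rewrite IH /tsum [in RHS]big_nat_recr //= -/(tsum n p y^-1).
have -> : 2^-1 - n.+1%:R = - (n.+1%:R - 2^-1) :> K by ring.
have hn : n.+1%:R - 2^-1 != 0 :> K.
  have -> : n.+1%:R - 2^-1 = n%:R + 2^-1 :> K by rewrite -[n.+1%:R]natr1; field.
  exact: half_neq0.
rewrite invrN (exprNn (n.+1%:R - 2^-1)^-1) !exprVn exprS.
by field; rewrite yn0 !expf_neq0.
Qed.

(** Summation over [|k| <= N]; for [x = 1] the bilateral series converges only in
this symmetric sense. *)
Definition sym_sum (N : nat) F : K :=
  \sum_(0 <= n < N.+1) F n%:Z + \sum_(1 <= n < N.+1) F (- n%:Z).

(** The function Phi and, up to sign, its Taylor coefficients; as in [lerch] the
term of a vanishing denominator is left out. *)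
Definition bilerch x q a : K :=
  limn (fun N => sym_sum N (fun k => x ^ k * ((a + k%:~R)^-1) ^+ q)).

Lemma sym_sumE N x q a :
  sym_sum N (fun k => x ^ k * ((a + k%:~R)^-1) ^+ q) =
  \sum_(0 <= n < N.+1) x ^+ n * ((n%:R + a)^-1) ^+ q
  + (-1) ^+ q * \sum_(1 <= n < N.+1) (x^-1) ^+ n * ((n%:R - a)^-1) ^+ q.
Proof.
rewrite /sym_sum mulr_sumr; congr (_ + _); apply: eq_bigr => i _.
  by rewrite addrC.
have -> : a + (- i%:Z)%:~R = - (i%:R - a) by rewrite mulrNz opprB.
by rewrite -exprnN -exprVn invrN (exprNn (i%:R - a)^-1) mulrCA.
Qed.

Lemma sum_from1 (f : nat -> K) N :
  \sum_(1 <= n < N.+1) f n = \sum_(0 <= n < N.+1) f n - f 0%N.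
Proof. by rewrite [X in _ = X - _]big_ltn //= addrC addKr. Qed.

Lemma bilerch_cvg_lerch x q a : nm x = 1 -> (0 < q)%N -> (q, x) <> (1%N, 1) ->
  (fun N => sym_sum N (fun k => x ^ k * ((a + k%:~R)^-1) ^+ q)) @ \oo -->
  lerch x q a + (-1) ^+ q * (lerch x^-1 q (- a) - ((- a)^-1) ^+ q).
Proof.
move=> x1 q0 qx.
have xV1 : nm x^-1 = 1 by rewrite nmV x1 invr1.
have qxV : (q, x^-1) <> (1%N, 1).
  by case=> e1 e2; apply: qx; rewrite e1 -[x]invrK e2 invr1.
apply: (cvgK_ext (v := fun N =>
   partial_sum 0 (fun k => x ^+ k * ((k%:R + a)^-1) ^+ q) N.+1 +
   (-1) ^+ q * (partial_sum 0 (fun k => (x^-1) ^+ k * ((k%:R - a)^-1) ^+ q) N.+1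
    - ((- a)^-1) ^+ q))); last first.
  apply: cvgKD; first by apply: cvgKS; exact: lerch_cvg.
  apply: cvgKM; first exact: cvgKc.
  apply: cvgKB; last exact: cvgKc.
  by apply: cvgKS; exact: lerch_cvg.
by move=> N; rewrite sym_sumE sum_from1 /partial_sum expr0 mul1r sub0r.
Qed.

(** Opposite terms are paired, and both are close to [1 / (n+1)] up to sign. *)
Lemma bilerch_cvg_11 a :
  (fun N => sym_sum N (fun k => 1 ^ k * ((a + k%:~R)^-1) ^+ 1)) @ \oo -->
  a^-1 + series_sum 1 (fun k => (k%:R + a)^-1 - (k%:R - a)^-1).
Proof.
have [c1 c10 h1] := inv_shift_diff a; have [c2 c20 h2] := inv_shift_diff (- a).
have h : cvgn (partial_sum 0 (fun k => (k.+1%:R + a)^-1 - (k.+1%:R - a)^-1)).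
  apply: (@abs_cvg _ K _ ((c1 + c2) * 2)) => n.
  apply: (@le_trans _ _ ((c1 + c2) * \sum_(0 <= i < n) (i.+1%:R ^+ 2)^-1)); last first.
    by rewrite ler_wpM2l ?sum_inv_sq ?addr_ge0.
  rewrite mulr_sumr; apply: ler_sum => i _.
  rewrite (_ : (i.+1%:R + a)^-1 - (i.+1%:R - a)^-1 =
     ((i.+1%:R + a)^-1 - i.+2%:R^-1) - ((i.+1%:R - a)^-1 - i.+2%:R^-1)); last by ring.
  apply: le_trans (nmD _ _) _; rewrite nmN mulrDl.
  have mono c : 0 <= c -> c / i.+2%:R ^+ 2 <= c / i.+1%:R ^+ 2 :> R.
    move=> c0; rewrite ler_wpM2l // lef_pV2 ?posrE ?exprn_gt0 //.
    by rewrite lerXn2r ?nnegrE ?ler_nat.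
  by apply: lerD; apply: le_trans (mono _ _); rewrite ?h1 ?h2.
have h' : partial_sum 1 (fun k => (k%:R + a)^-1 - (k%:R - a)^-1) @ \oo -->
    series_sum 1 (fun k => (k%:R + a)^-1 - (k%:R - a)^-1).
  by move/cvg_ex: h => [l hl]; have hl' := @cvg_shift_sum (fun k => (k%:R + a)^-1 - (k%:R - a)^-1) _ hl; rewrite /series_sum (limn_eq hl').
apply: (cvgK_ext (v := fun N => a^-1 +
   partial_sum 1 (fun k => (k%:R + a)^-1 - (k%:R - a)^-1) N.+1)); last first.
  apply: cvgKD; first exact: cvgKc.
  by apply: (cvgKS h').
move=> N; rewrite sym_sumE /partial_sum big_ltn //= !expr1 expr0 !mul1r add0r.
rewrite -addrA; congr (_ + _); rewrite sumrB mulN1r; congr (_ - _).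
  by apply: eq_bigr => i _; rewrite !expr1n mul1r expr1.
by apply: eq_bigr => i _; rewrite expr1 invr1 expr1n mul1r.
Qed.

Lemma bilerch_cvg x q a : nm x = 1 -> (0 < q)%N ->
  (fun N => sym_sum N (fun k => x ^ k * ((a + k%:~R)^-1) ^+ q)) @ \oo --> bilerch x q a.
Proof.
move=> x1 q0.
have [/eqP[-> ->]|/eqP h] := boolP ((q, x) == (1%N, 1)).
  by have := bilerch_cvg_11 (a := a) => h; rewrite /bilerch (limn_eq h).
by have := bilerch_cvg_lerch (a := a) x1 q0 h => h'; rewrite /bilerch (limn_eq h').
Qed.

Lemma bilerch_lerch x q a : nm x = 1 -> (0 < q)%N -> (q, x) <> (1%N, 1) ->
  bilerch x q a = lerch x q a + (-1) ^+ q * (lerch x^-1 q (- a) - ((- a)^-1) ^+ q).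
Proof. by move=> x1 q0 qx; exact: limn_eq (bilerch_cvg_lerch x1 q0 qx). Qed.

Lemma Phi_bilerch x s : nm x = 1 -> Phi x s = bilerch x 1 s.
Proof.
move=> x1; rewrite /Phi; case: eqP => [->|xn1].
  rewrite div1r /bilerch (limn_eq (@bilerch_cvg_11 s)); congr (_ + series_sum 1 _).
  by apply/funext => k; rewrite !div1r.
rewrite bilerch_lerch //; last by case.
have phiT z t : phi z t = lerch z 1 t.
  by congr (series_sum 0 _); apply/funext => k; rewrite expr1.
by rewrite !phiT !expr1 invrN; ring.
Qed.

(** Moving the window of summation by one only exchanges the two extreme terms, so
quasi-periodicity of the bilateral series follows from its terms tending to 0. *)
Lemma sym_sum_shift N G :
  sym_sum N (fun k => G (k - 1)) = sym_sum N G + G (- N.+1%:Z) - G N%:Z.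
Proof.
elim: N => [|N IH].
  by rewrite /sym_sum !big_nat1 !big_geq // !addr0 sub0r; ring.
have zS F : sym_sum N.+1 F = sym_sum N F + F N.+1%:Z + F (- N.+1%:Z).
  by rewrite /sym_sum !(big_nat_recr N.+1) //=; ring.
rewrite !zS IH.
have -> : N.+1%:Z - 1 = N%:Z by lia.
have -> : - N.+1%:Z - 1 = - N.+2%:Z by lia.
ring.
Qed.

Lemma bilerch_term_cvg0 x q a (f : nat -> int) : nm x = 1 -> (0 < q)%N ->
  (exists s (e : bool), forall n, (a + (f n)%:~R) = (-1) ^+ e * (n%:R + s)) ->
  (fun n => x ^ f n * ((a + (f n)%:~R)^-1) ^+ q) @ \oo --> (0 : K).
Proof.
move=> x1 q0 [s [e fs]].
have [c c1 hc] := inv_shift_bound s.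
apply: (cvg_of_bound (b := fun n => c ^+ q * n.+1%:R^-1)).
  move=> n; rewrite subr0 nmM fs.
  have -> : nm (x ^ f n) = 1.
    by case: (f n) => m; rewrite /exprz ?nmV nmX x1 expr1n ?invr1.
  rewrite mul1r nmX invfM nmM -exprVn invrN1 nm_sign mul1r.
  apply: (@le_trans _ _ ((c / n.+1%:R) ^+ q)).
    by apply: lerXn2r; rewrite ?nnegrE ?nm_ge0 //; apply: le_trans (nm_ge0 _) (hc n).
  have n1 : 1 <= n.+1%:R :> R by rewrite ler1n.
  rewrite expr_div_n ler_wpM2l ?exprn_ge0 //; first lra.
  rewrite lef_pV2 ?posrE ?exprn_gt0 ?ltr0n // -[leLHS]expr1.
  by rewrite ler_weXn2l.
rewrite -[0](mulr0 (c ^+ q)); apply: cvgM; first exact: cvg_cst.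
exact: cvg_harmonic.
Qed.

Lemma bilerch_shift x q a : nm x = 1 -> (0 < q)%N -> bilerch x q (a - 1) = x * bilerch x q a.
Proof.
move=> x1 q0; have xn0 := nm_neq0 x1.
apply: (cvg_lim_uniq (bilerch_cvg x1 q0)).
pose G k := x ^ k * ((a + k%:~R)^-1) ^+ q.
apply: (cvgK_ext (v := fun N => x * (sym_sum N G + G (- N.+1%:Z) - G N%:Z))); last first.
  apply: cvgKM; first exact: cvgKc.
  rewrite -[X in _ --> X]subr0 -[X in _ --> X - _]addr0.
  apply: cvgKB; first apply: cvgKD.
  - exact: bilerch_cvg.
  - apply: bilerch_term_cvg0 => //; exists (1 - a), true => n.
    by rewrite expr1 mulrNz -[n.+1%:~R]natr1; ring.
  - apply: bilerch_term_cvg0 => //; exists a, false => n.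
    by rewrite expr0 mul1r addrC.
move=> N; rewrite -sym_sum_shift /sym_sum mulrDr !mulr_sumr.
have e k : x ^ k * ((a - 1 + k%:~R)^-1) ^+ q = x * G (k - 1).
  rewrite /G mulrA -[X in X * _ ^ _]expr1z -expfzDr // addrCA subrr addr0; congr (_ * _^-1 ^+ _).
  by rewrite intrD mulrNz; ring.
by congr (_ + _); apply: eq_bigr => i _; rewrite e.
Qed.

Lemma bilerch_half x q l : nm x = 1 -> (0 < q)%N ->
  bilerch x q (- l%:R - 2^-1) = x ^+ l * bilerch x q (- 2^-1).
Proof.
move=> x1 q0; elim: l => [|l IH]; first by rewrite oppr0 add0r mul1r.
rewrite exprS -mulrA -IH -bilerch_shift //; congr bilerch; rewrite -natr1; ring.
Qed.

(** Symmetric summation makes the cotangent-like function at [x = 1] odd; this is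
what justifies reading the two divergent coefficients as 0. *)
Lemma bilerch_odd a : bilerch 1 1 (- a) = - bilerch 1 1 a.
Proof.
have n1 : nm (1 : K) = 1 by exact: nm1.
apply: (cvg_lim_uniq (bilerch_cvg (a := - a) n1 (isT : (0 < 1)%N))).
apply: (cvgK_ext (v := fun N => 0 - sym_sum N (fun k => 1 ^ k * ((a + k%:~R)^-1) ^+ 1))); last first.
  by rewrite -[X in _ --> X]sub0r; apply: cvgKB; [exact: cvgKc|exact: bilerch_cvg].
move=> N; rewrite !sym_sumE.
have e (c b : K) m : c = 1 -> \sum_(m <= n < N.+1) c ^+ n * ((n%:R + b)^-1) ^+ 1
    = \sum_(m <= n < N.+1) (n%:R + b)^-1.
  by move=> ->; apply: eq_bigr => i _; rewrite expr1n mul1r expr1.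
rewrite !e ?invr1 // opprK big_ltn // [in RHS]big_ltn // !add0r invrN; ring.
Qed.

Lemma Li_coefE m x : nm x = 1 -> Li_coef m x = (-1) ^+ m * bilerch x m.+1 0.
Proof.
move=> x1; rewrite /Li_coef; case: ifPn => [/andP[/eqP -> /eqP ->]|h].
  have /eqP := bilerch_odd 0; rewrite oppr0 -addr_eq0 -mulr2n mulrn_eq0 /= => /eqP ->.
  by rewrite mulr0.
have h' : (m.+1, x) <> (1%N, 1) by case=> e1 e2; move: h; rewrite e1 e2 !eqxx.
have hV : (m.+1, x^-1) <> (1%N, 1).
  by case=> e1 e2; apply: h'; rewrite e1 -[x]invrK e2 invr1.
have xV1 : nm x^-1 = 1 by rewrite nmV x1 invr1.
rewrite bilerch_lerch // !Li_lerch // oppr0 invr0 expr0n /= subr0 mulrDr exprS mulN1r.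
by rewrite mulNr mulrN mulrA -expr2 sqrr_sign mul1r.
Qed.

(** At [x = 1], [m = 0] the value is 0, since the function is both odd and
1-periodic. *)
Lemma ti_coefE m x : nm x = 1 -> ti_coef m x = (-1) ^+ m * bilerch x m.+1 (- 2^-1).
Proof.
move=> x1; rewrite /ti_coef; case: ifPn => [/andP[/eqP -> /eqP ->]|h].
  have n1 : nm (1 : K) = 1 by exact: nm1.
  have := bilerch_shift 2^-1 n1 (isT : (0 < 1)%N); rewrite mul1r.
  have -> : 2^-1 - 1 = - 2^-1 :> K by field.
  rewrite bilerch_odd => /eqP; rewrite eq_sym -addr_eq0 -mulr2n mulrn_eq0 /= => /eqP ->.
  by rewrite oppr0 mulr0.
have h' : (m.+1, x) <> (1%N, 1) by case=> e1 e2; move: h; rewrite e1 e2 !eqxx.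
have hV : (m.+1, x^-1) <> (1%N, 1).
  by case=> e1 e2; apply: h'; rewrite e1 -[x]invrK e2 invr1.
have xV1 : nm x^-1 = 1 by rewrite nmV x1 invr1.
have xn0 := nm_neq0 x1.
rewrite bilerch_lerch // !ti_lerch // opprK [lerch x _ (- _)]lerch_shift //.
have -> : - 2^-1 + 1 = 2^-1 :> K by field.
rewrite !invrN (exprNn (2^-1)^-1) exprS mulVKf //.
have s : (-1) ^+ m * (-1) ^+ m = 1 :> K by rewrite -expr2 sqrr_sign.
set e := (-1) ^+ m in s *; set A := lerch x _ _; set B := lerch x^-1 _ _; set c := _^-1 ^+ _.
have -> : e * (-1 * e * c + x * A + -1 * e * (B - c)) = e * (x * A) - (e * e) * B by ring.
by rewrite s mul1r.
Qed.

End Lattice.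

(** * Partial fractions of a product of two poles *)

Section TermIdentity.
Variable F : fieldType.
Implicit Types u v d U V : F.

(** Multiplying by [d] lowers the exponent of the second pole by one, at the cost
of one boundary term: the sum telescopes by Pascal's rule. *)
Lemma prod_step p j U V d : d * (U * V) = U - V ->
  d * \sum_(0 <= i < j.+1) 'C(i + p, i)%:R * U ^+ (j - i).+1 * V ^+ (p.+1 + i) =
  \sum_(0 <= i < j.+1) 'C((i + p).-1, i)%:R * U ^+ (j - i).+1 * V ^+ (p + i)
  - 'C(j + p, j)%:R * V ^+ (p.+1 + j).
Proof.
move=> h; elim: j => [|j IH].
  rewrite !big_nat1 !bin0 !addn0 subn0 !expr1 !mul1r exprS.
  transitivity (d * (U * V) * V ^+ p); first ring.
  by rewrite h; ring.
have rec (f : nat -> F) : \sum_(0 <= i < j.+2) f i * U ^+ (j.+1 - i).+1 * V ^+ (p + i) =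
    U * (\sum_(0 <= i < j.+1) f i * U ^+ (j - i).+1 * V ^+ (p + i))
    + f j.+1 * U * V ^+ (p + j.+1).
  rewrite big_nat_recr //= subnn expr1 mulr_sumr; congr (_ + _).
  apply: eq_big_nat => i /andP[_ hi]; rewrite subSn // [U ^+ (j - i).+2]exprS; ring.
have rec' (f : nat -> F) : \sum_(0 <= i < j.+2) f i * U ^+ (j.+1 - i).+1 * V ^+ (p.+1 + i) =
    U * (\sum_(0 <= i < j.+1) f i * U ^+ (j - i).+1 * V ^+ (p.+1 + i))
    + f j.+1 * U * V ^+ (p.+1 + j.+1).
  rewrite big_nat_recr //= subnn expr1 mulr_sumr; congr (_ + _).
  apply: eq_big_nat => i /andP[_ hi]; rewrite subSn // [U ^+ (j - i).+2]exprS; ring.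
rewrite rec rec' mulrDr mulrCA IH.
rewrite !addSn /= !addnS !exprS binS natrD [V ^+ (p + j)]lock.
transitivity (U * (\sum_(0 <= i < j.+1) 'C((i + p).-1, i)%:R * U ^+ (j - i).+1 * V ^+ (p + i) -
     'C(j + p, j)%:R * (V * locked (V ^+ (p + j)))) + ('C(j + p, j.+1)%:R + 'C(j + p, j)%:R) * (d * (U * V)) * (V * locked (V ^+ (p + j)))).
  ring.
rewrite h; ring.
Qed.

Lemma hockey_stick p j : (\sum_(0 <= i < p) 'C(i + j, j) = 'C(j + p, j.+1))%N.
Proof.
elim: p => [|p IH]; first by rewrite big_nil addn0 bin_small.
by rewrite big_nat_recr //= IH addnS binS addnC [(p + j)%N]addnC addnC.
Qed.

Lemma prod_partial_fractions_generic p j u v d : v = u + d -> d != 0 -> u != 0 -> v != 0 ->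
  \sum_(0 <= i < j.+1) 'C((i + p).-1, i)%:R * u^-1 ^+ (j - i).+1 * v^-1 ^+ (p + i) =
  d^-1 ^+ p * u^-1 ^+ j.+1
  - \sum_(0 <= i < p) d^-1 ^+ (p - i) * 'C(i + j, j)%:R * v^-1 ^+ (i.+1 + j).
Proof.
move=> vE d0 u0 v0.
have h : d * (u^-1 * v^-1) = u^-1 - v^-1 by rewrite vE; field; rewrite -vE v0.
elim: p => [|p IH].
  rewrite [X in _ - X]big_geq // subr0 expr0 mul1r big_nat_recl // subn0 bin0 mul1r mulr1.
  rewrite big1_seq ?addr0 // => i _.
  by rewrite addn0 /= bin_small // !mul0r.
apply: (mulfI d0).
under [in LHS]eq_bigr => i _ do rewrite addnS /=.
rewrite (prod_step _ _ h) IH mulrBr [d^-1 ^+ p.+1]exprS -[d^-1 * _ * _]mulrA (mulVKf d0) -addrA -opprD; congr (_ - _).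
rewrite [in RHS]big_nat_recr //= subSnn expr1 mulrDr; congr (_ + _).
  rewrite mulr_sumr; apply: eq_big_nat => i /andP[_ hi].
  by rewrite subSn 1?ltnW // [d^-1 ^+ _.+1]exprS -!mulrA (mulVKf d0).
by rewrite -!mulrA (mulVKf d0) addSn addnC.
Qed.

(** With [u = a + k], [v = a + l + 1/2] and [d = v - u], this compares, up to a
sign, the coefficient of [(s - a)^j] in [1 / ((s + k) (s + l + 1/2)^p)]
(left) with the contributions of the principal parts at the two poles (right).
When [a] is itself a pole, [u] or [v] vanishes and its negative powers with it;
the two correction terms on the left account for the coefficient that the
remaining factor has there, by the hockey-stick identity when [u = 0]. *)
Lemma prod_partial_fractions p j u v d : v = u + d -> d != 0 ->
  \sum_(0 <= i < j.+1) 'C((i + p.+1).-1, i)%:R * u^-1 ^+ (j - i).+1 * v^-1 ^+ (p.+1 + i)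
  - (u == 0)%:R * ('C(j + p.+1, j.+1)%:R * v^-1 ^+ (p.+1 + j.+1))
  + (v == 0)%:R * ((-1) ^+ p.+1 * u^-1 ^+ (p.+1 + j.+1)) =
  d^-1 ^+ p.+1 * u^-1 ^+ j.+1
  - \sum_(0 <= i < p.+1) d^-1 ^+ (p.+1 - i) * 'C(i + j, j)%:R * v^-1 ^+ (i.+1 + j).
Proof.
move=> vE d0.
have [u0|u0] := eqVneq u 0.
  have vd : v = d by rewrite vE u0 add0r.
  rewrite vd (negbTE d0) u0 invr0 mul0r addr0 expr0n /= mulr0 mul1r sub0r.
  rewrite big1_seq ?add0r; last by move=> i _; rewrite expr0n /= mulr0 mul0r.
  congr (- _).
  rewrite -hockey_stick natr_sum mulr_suml; apply: eq_big_nat => i /andP[_ hi].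
  rewrite mulrAC -exprD mulrC. congr (_ ^+ _ * _); lia.
have [v0|v0] := eqVneq v 0.
  have ud : u = - d by apply/eqP; rewrite -addr_eq0 -vE v0.
  rewrite v0 invr0 !mul0r !subr0 mul1r.
  rewrite big1_seq ?add0r; last by move=> i _; rewrite expr0n /= mulr0.
  rewrite [X in _ = _ - X]big1_seq ?subr0; last by move=> i _; rewrite expr0n /= mulr0.
  by rewrite exprD mulrA -exprMn ud invrN mulN1r opprK.
by rewrite mul0r subr0 mul0r addr0 (prod_partial_fractions_generic _ _ vE).
Qed.

End TermIdentity.

(** * The truncated Mittag-Leffler expansion *)

Section Truncated.
Variables (R : realType) (K : cpxField R).
Implicit Types (x y a s : K) (F G : int -> K).

Definition sym_range (N : nat) : seq int :=
  [seq n%:Z | n <- index_iota 0 N.+1] ++ [seq - n%:Z | n <- index_iota 1 N.+1].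

Lemma sym_sum_big N F : sym_sum N F = \sum_(k <- sym_range N) F k.
Proof. by rewrite /sym_range big_cat !big_map. Qed.

Definition lerch_part y q s N : K := partial_sum 0 (fun l => y ^+ l * ((l%:R + s)^-1) ^+ q) N.

(** An integer and a half-integer never coincide: twice the difference is odd. *)
Lemma half_int_neq0 (l : nat) (k : int) : l%:R + 2^-1 - k%:~R != 0 :> K.
Proof.
have n20 : 2 != 0 :> K by rewrite pnatr_eq0.
apply/eqP => /(congr1 (fun z => z * 2)); rewrite mulrBl mulrDl mulVf // mul0r.
have -> : l%:R * 2 + 1 - k%:~R * 2 = (l%:Z * 2 + 1 - k * 2)%:~R :> K.
  by rewrite intrB intrD !intrM.
move/eqP; rewrite intr_eq0 => /eqP; lia.
Qed.

(** [prod_partial_fractions] weighted by [x^k y^l] and summed over a rectangle. *)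
Lemma trunc_identity x y a p j N M :
  \sum_(0 <= i < j.+1) 'C((i + p.+1).-1, i)%:R
     * sym_sum M (fun k => x ^ k * ((a + k%:~R)^-1) ^+ (j - i).+1) * lerch_part y (p.+1 + i) (a + 2^-1) N
  - sym_sum M (fun k => x ^ k * (a + k%:~R == 0)%:R)
     * ('C(j + p.+1, j.+1)%:R * lerch_part y (p.+1 + j.+1) (a + 2^-1) N)
  + (\sum_(0 <= l < N) y ^+ l * (l%:R + (a + 2^-1) == 0)%:R)
     * ((-1) ^+ p.+1 * sym_sum M (fun k => x ^ k * ((a + k%:~R)^-1) ^+ (p.+1 + j.+1)))
  = sym_sum M (fun k => x ^ k * ((a + k%:~R)^-1) ^+ j.+1 * lerch_part y p.+1 (2^-1 - k%:~R) N)
  - \sum_(0 <= l < N) y ^+ l * \sum_(0 <= i < p.+1) 'C(i + j, j)%:R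
      * ((l%:R + (a + 2^-1))^-1) ^+ (i.+1 + j)
      * sym_sum M (fun k => x ^ k * ((l%:R + 2^-1 - k%:~R)^-1) ^+ (p.+1 - i)).
Proof.
pose U (k : int) : K := (a + k%:~R)^-1.
pose V (l : nat) : K := (l%:R + (a + 2^-1))^-1.
pose d (l : nat) (k : int) : K := l%:R + 2^-1 - k%:~R.
pose TA k l := \sum_(0 <= i < j.+1) 'C((i + p.+1).-1, i)%:R * U k ^+ (j - i).+1 * V l ^+ (p.+1 + i).
pose TB k l : K := (a + k%:~R == 0)%:R * ('C(j + p.+1, j.+1)%:R * V l ^+ (p.+1 + j.+1)).
pose TC k l : K := (l%:R + (a + 2^-1) == 0)%:R * ((-1) ^+ p.+1 * U k ^+ (p.+1 + j.+1)).
pose TD k l : K := (d l k)^-1 ^+ p.+1 * U k ^+ j.+1.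
pose TE k l : K := \sum_(0 <= i < p.+1) (d l k)^-1 ^+ (p.+1 - i) * 'C(i + j, j)%:R * V l ^+ (i.+1 + j).
have key k l : TA k l - TB k l + TC k l = TD k l - TE k l.
  by apply: prod_partial_fractions; [rewrite /d; ring|exact: half_int_neq0].
transitivity (\sum_(k <- sym_range M) \sum_(0 <= l < N) x ^ k * y ^+ l * (TA k l - TB k l + TC k l)).
  symmetry.
  under eq_bigr => k _ do under eq_bigr => l _ do rewrite mulrDr mulrBr.
  under eq_bigr => k _ do rewrite big_split sumrB /=.
  rewrite big_split sumrB /=; congr (_ - _ + _).
  - under eq_bigr => k _ do under eq_bigr => l _ do rewrite mulr_sumr.
    under eq_bigr => k _ do rewrite exchange_big /=.
    rewrite exchange_big /=; apply: eq_bigr => i _.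
    rewrite -mulrA sym_sum_big /lerch_part /partial_sum big_distrlr /= mulr_sumr; apply: eq_bigr => k _.
    by rewrite mulr_sumr; apply: eq_bigr => l _; rewrite /U /V; ring.
  - rewrite sym_sum_big /lerch_part /partial_sum mulr_sumr big_distrlr /=; apply: eq_bigr => k _.
    by apply: eq_bigr => l _; rewrite /TB /V; ring.
  - rewrite mulrC sym_sum_big /lerch_part /partial_sum [X in X * _]mulr_sumr big_distrlr /=; apply: eq_bigr => k _.
    by apply: eq_bigr => l _; rewrite /TC /U; ring.
under eq_bigr => k _ do under eq_bigr => l _ do rewrite key mulrBr.
under eq_bigr => k _ do rewrite sumrB.
rewrite sumrB; congr (_ - _).
  rewrite sym_sum_big; apply: eq_bigr => k _; rewrite /lerch_part /partial_sum mulr_sumr; apply: eq_bigr => l _.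
  by rewrite /TD /d /U addrA; ring.
rewrite exchange_big /=; apply: eq_bigr => l _.
under eq_bigr => k _ do rewrite mulr_sumr.
rewrite exchange_big /= mulr_sumr; apply: eq_bigr => i _.
rewrite sym_sum_big !mulr_sumr; apply: eq_bigr => k _.
by rewrite /d /V; ring.
Qed.

(** The value of the factor over the integers at the half-integer poles; moving the
pole by [l] only multiplies it by [x^l]. *)
Lemma sym_sum_half_cvg x q l : nm x = 1 ->
  (fun M => sym_sum M (fun k => x ^ k * ((l%:R + 2^-1 - k%:~R)^-1) ^+ q.+1)) @ \oo -->
  - (x ^+ l * ti_coef q x : K).
Proof.
move=> x1.
apply: (cvgK_ext (v := fun M => (-1) ^+ q.+1 *
   sym_sum M (fun k => x ^ k * ((- l%:R - 2^-1 + k%:~R)^-1) ^+ q.+1))); last first.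
  have -> : - (x ^+ l * ti_coef q x) = (-1) ^+ q.+1 * bilerch x q.+1 (- l%:R - 2^-1) :> K.
    by rewrite bilerch_half // ti_coefE // exprS; ring.
  by apply: cvgKM; [exact: cvgKc|exact: bilerch_cvg].
move=> M; rewrite !sym_sum_big mulr_sumr; apply: eq_bigr => k _.
have -> : l%:R + 2^-1 - k%:~R = - (- l%:R - 2^-1 + k%:~R) :> K by ring.
by rewrite invrN (exprNn (_ + _)^-1); ring.
Qed.

(** The contributions of the half-integer poles, up to the sign [(-1)^(j+1)]. *)
Definition half_sum x y a p j : nat -> K :=
  partial_sum 0 (fun l => (x * y) ^+ l * \sum_(0 <= i < p.+1) 'C(i + j, j)%:R
     * ((l%:R + (a + 2^-1))^-1) ^+ (i.+1 + j) * ti_coef (p - i) x).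

(** Up to the sign [(-1)^j], the Laurent coefficient at [a] of the integrand
without its rational factor, where [t q] stands for the (possibly truncated)
sum of exponent [q] over the half-integers. *)
Definition laurent_sum x a p j (t : nat -> K) : K :=
  \sum_(0 <= i < j.+1) 'C((i + p.+1).-1, i)%:R * bilerch x (j - i).+1 a * t (p.+1 + i)%N
  - (a == 0)%:R * ('C(j + p.+1, j.+1)%:R * t (p.+1 + j.+1)%N)
  + (a + 2^-1 == 0)%:R * ((-1) ^+ p.+1 * bilerch x (p.+1 + j.+1) a).

Lemma trunc_limit x y a p j N : nm x = 1 -> (0 < N)%N ->
  (forall k : int, a + k%:~R = 0 -> k = 0) ->
  (forall l : nat, l%:R + (a + 2^-1) = 0 -> l = 0%N) ->
  (fun M => sym_sum M (fun k => x ^ k * ((a + k%:~R)^-1) ^+ j.+1 * lerch_part y p.+1 (2^-1 - k%:~R) N))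
   @ \oo --> laurent_sum x a p j (fun q => lerch_part y q (a + 2^-1) N) - half_sum x y a p j N.
Proof.
move=> x1 N0 ha hh.
have dk M : sym_sum M (fun k => x ^ k * (a + k%:~R == 0)%:R) = (a == 0)%:R :> K.
  have z k : k != 0 -> x ^ k * (a + k%:~R == 0)%:R = 0 :> K.
    move=> k0; case: eqP => [/ha e|_]; last by rewrite mulr0.
    by rewrite e eqxx in k0.
  rewrite /sym_sum big_ltn //= expr0z mul1r addr0 big1_seq ?addr0 => [|i].
    rewrite big1_seq ?addr0 // => i; rewrite mem_index_iota => /= hi.
    apply: z; lia.
  rewrite mem_index_iota => /= hi; apply: z; lia.
have dl : \sum_(0 <= l < N) y ^+ l * (l%:R + (a + 2^-1) == 0)%:R = (a + 2^-1 == 0)%:R :> K.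
  rewrite big_ltn // mul1r add0r big1_seq ?addr0 // => i.
  rewrite mem_index_iota => /= hi; case: eqP => [/hh e|_]; last by rewrite mulr0.
  by rewrite e in hi.
apply: (cvgK_ext (v := fun M =>
  (\sum_(0 <= i < j.+1) 'C((i + p.+1).-1, i)%:R
     * sym_sum M (fun k => x ^ k * ((a + k%:~R)^-1) ^+ (j - i).+1) * lerch_part y (p.+1 + i) (a + 2^-1) N
  - (a == 0)%:R
     * ('C(j + p.+1, j.+1)%:R * lerch_part y (p.+1 + j.+1) (a + 2^-1) N)
  + (a + 2^-1 == 0)%:R
     * ((-1) ^+ p.+1 * sym_sum M (fun k => x ^ k * ((a + k%:~R)^-1) ^+ (p.+1 + j.+1))))
  + \sum_(0 <= l < N) y ^+ l * \sum_(0 <= i < p.+1) 'C(i + j, j)%:R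
      * ((l%:R + (a + 2^-1))^-1) ^+ (i.+1 + j)
      * sym_sum M (fun k => x ^ k * ((l%:R + 2^-1 - k%:~R)^-1) ^+ (p.+1 - i)))).
  by move=> M; rewrite -(dk M) -dl trunc_identity subrK.
have -> : - half_sum x y a p j N =
   \sum_(0 <= l < N) y ^+ l * \sum_(0 <= i < p.+1 | (i < p.+1)%N) 'C(i + j, j)%:R
     * ((l%:R + (a + 2^-1))^-1) ^+ (i.+1 + j) * - (x ^+ l * ti_coef (p - i) x).
  rewrite /half_sum /partial_sum -sumrN; apply: eq_bigr => l _.
  rewrite exprMn !mulr_sumr -sumrN [in RHS]big_nat_cond [in LHS]big_nat.
  apply: congr_big => // i; first by rewrite andbb.
  by move=> _; ring.
apply: cvgKD; first apply: cvgKD; first apply: cvgKB.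
- apply: cvgKsum => i _; apply: cvgKM; last exact: cvgKc.
  by apply: cvgKM; [exact: cvgKc|exact: bilerch_cvg].
- exact: cvgKc.
- apply: cvgKM; first exact: cvgKc.
  by apply: cvgKM; [exact: cvgKc|exact: bilerch_cvg].
apply: cvgKsum => l _; apply: cvgKM; first exact: cvgKc.
apply: (cvgK_ext (v := fun M => \sum_(0 <= i < p.+1 | (i < p.+1)%N) 'C(i + j, j)%:R
      * ((l%:R + (a + 2^-1))^-1) ^+ (i.+1 + j)
      * sym_sum M (fun k => x ^ k * ((l%:R + 2^-1 - k%:~R)^-1) ^+ (p.+1 - i)))).
  by move=> M; rewrite big_nat [RHS]big_nat_cond; apply: congr_big => // i; rewrite andbb.
apply: cvgKsum => i hi; apply: cvgKM; first exact: cvgKc.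
by rewrite subSn //; exact: sym_sum_half_cvg.
Qed.

End Truncated.

(** * The limit of the truncated expansion *)

Section Estimates.
Variables (R : realType) (K : cpxField R).
Implicit Types (x y a s : K) (F G : int -> K).

Definition harm n : R := \sum_(0 <= i < n) i.+1%:R^-1.

Lemma harm_le m n : (m <= n)%N -> harm m <= harm n.
Proof.
move=> mn; rewrite /harm [leRHS](@big_cat_nat _ _ _ m) //= lerDl.
by apply: sumr_ge0 => i _; rewrite invr_ge0.
Qed.

Lemma harm_mean_cvg0 : (fun n => harm n.+1 / n.+1%:R) @ \oo --> (0 : R).
Proof.
have := @cesaro R harmonic 0 (@cvg_harmonic R).
rewrite /arithmetic_mean /series /=; apply: cvg_trans.
rewrite (_ : (fun n => harm n.+1 / n.+1%:R) =
  (fun n => n.+1%:R^-1 * \sum_(0 <= k < n.+1) k.+1%:R^-1)) //.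
by apply/funext => n; rewrite mulrC.
Qed.

(** Partial fractions in [n] turn the product into two harmonic sums divided by
[N]. *)
Lemma conv_sum_in N :
  \sum_(0 <= n < N.+1) (n.+1%:R * ((N - n)%:R + 2^-1))^-1 <= 3 * (harm N.+1 / N.+1%:R) :> R.
Proof.
have N0 : 0 < N.+1%:R :> R by rewrite ltr0n.
apply: (@le_trans _ _ (N.+1%:R^-1 * \sum_(0 <= n < N.+1) (n.+1%:R^-1 + 2 * (N - n).+1%:R^-1))).
  rewrite mulr_sumr; apply: ler_sum_nat => n /andP[_ hn].
  have n0 : 0 < n.+1%:R :> R by rewrite ltr0n.
  have m0 : 0 <= (N - n)%:R :> R by [].
  have nm : N.+1%:R = n.+1%:R + (N - n)%:R :> R by rewrite -natrD; congr (_%:R); lia.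
  rewrite nm -[(N - n).+1%:R]natr1; set p := n.+1%:R in n0 nm *; set q := (N - n)%:R in m0 nm *.
  have pq : 0 < p + q by rewrite -nm.
  rewrite -[leLHS]mul1r ler_pdivrMr; last by rewrite mulr_gt0 //; lra.
  have -> : (p + q)^-1 * (p^-1 + 2 * (q + 1)^-1) * (p * (q + 2^-1)) =
     ((q + 1 + 2 * p) * (q + 2^-1)) / ((p + q) * (q + 1)).
    by field; rewrite !gt_eqF //; lra.
  rewrite ler_pdivlMr ?mul1r; last by rewrite mulr_gt0 //; lra.
  nra.
rewrite big_split /= -mulr_sumr.
have -> : \sum_(0 <= i < N.+1) (N - i).+1%:R^-1 = harm N.+1.
  rewrite /harm [RHS]big_nat_rev /=; apply: eq_big_nat => i /andP[_ hi].
  by congr (_%:R^-1); lia.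
rewrite -/(harm N.+1) le_eqVlt; apply/orP; left; apply/eqP; ring.
Qed.

(** The sum over [n > N] telescopes into a difference of harmonic numbers, bounded
uniformly in the length [M]. *)
Lemma conv_sum_out N M :
  \sum_(0 <= i < M) ((N.+1 + i).+1%:R * (i.+1%:R + 2^-1))^-1 <= harm N.+1 / N.+1%:R :> R.
Proof.
have N0 : 0 < N.+1%:R :> R by rewrite ltr0n.
rewrite ler_pdivlMr // mulr_suml.
apply: (@le_trans _ _ (\sum_(0 <= i < M) (i.+1%:R^-1 - (N.+1 + i).+1%:R^-1))).
  apply: ler_sum_nat => i _.
  have i0 : 0 < i.+1%:R :> R by rewrite ltr0n.
  rewrite -addnS natrD; set p := N.+1%:R in N0 *; set q := i.+1%:R in i0 *.
  have -> : q^-1 - (p + q)^-1 = p / ((p + q) * q).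
    by field; rewrite !gt_eqF // addr_gt0.
  rewrite mulrC ler_wpM2l ?(ltW N0) // lef_pV2 ?posrE ?mulr_gt0 ?addr_gt0 //.
  by rewrite ler_pM2l ?addr_gt0 // lerDl.
have -> : harm N.+1 = \sum_(0 <= i < M) i.+1%:R^-1 - (harm M - harm N.+1) by rewrite -/(harm M); ring.
rewrite sumrB lerD2l lerN2.
have -> : \sum_(0 <= i < M) (N.+1 + i).+1%:R^-1 = harm (N.+1 + M) - harm N.+1.
  rewrite /harm [in RHS](@big_cat_nat _ _ _ N.+1) ?leq_addr //= [RHS]addrC addKr.
  by rewrite -{2}[N.+1]add0n big_addn addnC addnK; apply: eq_bigr => i _; rewrite addnC.
by rewrite lerD2r harm_le // leq_addl.
Qed.

Lemma nm_expz x (k : int) : nm x = 1 -> nm (x ^ k) = 1.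
Proof. by move=> x1; case: k => m; rewrite /exprz ?nmV nmX x1 expr1n ?invr1. Qed.

Lemma lerch_part_cat y q s N M : y != 0 -> (N <= M)%N ->
  lerch_part y q s M = lerch_part y q s N + y ^+ N * lerch_part y q (s + N%:R) (M - N).
Proof.
move=> y0 NM; rewrite /lerch_part /partial_sum (@big_cat_nat _ _ _ N) //=; congr (_ + _).
rewrite -{1}[N]add0n big_addn mulr_sumr; apply: eq_bigr => i _.
rewrite exprD natrD; have -> : i%:R + N%:R + s = i%:R + (s + N%:R) by ring.
by rewrite mulrAC mulrC mulrA.
Qed.

Lemma lerch_part_rev y q s N : y != 0 ->
  lerch_part y q s N.+1 = (-1) ^+ q * y ^+ N * lerch_part y^-1 q (- s - N%:R) N.+1.
Proof.
move=> y0; rewrite /lerch_part /partial_sum big_nat_rev /= mulr_sumr; apply: eq_big_nat => i /andP[_ hi].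
have -> : (0 + N.+1 - i.+1 = N - i)%N by lia.
have iN : (i <= N)%N by lia.
rewrite natrB //; have -> : N%:R - i%:R + s = - (i%:R + (- s - N%:R)) by ring.
have e : y ^+ N = y ^+ (N - i) * y ^+ i by rewrite -exprD subnK.
rewrite invrN (exprNn (_ + _)^-1) e (exprVn y i).
set w := _ ^+ q; set w' := _ ^+ q; field.
by rewrite expf_neq0.
Qed.

(** For [|k| <= N] the error of truncation is a tail of the series; for [|k| > N]
the truncated sum is itself small, all its denominators being large.  In each
case [lerch_part_bound] applies, for [k > N] after reversing the order of the
sum, which replaces [y] by its inverse. *)
Lemma tail_bounds y p : nm y = 1 -> (p.+1, y) <> (1%N, 1) ->
  exists2 C : R, 0 <= C & forall N,
  [/\ forall n, (n <= N)%N ->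
        nm (lerch_part y p.+1 (2^-1 - n%:R) N - lerch y p.+1 (2^-1 - n%:R)) <= C / ((N - n)%:R + 2^-1),
      forall n, (n <= N)%N ->
        nm (lerch_part y p.+1 (2^-1 + n%:R) N - lerch y p.+1 (2^-1 + n%:R)) <= C / ((N - n)%:R + 2^-1),
      forall n, (N < n)%N -> nm (lerch_part y p.+1 (2^-1 - n%:R) N) <= C / ((n - N)%:R + 2^-1) &
      forall n, (N < n)%N -> nm (lerch_part y p.+1 (2^-1 + n%:R) N) <= C / ((n - N)%:R + 2^-1)].
Proof.
move=> y1 py; have y0 := nm_neq0 y1.
have yV1 : nm y^-1 = 1 by rewrite nmV y1 invr1.
have pyV : (p.+1, y^-1) <> (1%N, 1).
  by case=> e1 e2; apply: py; rewrite e1 -[y]invrK e2 invr1.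
have [C1 C10 h1] := lerch_part_bound y1 (ltn0Sn p) py.
have [C2 C20 h2] := lerch_part_bound yV1 (ltn0Sn p) pyV.
have r2 : rc K 2^-1 = 2^-1 by rewrite rcV rc_nat.
have b1 (h : R) M : 2^-1 <= h -> nm (lerch_part y p.+1 (rc K h) M) <= C1 / h by exact: h1.
have b2 (h : R) M : 2^-1 <= h -> nm (lerch_part y^-1 p.+1 (rc K h) M) <= C2 / h by exact: h2.
have le1 (h g : R) : 2^-1 <= g -> g <= h -> C1 / h <= (C1 + C2) / g.
  move=> g2 gh; apply: ler_pM; rewrite ?invr_ge0 ?lerDl //; first lra.
  by rewrite lef_pV2 ?posrE //; lra.
have tail (h : R) N : 2^-1 <= h + N%:R ->
    nm (lerch_part y p.+1 (rc K h) N - lerch y p.+1 (rc K h)) <= C1 / (h + N%:R).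
  move=> hN; rewrite nmB.
  apply: (nm_lim_le (lerch_cvg (s := rc K h) y1 (ltn0Sn p) py)).
  exists N => // M /= NM.
  rewrite -/(lerch_part y p.+1 (rc K h) M) (lerch_part_cat _ _ y0 NM) addrC addKr nmM nmX y1 expr1n mul1r.
  by rewrite -rc_nat -rcD; exact: b1.
exists (C1 + C2); first exact: addr_ge0.
move=> N; split=> n hn.
- have nN : n%:R <= N%:R :> R by rewrite ler_nat.
  have -> : 2^-1 - n%:R = rc K (2^-1 - n%:R) by rewrite rcB r2 rc_nat.
  rewrite natrB //; apply: le_trans (tail _ _ _) (le1 _ _ _ _); lra.
- have nN : n%:R <= N%:R :> R by rewrite ler_nat.
  have n0 : 0 <= n%:R :> R by [].
  have -> : 2^-1 + n%:R = rc K (2^-1 + n%:R) by rewrite rcD r2 rc_nat.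
  rewrite natrB //; apply: le_trans (tail _ _ _) (le1 _ _ _ _); lra.
- have nN : N%:R + 1 <= n%:R :> R by rewrite natr1 ler_nat.
  case: N hn nN => [|N] hn nN.
    rewrite /lerch_part /partial_sum big_geq // nm0 mulr_ge0 ?addr_ge0 ?invr_ge0 //; lra.
  rewrite lerch_part_rev // !nmM nm_sign nmX y1 expr1n !mul1r.
  have -> : - (2^-1 - n%:R) - N%:R = rc K (n%:R - N%:R - 2^-1).
    by rewrite !rcB r2 !rc_nat; ring.
  rewrite -natr1 in nN.
  have e : n%:R - N%:R - 2^-1 = (n - N.+1)%:R + 2^-1 :> R.
    by rewrite natrB ?(ltnW hn) // -[N.+1%:R]natr1; field.
  apply: le_trans (b2 _ _ _) _; first lra.
  by rewrite e ler_wpM2r ?invr_ge0 ?addr_ge0 // lerDr.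
have nN : N%:R + 1 <= n%:R :> R by rewrite natr1 ler_nat.
have n0 : 0 <= N%:R :> R by [].
have -> : 2^-1 + n%:R = rc K (2^-1 + n%:R) by rewrite rcD r2 rc_nat.
rewrite natrB ?(ltnW hn) //; apply: le_trans (b1 _ _ _) (le1 _ _ _ _); lra.
Qed.

Lemma inv_pow_bound a j : exists2 E : R, 0 <= E &
  forall n, nm (((a + n%:R)^-1) ^+ j.+1) <= E / n.+1%:R /\ nm (((a - n%:R)^-1) ^+ j.+1) <= E / n.+1%:R.
Proof.
have [c1 c11 h1] := inv_shift_bound a; have [c2 c21 h2] := inv_shift_bound (- a).
have g (c : R) (z : K) n : 1 <= c -> c <= c1 + c2 -> nm z <= c / n.+1%:R -> nm (z ^+ j.+1) <= (c1 + c2) ^+ j.+1 / n.+1%:R.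
  move=> c10 cc hz; have n1 : 1 <= n.+1%:R :> R by rewrite ler1n.
  rewrite nmX; apply: (@le_trans _ _ ((c / n.+1%:R) ^+ j.+1)).
    by apply: lerXn2r; rewrite ?nnegrE ?nm_ge0 //; apply: le_trans (nm_ge0 _) hz.
  rewrite expr_div_n; apply: ler_pM; rewrite ?invr_ge0 ?exprn_ge0 //; try lra.
    by apply: lerXn2r; rewrite ?nnegrE //; lra.
  rewrite lef_pV2 ?posrE ?exprn_gt0 ?ltr0n // -[leLHS]expr1.
  by rewrite ler_weXn2l.
exists ((c1 + c2) ^+ j.+1); first by rewrite exprn_ge0 // addr_ge0 //; lra.
move=> n; split.
  apply: (g c1 _ _); rewrite ?lerDl //; [lra|by rewrite addrC].
apply: (g c2 _ _); rewrite ?lerDr //; first lra.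
by rewrite -[a - _]opprB invrN nmN.
Qed.

(** Compares the sum over [|k| <= M] of truncated coefficients with the sum over
[|k| <= N] of the full ones, uniformly in [M]; the uniformity is what allows
[M] to tend to infinity first. *)
Lemma trunc_error x y a p j : nm x = 1 -> nm y = 1 -> (p.+1, y) <> (1%N, 1) ->
  exists2 eps : nat -> R, eps @ \oo --> (0 : R) & forall N M, (N <= M)%N ->
  nm (sym_sum M (fun k => x ^ k * ((a + k%:~R)^-1) ^+ j.+1 * lerch_part y p.+1 (2^-1 - k%:~R) N)
    - sym_sum N (fun k => x ^ k * ((a + k%:~R)^-1) ^+ j.+1 * lerch y p.+1 (2^-1 - k%:~R))) <= eps N.
Proof.
move=> x1 y1 py.
have [C C0 hC] := tail_bounds y1 py.
have [E E0 hE] := inv_pow_bound a j.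
exists (fun N => 8 * (E * C) * (harm N.+1 / N.+1%:R)).
  rewrite -[0](mulr0 (8 * (E * C))); apply: cvgM; first exact: cvg_cst.
  exact: harm_mean_cvg0.
move=> N M NM.
have [t1 t2 t3 t4] := hC N.
pose u (k : int) := x ^ k * ((a + k%:~R)^-1) ^+ j.+1.
pose DN (k : int) := lerch_part y p.+1 (2^-1 - k%:~R) N.
pose D (k : int) := lerch y p.+1 (2^-1 - k%:~R).
have ub n : nm (u n%:Z) <= E / n.+1%:R /\ nm (u (- n%:Z)) <= E / n.+1%:R.
  by rewrite /u !nmM !nm_expz // !mul1r mulrNz; exact: hE.
(* Every product of a weight and an error has the shape summed in conv_sum_in and conv_sum_out. *)
have combine (A B e d : R) n m : 0 <= A -> 0 <= B -> A <= E / n.+1%:R -> B <= C / (m%:R + 2^-1) ->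
    A * B <= E * C * (n.+1%:R * (m%:R + 2^-1))^-1.
  move=> A0 B0 hA hB; rewrite invfM mulrACA; exact: ler_pM.
have -> : sym_sum M (fun k => u k * DN k) - sym_sum N (fun k => u k * D k) =
   \sum_(0 <= n < N.+1) u n%:Z * (DN n%:Z - D n%:Z)
   + \sum_(1 <= n < N.+1) u (- n%:Z) * (DN (- n%:Z) - D (- n%:Z))
   + (\sum_(N.+1 <= n < M.+1) u n%:Z * DN n%:Z + \sum_(N.+1 <= n < M.+1) u (- n%:Z) * DN (- n%:Z)).
  have sB (r : seq nat) (f : nat -> int) : \sum_(n <- r) u (f n) * (DN (f n) - D (f n)) =
     \sum_(n <- r) u (f n) * DN (f n) - \sum_(n <- r) u (f n) * D (f n).
    by rewrite -sumrB; apply: eq_bigr => i _; rewrite mulrBr.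
  rewrite /sym_sum (@big_cat_nat _ _ _ N.+1 0 M.+1) //= (@big_cat_nat _ _ _ N.+1 1 M.+1) //=.
  rewrite (sB _ (fun n => n%:Z)) (sB _ (fun n => - n%:Z)); ring.
have S1 : nm (\sum_(0 <= n < N.+1) u n%:Z * (DN n%:Z - D n%:Z)) <= 3 * (E * C) * (harm N.+1 / N.+1%:R).
  apply: le_trans (nm_sum _ _ _) _.
  apply: (@le_trans _ _ (E * C * \sum_(0 <= n < N.+1) (n.+1%:R * ((N - n)%:R + 2^-1))^-1)); last first.
    by rewrite -[3 * _ * _]mulrA mulrCA ler_wpM2l ?conv_sum_in ?mulr_ge0.
  rewrite mulr_sumr; apply: ler_sum_nat => n /andP[_ hn].
  by rewrite nmM; apply: combine; rewrite ?nm_ge0 ?(ub n).1 // t1.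
have S2 : nm (\sum_(1 <= n < N.+1) u (- n%:Z) * (DN (- n%:Z) - D (- n%:Z))) <= 3 * (E * C) * (harm N.+1 / N.+1%:R).
  apply: le_trans (nm_sum _ _ _) _.
  apply: (@le_trans _ _ (E * C * \sum_(0 <= n < N.+1) (n.+1%:R * ((N - n)%:R + 2^-1))^-1)); last first.
    by rewrite -[3 * _ * _]mulrA mulrCA ler_wpM2l ?conv_sum_in ?mulr_ge0.
  rewrite [X in _ <= _ * X]big_ltn // mulrDr -[leLHS]add0r; apply: lerD.
    by rewrite !mulr_ge0 ?invr_ge0 ?mulr_ge0 ?addr_ge0.
  rewrite mulr_sumr; apply: ler_sum_nat => n /andP[_ hn].
  rewrite nmM; apply: combine; rewrite ?nm_ge0 ?(ub n).2 //.
  by rewrite /DN /D mulrNz opprK t2.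
have out (f : nat -> K) : (forall n, (N < n)%N -> nm (f n) <= E * C * (n.+1%:R * ((n - N)%:R + 2^-1))^-1) ->
    nm (\sum_(N.+1 <= n < M.+1) f n) <= E * C * (harm N.+1 / N.+1%:R).
  move=> hf; apply: le_trans (nm_sum _ _ _) _.
  apply: (@le_trans _ _ (E * C * \sum_(0 <= i < M.+1 - N.+1) ((N.+1 + i).+1%:R * (i.+1%:R + 2^-1))^-1)).
    rewrite -{1}[N.+1]add0n big_addn mulr_sumr; apply: ler_sum_nat => i _.
    have := hf (i + N.+1)%N; rewrite addnC.
    have -> : (N.+1 + i - N = i.+1)%N by lia.
    by apply; lia.
  by rewrite ler_wpM2l ?conv_sum_out // mulr_ge0.
have S3 : nm (\sum_(N.+1 <= n < M.+1) u n%:Z * DN n%:Z) <= E * C * (harm N.+1 / N.+1%:R).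
  apply: out => n hn.
  by rewrite nmM; apply: combine; rewrite ?nm_ge0 ?(ub n).1 // t3.
have S4 : nm (\sum_(N.+1 <= n < M.+1) u (- n%:Z) * DN (- n%:Z)) <= E * C * (harm N.+1 / N.+1%:R).
  apply: out => n hn.
  rewrite nmM; apply: combine; rewrite ?nm_ge0 ?(ub n).2 //.
  by rewrite /DN mulrNz opprK t4.
apply: le_trans (nmD _ _) _; apply: le_trans (lerD (nmD _ _) (nmD _ _)) _.
set w := _ / _ in S1 S2 S3 S4 *; lra.
Qed.

Definition pole_sum x y a p j N : K :=
  sym_sum N (fun k => x ^ k * ((a + k%:~R)^-1) ^+ j.+1 * lerch y p.+1 (2^-1 - k%:~R)).

(** The hypotheses on [a] say that it is no pole of the integrand without its
rational factor, except possibly 0 or -1/2. *)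
Lemma mittag_leffler x y a p j : nm x = 1 -> nm y = 1 -> (p.+1, y) <> (1%N, 1) ->
  (forall k : int, a + k%:~R = 0 -> k = 0) ->
  (forall l : nat, l%:R + (a + 2^-1) = 0 -> l = 0%N) ->
  (fun N => pole_sum x y a p j N + half_sum x y a p j N) @ \oo -->
  laurent_sum x a p j (fun q => lerch y q (a + 2^-1)).
Proof.
move=> x1 y1 py ha hh.
have [eps eps0 heps] := trunc_error a j x1 y1 py.
pose GN N := laurent_sum x a p j (fun q => lerch_part y q (a + 2^-1) N).
have GNc : GN @ \oo --> laurent_sum x a p j (fun q => lerch y q (a + 2^-1)).
  have tc q : (0 < q)%N -> (q, y) <> (1%N, 1) -> lerch_part y q (a + 2^-1) @ \oo --> lerch y q (a + 2^-1).
    exact: lerch_cvg.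
  have big q : (p.+1 <= q)%N -> lerch_part y q (a + 2^-1) @ \oo --> lerch y q (a + 2^-1).
    move=> pq; apply: tc; first by lia.
    case=> e1 e2; apply: py; rewrite e2; congr (_, _); lia.
  apply: cvgKD; last exact: cvgKc.
  apply: cvgKB.
    by apply: cvgKsum => i _; apply: cvgKM; [exact: cvgKc|apply: big; lia].
  apply: cvgKM; first exact: cvgKc.
  by apply: cvgKM; [exact: cvgKc|apply: big; lia].
(* Shifted by one, as the pole at -1/2 is present only when N > 0. *)
have err0 : (fun N => (GN N - half_sum x y a p j N) - pole_sum x y a p j N) @ \oo --> (0 : K).
  apply: cvgKSI; apply: (cvg_of_bound (b := fun N => eps N.+1)); last first.
    by rewrite cvg_shiftS.
  move=> N; rewrite subr0.
  apply: (nm_lim_le (@trunc_limit _ _ x y a p j _ x1 (ltn0Sn N) ha hh)).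
  by exists N.+1 => // M /= NM; exact: heps.
apply: (cvgK_ext (v := fun N => GN N - ((GN N - half_sum x y a p j N) - pole_sum x y a p j N))).
  by move=> N; ring.
by rewrite -[X in _ --> X]subr0; apply: cvgKB.
Qed.

End Estimates.

(** * Expansions with geometric remainder *)

Section Analytic.
Variables (R : realType) (K : cpxField R).
Implicit Types (f g : K -> K) (a b : nat -> K) (al t c : K).

Definition psum a t N : K := \sum_(0 <= i < N) a i * t ^+ i.

(** A power expansion on a punctured neighbourhood, given by geometric bounds on all
remainders instead of convergence.  Such bounds survive multiplication by a
direct estimate, with no rearrangement of double series.  The centre is excluded
because Laurent expansions multiplied by a power are to be covered. *)
Definition analytic f al a := exists C rho e : R,
  [/\ 0 <= C, 0 < rho, 0 < e, rho * e <= 1 &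
   forall t, 0 < nm t -> nm t < e -> forall N,
     nm (f (al + t) - psum a t N) <= C * (rho * nm t) ^+ N].

Lemma analytic_ext f g al a : (exists2 e : R, 0 < e &
    forall t, 0 < nm t -> nm t < e -> f (al + t) = g (al + t)) ->
  analytic g al a -> analytic f al a.
Proof.
case=> e e0 fg [C [rho [e' [C0 r0 e'0 re h]]]].
exists C, rho, (Num.min e e'); split=> //.
- by rewrite lt_min e0.
- by apply: le_trans re; rewrite ler_wpM2l ?(ltW r0) // ge_min lexx orbT.
- by move=> t t0; rewrite lt_min => /andP[te te'] N; rewrite fg // h.
Qed.

Lemma analytic_eq f g al a b : f =1 g -> a =1 b -> analytic g al a -> analytic f al b.
Proof. by move=> /funext -> /funext ->. Qed.

Lemma analytic_add f g al a b : analytic f al a -> analytic g al b ->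
  analytic (fun s => f s + g s) al (fun n => a n + b n).
Proof.
case=> C [r [e [C0 r0 e0 re hf]]] [C' [r' [e' [C'0 r'0 e'0 re' hg]]]].
have rr : 0 < r + r' by rewrite addr_gt0.
exists (C + C'), (r + r'), (Num.min (r + r')^-1 (Num.min e e')); split=> //.
- exact: addr_ge0.
- by rewrite !lt_min e0 e'0 invr_gt0 rr.
- rewrite -[leRHS](mulfV (lt0r_neq0 rr)) ler_wpM2l ?(ltW rr) //.
  by rewrite ge_min lexx.
move=> t t0; rewrite !lt_min => /and3P[_ te te'] N.
rewrite (_ : _ - _ = (f (al + t) - psum a t N) + (g (al + t) - psum b t N)); last first.
  have -> : psum (fun n => a n + b n) t N = psum a t N + psum b t N.
    by rewrite /psum -big_split; apply: eq_bigr => i _; rewrite mulrDl.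
  ring.
apply: le_trans (nmD _ _) _; rewrite mulrDl; apply: lerD.
  apply: le_trans (hf t t0 te N) _; rewrite ler_wpM2l // lerXn2r ?nnegrE ?mulr_ge0 ?ltW //.
  by rewrite ltr_pM2r // ltrDl.
apply: le_trans (hg t t0 te' N) _; rewrite ler_wpM2l // lerXn2r ?nnegrE ?mulr_ge0 ?ltW //.
by rewrite ltr_pM2r // ltrDr.
Qed.

Lemma analytic_scale f al a c : analytic f al a ->
  analytic (fun s => c * f s) al (fun n => c * a n).
Proof.
case=> C [r [e [C0 r0 e0 re hf]]].
exists (nm c * C), r, e; split=> //; first by rewrite mulr_ge0 ?nm_ge0.
move=> t t0 te N.
have -> : psum (fun n => c * a n) t N = c * psum a t N.
  by rewrite /psum mulr_sumr; apply: eq_bigr => i _; rewrite mulrA.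
by rewrite -mulrBr nmM -mulrA ler_wpM2l ?nm_ge0 ?hf.
Qed.

Definition delta (M n : nat) : K := (n == M)%:R.

Lemma psum_delta M t N : psum (delta M) t N = if (M < N)%N then t ^+ M else 0.
Proof.
elim: N => [|N IH]; first by rewrite /psum big_geq.
rewrite /psum big_nat_recr //= -/(psum _ _ _) IH /delta ltnS.
case: (ltngtP M N) => h; rewrite ?mul0r ?addr0 //.
by rewrite h mul1r add0r.
Qed.

Lemma analytic_pow al M : analytic (fun s => (s - al) ^+ M) al (delta M).
Proof.
exists 1, 1, 1; split=> //; rewrite ?mulr1 //.
move=> t t0 t1 N; rewrite !mul1r psum_delta [al + t]addrC addrK.
case: ifP => [_|/negbT]; first by rewrite subrr nm0 exprn_ge0 // ltW.
rewrite -leqNgt => NM; rewrite subr0 nmX.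
by rewrite ler_wiXn2l // ltW.
Qed.

Lemma analytic_zero al : analytic (fun=> 0) al (fun=> 0).
Proof.
by apply: (analytic_eq _ _ (analytic_scale 0 (analytic_pow al 0))) => n; rewrite mul0r.
Qed.

Definition cauchy_prod a b (n : nat) : K := \sum_(0 <= i < n.+1) a i * b (n - i)%N.

(** This form of the partial sums of a product expresses the remainder of a product
through the remainders of the factors. *)
Lemma psum_cauchy a b t N : psum (cauchy_prod a b) t N =
  \sum_(0 <= i < N) a i * t ^+ i * psum b t (N - i).
Proof.
elim: N => [|N IH]; first by rewrite /psum !big_geq.
rewrite [LHS]/psum big_nat_recr //= -/(psum _ _ _) IH.
rewrite [RHS]big_nat_recr //= subSnn.
have -> : psum b t 1 = b 0%N by rewrite /psum big_nat1 expr0 mulr1.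
rewrite /cauchy_prod big_nat_recr //= subnn mulrDl addrA; congr (_ + _); last by ring.
rewrite mulr_suml -big_split; apply: eq_big_nat => i /andP[_ hi] /=.
rewrite subSn 1?ltnW // [psum b t (N - i).+1]/psum big_nat_recr //= -/(psum b t (N - i)).
have -> : t ^+ N = t ^+ (N - i) * t ^+ i by rewrite -exprD subnK // ltnW.
ring.
Qed.

Lemma analytic_coef_bound f al a C rho e t : 0 <= C -> 0 < rho -> 0 < e -> rho * e <= 1 ->
  (forall t, 0 < nm t -> nm t < e -> forall N,
     nm (f (al + t) - psum a t N) <= C * (rho * nm t) ^+ N) ->
  0 < nm t -> nm t < e -> forall i, nm (a i * t ^+ i) <= 2 * C * (rho * nm t) ^+ i.
Proof.
move=> C0 r0 e0 re h t0 te i.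
have -> : a i * t ^+ i = (f (al + t) - psum a t i) - (f (al + t) - psum a t i.+1).
  by rewrite /psum big_nat_recr //=; ring.
apply: le_trans (nmD _ _) _; rewrite nmN.
have h1 := h t t0 te i; have h2 := h t t0 te i.+1.
have q0 : 0 <= (rho * nm t) ^+ i by rewrite exprn_ge0 // mulr_ge0 ?ltW.
have q1 : rho * nm t <= 1 by apply: le_trans re; rewrite ler_wpM2l ?ltW.
have : C * (rho * nm t) ^+ i.+1 <= C * (rho * nm t) ^+ i.
  by rewrite ler_wpM2l // exprS ler_piMl.
lra.
Qed.

(** The remainder of order [N] of a product consists of [N + 1] terms of the right
size; doubling the rate absorbs this number. *)
Lemma analytic_mul f g al a b : analytic f al a -> analytic g al b ->
  analytic (fun s => f s * g s) al (cauchy_prod a b).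
Proof.
case=> C [r [e [C0 r0 e0 re hf]]] [C' [r' [e' [C'0 r'0 e'0 re' hg]]]].
set q := r + r'; have q0 : 0 < q by rewrite addr_gt0.
have q20 : 0 < 2 * q by lra.
exists (2 * (C * C')), (2 * q), (Num.min (2 * q)^-1 (Num.min e e')); split=> //.
- by rewrite !mulr_ge0.
- by rewrite !lt_min e0 e'0 invr_gt0 q20.
- rewrite -[leRHS](mulfV (lt0r_neq0 q20)) ler_wpM2l ?(ltW q20) //.
  by rewrite ge_min lexx.
move=> t t0; rewrite !lt_min => /and3P[_ te te'] N.
have w0 : 0 <= q * nm t by rewrite mulr_ge0 ?ltW.
have rq m : (r * nm t) ^+ m <= (q * nm t) ^+ m.
  by rewrite lerXn2r ?nnegrE ?mulr_ge0 ?ltW // ltr_pM2r // ltrDl.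
have rq' m : (r' * nm t) ^+ m <= (q * nm t) ^+ m.
  by rewrite lerXn2r ?nnegrE ?mulr_ge0 ?ltW // ltr_pM2r // ltrDr.
have -> : f (al + t) * g (al + t) - psum (cauchy_prod a b) t N =
   (f (al + t) - psum a t N) * g (al + t)
   + \sum_(0 <= i < N) a i * t ^+ i * (g (al + t) - psum b t (N - i)).
  rewrite psum_cauchy mulrBl.
  under [X in _ = _ + X]eq_bigr => i _ do rewrite mulrBr.
  rewrite sumrB -mulr_suml -/(psum a t N); ring.
apply: le_trans (nmD _ _) _.
have b1 : nm ((f (al + t) - psum a t N) * g (al + t)) <= C * C' * (q * nm t) ^+ N.
  rewrite nmM mulrAC; apply: ler_pM; rewrite ?nm_ge0 //.
    by apply: le_trans (hf t t0 te N) _; rewrite ler_wpM2l.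
  by have := hg t t0 te' 0%N; rewrite /psum big_geq // subr0 expr0 mulr1.
have b2 : nm (\sum_(0 <= i < N) a i * t ^+ i * (g (al + t) - psum b t (N - i))) <=
   \sum_(0 <= i < N) 2 * (C * C') * (q * nm t) ^+ N.
  apply: le_trans (nm_sum _ _ _) _; apply: ler_sum_nat => i /andP[_ hi].
  have -> : 2 * (C * C') * (q * nm t) ^+ N = (2 * C * (q * nm t) ^+ i) * (C' * (q * nm t) ^+ (N - i)).
    have -> : (q * nm t) ^+ N = (q * nm t) ^+ (N - i) * (q * nm t) ^+ i.
      by rewrite -exprD subnK // ltnW.
    ring.
  rewrite nmM; apply: ler_pM; rewrite ?nm_ge0 //.
    apply: le_trans (analytic_coef_bound C0 r0 e0 re hf t0 te i) _.
    by rewrite ler_wpM2l // mulr_ge0.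
  by apply: le_trans (hg t t0 te' _) _; rewrite ler_wpM2l.
apply: le_trans (lerD b1 b2) _.
rewrite sumr_const_nat subn0 -[X in _ + X <= _]mulr_natr.
have -> : (2 * q * nm t) ^+ N = 2 ^+ N * (q * nm t) ^+ N by rewrite -exprMn mulrA.
have c2 : 1 + 2 * N%:R <= 2 * 2 ^+ N :> R.
  elim: (N) => [|n IH]; first by rewrite expr0; lra.
  rewrite exprS -natr1; have : 1 <= 2 ^+ n :> R by rewrite exprn_ege1 // ler1n.
  lra.
have := mulr_ge0 C0 C'0; set CC := C * C' => CC0.
have W0 : 0 <= CC * (q * nm t) ^+ N by rewrite mulr_ge0 // exprn_ge0.
rewrite -subr_ge0.
have -> : 2 * CC * (2 ^+ N * (q * nm t) ^+ N) - (CC * (q * nm t) ^+ N + 2 * CC * (q * nm t) ^+ N * N%:R)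
  = (CC * (q * nm t) ^+ N) * (2 * 2 ^+ N - (1 + 2 * N%:R)) by ring.
by rewrite mulr_ge0 // subr_ge0.
Qed.

(** Lowest coefficients first: after cancelling the common ones, dividing by a
small power of [t] isolates the next difference. *)
Lemma analytic_uniq f al a b : analytic f al a -> analytic f al b -> a =1 b.
Proof.
case=> C [r [e [C0 r0 e0 re hf]]] [C' [r' [e' [C'0 r'0 e'0 re' hg]]]].
move=> n; have [m] := ubnP n; elim: m n => // m IH n /ltnSE nm'.
apply/eqP; rewrite -subr_eq0 -nm_eq0 eq_le nm_ge0 andbT; apply/ler_addgt0Pr => d d0; rewrite add0r.
pose Q := C * r ^+ n.+1 + C' * r' ^+ n.+1.
have Q0 : 0 <= Q by rewrite addr_ge0 ?mulr_ge0 ?exprn_ge0 ?(ltW r0) ?(ltW r'0).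
pose h := Num.min (Num.min e e') (d / (Q + 1)) / 2.
have m0 : 0 < Num.min (Num.min e e') (d / (Q + 1)).
  by rewrite !lt_min e0 e'0 divr_gt0 // ltr_wpDl.
have h0 : 0 < h by rewrite divr_gt0.
have hlt : h < Num.min (Num.min e e') (d / (Q + 1)) by rewrite /h; lra.
move: hlt; rewrite !lt_min => /andP[/andP[he he'] hd].
clearbody h.
have nh : nm (rc K h) = h by rewrite nm_rc // ltW.
have := hf (rc K h); have := hg (rc K h); rewrite nh => /(_ h0 he' n.+1) g1 /(_ h0 he n.+1) f1.
have eqs : psum a (rc K h) n = psum b (rc K h) n.
  by rewrite /psum; apply: eq_big_nat => i /andP[_ hi]; rewrite IH //; apply: leq_trans hi nm'.
have : nm ((a n - b n) * rc K h ^+ n) <= C * (r * h) ^+ n.+1 + C' * (r' * h) ^+ n.+1.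
  have -> : (a n - b n) * rc K h ^+ n =
     (f (al + rc K h) - psum b (rc K h) n.+1) - (f (al + rc K h) - psum a (rc K h) n.+1).
    move: eqs; rewrite /psum !big_nat_recr //= => ->; ring.
  by apply: le_trans (nmD _ _) _; rewrite nmN addrC lerD.
have -> : C * (r * h) ^+ n.+1 + C' * (r' * h) ^+ n.+1 = Q * h * h ^+ n.
  by rewrite /Q !exprMn [h ^+ n.+1]exprS; ring.
rewrite nmM nmX nh ler_pM2r ?exprn_gt0 //.
move=> hh; apply: le_trans hh _.
have : h * (Q + 1) <= d by rewrite -ler_pdivlMr ?(ltW hd) // ltr_wpDl.
lra.
Qed.

(** Convergence at one point bounds the terms, which gives geometric remainders at
all points closer to the centre. *)
Lemma analytic_of_cvg f al a (e : R) : 0 < e ->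
  (forall t, 0 < nm t -> nm t < e -> psum a t @ \oo --> f (al + t)) -> analytic f al a.
Proof.
move=> e0 h.
pose r := e / 2; have r0 : 0 < r by rewrite divr_gt0.
have nr : nm (rc K r) = r by rewrite nm_rc // ltW.
have [B B0 hB] : exists2 B : R, 0 <= B & forall n, nm (a n * rc K r ^+ n) <= B.
  have /cvg_nm hc : psum a (rc K r) @ \oo --> f (al + rc K r).
    by apply: h; rewrite nr // /r; lra.
  have /pinfty_ex_gt0 [M M0 hM] : bounded_fun (fun n => nm (psum a (rc K r) n - f (al + rc K r)) : R^o).
    by apply: cvg_seq_bounded; apply/cvg_ex; exists 0.
  exists (2 * M); first by rewrite mulr_ge0 // ltW.
  move=> n.
  have hM' k : nm (psum a (rc K r) k - f (al + rc K r)) <= M.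
    by apply: le_trans (hM k Logic.I); exact: (ler_norm (nm _ : R)).
  have -> : a n * rc K r ^+ n = (psum a (rc K r) n.+1 - f (al + rc K r)) - (psum a (rc K r) n - f (al + rc K r)).
    by rewrite /psum big_nat_recr //=; ring.
  apply: le_trans (nmD _ _) _; rewrite nmN; have := hM' n; have := hM' n.+1; lra.
exists (2 * B), r^-1, (r / 2); split=> //.
- by rewrite mulr_ge0.
- by rewrite invr_gt0.
- by rewrite divr_gt0.
- by rewrite mulrA mulVf ?gt_eqF // mul1r; lra.
move=> t t0 tr N.
apply: (nm_lim_le (h t t0 _)); first by rewrite /r in tr r0; lra.
have q0 : 0 <= r^-1 * nm t by rewrite mulr_ge0 ?invr_ge0 ?ltW.
have q1 : r^-1 * nm t <= 2^-1.
  by rewrite mulrC ler_pdivrMr //; lra.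
exists N => // M /= NM.
rewrite /psum (@big_cat_nat _ _ _ N) //= [X in nm X]addrC addKr.
apply: le_trans (nm_sum _ _ _) _.
set q := r^-1 * nm t in q0 q1 *.
apply: (@le_trans _ _ (\sum_(N <= i < M) B * q ^+ i)).
  apply: ler_sum_nat => i _.
  have -> : nm (a i * t ^+ i) = nm (a i * rc K r ^+ i) * q ^+ i.
    rewrite !nmM !nmX nr /q [(r^-1 * _) ^+ i]exprMn [r^-1 ^+ i]exprVn; field.
    by rewrite expf_neq0 // lt0r_neq0.
  by rewrite ler_wpM2r ?exprn_ge0.
have -> : 2 * B * q ^+ N = B * (2 * q ^+ N) by ring.
rewrite -mulr_sumr ler_wpM2l //.
suff : \sum_(N <= i < M) q ^+ i <= 2 * q ^+ N - 2 * q ^+ M.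
  have : 0 <= q ^+ M by rewrite exprn_ge0.
  lra.
elim: M NM => [|M IH].
  by rewrite leqn0 => /eqP ->; rewrite big_geq // subrr.
rewrite leq_eqVlt => /orP[/eqP <-|NM]; first by rewrite big_geq // subrr.
rewrite big_nat_recr //=.
have := IH NM; have : 0 <= q ^+ M by rewrite exprn_ge0.
rewrite [q ^+ M.+1]exprS; nra.
Qed.

End Analytic.

(** * Residues *)

Section ResidueTheory.
Variables (R : realType) (K : cpxField R).
Implicit Types (f g : K -> K) (a b : nat -> K) (al t c : K).

Lemma near_punctured al (P : set K) :
  (\forall s \near al^', P s) <->
  exists2 e : R, 0 < e & forall t, 0 < nm t -> nm t < e -> P (al + t).
Proof.
have -> : (\forall s \near al^', P s) = (\forall s \near al, s != al -> P s) by [].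
split.
  case/near_nm => e e0 h; exists e => // t t0 te; apply: h.
    by rewrite addrC addKr.
  by rewrite addrC -subr_eq0 addrK -nm_gt0.
case=> e e0 h; apply/near_nm; exists e => // s hs sal.
by rewrite -(subrK al s) addrC; apply: h => //; rewrite nm_gt0 subr_eq0.
Qed.

Lemma pow_shift t (n m : nat) : t != 0 -> t ^ (n%:Z - m%:Z) = t ^- m * t ^+ n.
Proof. by move=> t0; rewrite expfzDr // -exprnN mulrC. Qed.

Lemma laurent_psum a t M : t != 0 ->
  partial_sum 0 (fun n => a n * t ^ (n%:Z - M.+1%:Z)) = fun N => t ^- M.+1 * psum a t N.
Proof.
move=> t0; apply/funext => N; rewrite /partial_sum /psum mulr_sumr; apply: eq_bigr => i _.
by rewrite pow_shift //; ring.
Qed.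

Lemma analytic_residue f al a M :
  analytic (fun s => (s - al) ^+ M.+1 * f s) al a -> is_residue f al (a M).
Proof.
case=> C [r [e [C0 r0 e0 re h]]].
exists M, a; split=> //; apply/near_punctured; exists e => // t t0 te.
have tn0 : t != 0 by rewrite -nm_gt0.
have -> : al + t - al = t by rewrite addrC addKr.
rewrite laurent_psum //.
have -> : f (al + t) = t ^- M.+1 * (t ^+ M.+1 * f (al + t)) by rewrite mulKf // expf_neq0.
apply: cvgKM; first exact: cvgKc.
have := h t t0 te; have -> : al + t - al = t by rewrite addrC addKr.
move=> h'.
apply: (cvg_of_bound (b := fun N => C * (r * nm t) ^+ N)).
  by move=> N; rewrite nmB.
rewrite -[0](mulr0 C); apply: cvgM; first exact: cvg_cst.
apply: cvg_expr; rewrite ger0_norm ?mulr_ge0 ?(ltW r0) ?(ltW t0) //.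
by apply: lt_le_trans re; rewrite ltr_pM2l.
Qed.

Lemma residue_analytic f al c : is_residue f al c ->
  exists M a, c = a M /\ analytic (fun s => (s - al) ^+ M.+1 * f s) al a.
Proof.
case=> M [a [ca /near_punctured [e e0 h]]]; exists M, a; split=> //.
apply: (analytic_of_cvg e0) => t t0 te.
have tn0 : t != 0 by rewrite -nm_gt0.
have := h t t0 te; have -> : al + t - al = t by rewrite addrC addKr.
rewrite laurent_psum // => h'.
apply: (cvgK_ext (v := fun N => t ^+ M.+1 * (t ^- M.+1 * psum a t N))).
  by move=> N; rewrite mulVKf // expf_neq0.
by apply: cvgKM; [exact: cvgKc|exact: h'].
Qed.

Lemma cauchy_delta a M n : cauchy_prod (delta K M) a n = if (n < M)%N then 0 else a (n - M)%N.
Proof.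
rewrite /cauchy_prod /delta; case: ltnP => h.
  rewrite big1_seq // => i; rewrite mem_index_iota => /= hi.
  by case: eqP => [e|_]; [lia|rewrite mul0r].
rewrite (big_cat_nat _ (n := M)) //=; last by lia.
rewrite big1_seq ?add0r; last first.
  move=> i; rewrite mem_index_iota => /= hi.
  by case: eqP => [e|_]; [lia|rewrite mul0r].
rewrite big_ltn // eqxx mul1r big1_seq ?addr0 // => i; rewrite mem_index_iota => /= hi.
by case: eqP => [e|_]; [lia|rewrite mul0r].
Qed.

Lemma analytic_shift f al a M : analytic f al a ->
  analytic (fun s => (s - al) ^+ M * f s) al (fun n => if (n < M)%N then 0 else a (n - M)%N).
Proof.
move=> h; apply: (analytic_eq _ _ (analytic_mul (analytic_pow al M) h)) => // n.
by rewrite cauchy_delta.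
Qed.

(** Two Laurent expansions with principal parts of different lengths are compared
after multiplying each by the power that the other one uses. *)
Lemma Res_analytic f al a M :
  analytic (fun s => (s - al) ^+ M.+1 * f s) al a -> Res f al = a M.
Proof.
move=> h; apply: xget_unique; first exact: analytic_residue.
move=> c /residue_analytic [N [b [-> hb]]].
have h1 := analytic_shift N.+1 h; have h2 := analytic_shift M.+1 hb.
have h3 : analytic (fun s => (s - al) ^+ N.+1 * ((s - al) ^+ M.+1 * f s)) al
   (fun n => if (n < M.+1)%N then 0 else b (n - M.+1)%N).
  by apply: (analytic_eq _ _ h2) => // s; rewrite mulrCA.
have := analytic_uniq h3 h1 (N + M).+1; rewrite !ltnS -!addnS.
have -> : (N + M.+1 <= M)%N = false by lia.
have -> : (N + M.+1 <= N)%N = false by lia.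
rewrite addnK; have -> : (N + M.+1 - N.+1 = M)%N by lia.
by [].
Qed.

End ResidueTheory.

(** * Uniform remainders for powers of one pole *)

Section TermExpansion.
Variables (R : realType) (K : cpxField R).
Implicit Types (al t c w : K).

Lemma bin_le_exp n m : ('C(n, m) <= 2 ^ n)%N.
Proof.
elim: n m => [|n IH] [|m] //; first by rewrite bin0 expn_gt0.
by rewrite binS expnS mul2n -addnn leq_add.
Qed.

(** The coefficients of [(1 + w)^-q]. *)
Definition inv_pow_coef q i : K := (-1) ^+ i * 'C((i + q).-1, i)%:R.

Lemma inv_pow_coef_rec q w N :
  (1 + w) * \sum_(0 <= i < N.+1) inv_pow_coef q.+1 i * w ^+ i =
  \sum_(0 <= i < N.+1) inv_pow_coef q i * w ^+ i + (-1) ^+ N * 'C(N + q, N)%:R * w ^+ N.+1.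
Proof.
elim: N => [|N IH]; first by rewrite !big_nat1 /inv_pow_coef !bin0 !expr0; ring.
rewrite big_nat_recr //= mulrDr IH [in RHS]big_nat_recr //= /inv_pow_coef addnS /= addSn binS natrD.
rewrite !exprS; ring.
Qed.

(** Induction on the exponent: dividing by [1 + w] loses a constant factor and adds
one term whose binomial coefficient is at most [2^(N+q)]. *)
Lemma term_remainder q : exists2 B : R, 0 <= B & forall w, nm w <= 2^-1 -> forall N,
  nm ((1 + w)^-1 ^+ q - \sum_(0 <= i < N) inv_pow_coef q i * w ^+ i) <= B * (2 * nm w) ^+ N.
Proof.
elim: q => [|q [B B0 IH]].
  exists 1 => // w w2 N; rewrite mul1r expr0.
  case: N => [|N]; first by rewrite big_geq // subr0 nm1 expr0.
  rewrite big_nat_recl // big1_seq ?addr0 => [|i _].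
    by rewrite /inv_pow_coef bin0 !expr0 !mulr1 subrr nm0 exprn_ge0 // mulr_ge0 ?nm_ge0.
  by rewrite /inv_pow_coef addn0 /= bin_small // mulr0 mul0r.
exists (2 ^+ q.+1 + 2 * (B + 2 ^+ q)); first by rewrite !addr_ge0 ?mulr_ge0 ?addr_ge0 ?exprn_ge0.
move=> w w2 N.
have w1 : 2^-1 <= nm (1 + w).
  have := nm_ler_sub (1 : K) (- w); rewrite nm1 nmN opprK; lra.
have wn0 : 1 + w != 0 by rewrite -nm_gt0; lra.
have wi : nm (1 + w)^-1 <= 2 by rewrite nmV -[leRHS]invrK lef_pV2 ?posrE //; lra.
have e0 : 0 <= (2 * nm w) ^+ N by rewrite exprn_ge0 // mulr_ge0 ?nm_ge0.
have c0 : 0 <= 2 * (B + 2 ^+ q) by rewrite mulr_ge0 ?addr_ge0 ?exprn_ge0.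
have c1 : 0 <= 2 ^+ q.+1 :> R by rewrite exprn_ge0.
case: N e0 => [|N] e0.
  rewrite big_geq // subr0 expr0 mulr1 nmX.
  apply: (@le_trans _ _ (2 ^+ q.+1)); last by rewrite lerDl.
  by rewrite lerXn2r ?nnegrE ?nm_ge0.
have -> : (1 + w)^-1 ^+ q.+1 - \sum_(0 <= i < N.+1) inv_pow_coef q.+1 i * w ^+ i =
   (1 + w)^-1 * (((1 + w)^-1 ^+ q - \sum_(0 <= i < N.+1) inv_pow_coef q i * w ^+ i)
     - (-1) ^+ N * 'C(N + q, N)%:R * w ^+ N.+1).
  apply: (mulfI wn0); rewrite mulrBr inv_pow_coef_rec mulVKf // exprS mulVKf //; ring.
apply: (@le_trans _ _ (2 * (B + 2 ^+ q) * (2 * nm w) ^+ N.+1)); last first.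
  by rewrite ler_wpM2r // lerDr.
rewrite nmM -[leRHS]mulrA; apply: ler_pM; rewrite ?nm_ge0 //.
apply: le_trans (nmD _ _) _; rewrite mulrDl; apply: lerD; first exact: IH.
rewrite nmN !nmM nm_sign mul1r nm_nat nmX exprMn mulrA ler_wpM2r ?exprn_ge0 ?nm_ge0 //.
apply: (@le_trans _ _ (2 ^+ (N + q))).
  by rewrite -natrX ler_nat bin_le_exp.
by rewrite -exprD addnC ler_weXn2l // ?ler1n // addnS.
Qed.

(** The remainders of the terms of a Lerch sum add up because the squares of the
inverse denominators do; this requires order at least 2 in those inverses,
which is why the remainder of order 0 is excluded for [q = 1]. *)
Lemma sum_remainder q : exists2 B : R, 0 <= B &
  forall (I : Type) (s : seq I) (w v : I -> K) (c S : R) t N,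
  (forall k, nm (w k) = 1) -> (forall k, v k != 0) ->
  (forall k, nm (v k)^-1 <= c) -> nm t * c <= 2^-1 -> 1 <= c ->
  \sum_(k <- s) nm (v k)^-1 ^+ 2 <= S -> (2 <= q + N)%N ->
  nm (\sum_(k <- s) w k * (v k + t)^-1 ^+ q
     - \sum_(0 <= i < N) (inv_pow_coef q i * \sum_(k <- s) w k * (v k)^-1 ^+ (q + i)) * t ^+ i)
  <= B * c ^+ q * S * (2 * c * nm t) ^+ N.
Proof.
have [B B0 hB] := term_remainder q.
exists B => // I s w v c S t N w1 v0 vc tc c1 sS qN.
have c0 : 0 <= c by lra.
have -> : \sum_(k <- s) w k * (v k + t)^-1 ^+ q
     - \sum_(0 <= i < N) (inv_pow_coef q i * \sum_(k <- s) w k * (v k)^-1 ^+ (q + i)) * t ^+ i =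
   \sum_(k <- s) w k * (v k)^-1 ^+ q * ((1 + t / v k)^-1 ^+ q
      - \sum_(0 <= i < N) inv_pow_coef q i * (t / v k) ^+ i).
  under [in RHS]eq_bigr => k _ do rewrite mulrBr.
  rewrite sumrB; congr (_ - _).
    apply: eq_bigr => k _.
    have -> : v k + t = v k * (1 + t / v k) by rewrite mulrDr mulr1 mulrCA mulfV // mulr1.
    by rewrite invfM exprMn mulrA.
  under [in LHS]eq_bigr => i _ do rewrite mulr_sumr mulr_suml.
  rewrite exchange_big /=; apply: eq_bigr => k _; rewrite mulr_sumr; apply: eq_bigr => i _.
  by rewrite exprMn exprD; ring.
apply: le_trans (nm_sum _ _ _) _.
have -> : B * c ^+ q * S * (2 * c * nm t) ^+ N = (B * c ^+ q * (2 * c * nm t) ^+ N) * S by ring.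
have E0 : 0 <= B * c ^+ q * (2 * c * nm t) ^+ N.
  by rewrite !mulr_ge0 ?exprn_ge0 ?mulr_ge0 ?nm_ge0.
apply: le_trans (ler_wpM2l E0 sS); rewrite mulr_sumr; apply: ler_sum => k _.
have tv : nm (t / v k) <= 2^-1.
  by apply: le_trans tc; rewrite nmM ler_wpM2l ?nm_ge0.
rewrite !nmM w1 mul1r.
apply: le_trans (ler_wpM2l (nm_ge0 _) (hB _ tv N)) _.
rewrite nmX nmM; set V := nm (v k)^-1; have V0 : 0 <= V by exact: nm_ge0.
have -> : V ^+ q * (B * (2 * (nm t * V)) ^+ N) = B * (2 * nm t) ^+ N * V ^+ (q + N).
  by rewrite !exprMn exprD; ring.
have -> : B * c ^+ q * (2 * c * nm t) ^+ N * V ^+ 2 = B * (2 * nm t) ^+ N * (c ^+ (q + N) * V ^+ 2).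
  by rewrite !exprMn exprD; ring.
rewrite ler_wpM2l ?mulr_ge0 ?exprn_ge0 ?mulr_ge0 ?nm_ge0 //.
rewrite -{1}(subnK qN) exprD ler_wpM2r ?exprn_ge0 //.
apply: (@le_trans _ _ (c ^+ (q + N - 2))); first by rewrite lerXn2r ?nnegrE ?vc.
by rewrite ler_weXn2l // leq_subr.
Qed.

End TermExpansion.

(** * Derivatives of expansions *)

Section Derivatives.
Variables (R : realType) (K : cpxField R).
Implicit Types (f g : K -> K) (a b : nat -> K) (al t h c s : K).

Lemma derive1_of_bound f s (D : K) (Q e : R) : 0 <= Q -> 0 < e ->
  (forall h, 0 < nm h -> nm h < e -> nm (f (s + h) - f s - h * D) <= Q * nm h ^+ 2) ->
  derive1 f s = D.
Proof.
move=> Q0 e0 hf; apply: cvg_lim; first exact: norm_hausdorff.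
apply/cvg_nm; apply/cvgrPdist_lt => d d0; apply/near_punctured.
exists (Num.min e (d / (Q + 1))).
  by rewrite lt_min e0 divr_gt0 // ltr_wpDl.
move=> h h0; rewrite lt_min => /andP[he hd].
have hn0 : h != 0 by rewrite -nm_gt0.
rewrite /= sub0r normrN !add0r ger0_norm ?nm_ge0 //.
have -> : h^-1 *: (f (h + s) - f s) - D = h^-1 * (f (s + h) - f s - h * D).
  by rewrite [h + s]addrC mulrBr mulKf.
rewrite nmM nmV mulrC ltr_pdivrMr //.
apply: le_lt_trans (hf h h0 he) _.
rewrite expr2 mulrA ltr_pM2r //.
move: hd; rewrite ltr_pdivlMr ?ltr_wpDl // => hd; nra.
Qed.

(** The error of the linear approximation to [(t + h)^n]. *)
Definition newton_rem t h n : K := (t + h) ^+ n - t ^+ n - n%:R * h * t ^+ n.-1.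

Lemma newton_rem_bound t h (r : R) n : nm t <= r -> nm (t + h) <= r ->
  nm (newton_rem t h n.+2) <= nm h ^+ 2 * (4 * (3 * r) ^+ n).
Proof.
move=> tr thr; have r0 : 0 <= r by apply: le_trans tr; exact: nm_ge0.
elim: n => [|n IH].
  rewrite /newton_rem /= expr0 (_ : _ - _ - _ = h ^+ 2); last by ring.
  by rewrite nmX; have := exprn_ge0 2 (nm_ge0 h); lra.
have -> : newton_rem t h n.+3 = (t + h) * newton_rem t h n.+2 + h ^+ 2 * (n.+2%:R * t ^+ n.+1).
  by rewrite /newton_rem /= -[n.+3%:R]natr1 !(exprS _ n.+1) !(exprS _ n.+2) !(exprS _ n.+1); ring.
apply: le_trans (nmD _ _) _; rewrite !nmM !nmX nm_nat.
have b1 : nm (t + h) * nm (newton_rem t h n.+2) <= r * (nm h ^+ 2 * (4 * (3 * r) ^+ n)).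
  by apply: ler_pM; rewrite ?nm_ge0.
have b2 : nm t ^+ n.+1 <= r ^+ n.+1 by rewrite lerXn2r ?nnegrE ?nm_ge0.
have b3 : n.+2%:R <= 8 * 3 ^+ n :> R.
  elim: (n) => [|m Im]; first by rewrite expr0; lra.
  rewrite -natr1 exprS; have : 1 <= 3 ^+ m :> R by rewrite exprn_ege1 // ler1n.
  lra.
apply: (@le_trans _ _ (r * (nm h ^+ 2 * (4 * (3 * r) ^+ n)) + nm h ^+ 2 * (8 * 3 ^+ n * r ^+ n.+1))).
  apply: lerD; first exact: b1.
  rewrite ler_wpM2l ?mulr_ge0 ?nm_ge0 //.
  by apply: ler_pM; rewrite ?exprn_ge0 ?nm_ge0.
by rewrite le_eqVlt; apply/orP; left; apply/eqP; rewrite !exprMn !exprS; ring.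
Qed.

Lemma geo_sum_le (q : R) n : 0 <= q -> q <= 3 / 4 -> \sum_(0 <= i < n) q ^+ i <= 4.
Proof.
move=> q0 q1; have : \sum_(0 <= i < n) q ^+ i <= 4 - 4 * q ^+ n.
  elim: n => [|n IH]; first by rewrite big_geq // expr0; lra.
  rewrite big_nat_recr //= exprS; have := exprn_ge0 n q0; nra.
have := exprn_ge0 n q0; lra.
Qed.

Definition dcoef a (n : nat) : K := n.+1%:R * a n.+1.

Lemma analytic_psum_cvg f al a : analytic f al a -> f al = a 0%N ->
  exists2 e : R, 0 < e & forall t, nm t < e -> psum a t @ \oo --> f (al + t).
Proof.
case=> C [r [e [C0 r0 e0 re h]]] f0; exists e => // t te.
have [t0|tn0] := eqVneq t 0.
  rewrite t0 addr0 f0; apply: cvgKSI; apply: (cvgK_ext (v := fun=> a 0%N)); last exact: cvgKc.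
  move=> n; rewrite /psum big_nat_recl //= expr0 mulr1 big1_seq ?addr0 // => i _.
  by rewrite expr0n mulr0.
have t0 : 0 < nm t by rewrite nm_gt0.
apply: (cvg_of_bound (b := fun N => C * (r * nm t) ^+ N)).
  by move=> N; rewrite nmB h.
rewrite -[0](mulr0 C); apply: cvgM; first exact: cvg_cst.
apply: cvg_expr; rewrite ger0_norm ?mulr_ge0 ?(ltW r0) ?(ltW t0) //.
by apply: lt_le_trans re; rewrite ltr_pM2l.
Qed.

Lemma analytic_coef_geo f al a : analytic f al a ->
  exists A r : R, [/\ 0 <= A, 0 < r & forall n, nm (a n) <= A * r ^+ n].
Proof.
case=> C [r [e [C0 r0 e0 re h]]]; exists (2 * C), r; split=> // [|n]; first by rewrite mulr_ge0.
have [u u0 ue] : exists2 u, 0 < u & u < e by exists (e / 2); [rewrite divr_gt0|lra].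
have nt : nm (rc K u) = u by rewrite nm_rc // ltW.
have hb := @analytic_coef_bound _ _ f al a C r e (rc K u) C0 r0 e0 re h.
rewrite nt in hb; have := hb u0 ue n; rewrite nmM nmX nt exprMn mulrA.
by rewrite ler_pM2r ?exprn_gt0.
Qed.

(** The derivative is computed at every point near the centre, not only at the
centre, so that the result can be iterated. *)
Lemma analytic_derive f al a : analytic f al a -> f al = a 0%N ->
  analytic (derive1 f) al (dcoef a) /\ derive1 f al = dcoef a 0.
Proof.
move=> ha f0; have [e e0 hp] := analytic_psum_cvg ha f0.
have [A [r [A0 r0 hA]]] := analytic_coef_geo ha.
(* Within this radius, t and t + h stay in the disc and all series below have ratio at most 3/4. *)
pose d := Num.min (e / 2) (8 * r)^-1.
have r8 : 0 < 8 * r by rewrite mulr_gt0.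
have d0 : 0 < d by rewrite lt_min divr_gt0 //= invr_gt0.
have de : d <= e / 2 by rewrite ge_min lexx.
have dr : r * d <= 8^-1.
  have : d <= (8 * r)^-1 by rewrite ge_min lexx orbT.
  by rewrite -[(8 * r)^-1]mul1r ler_pdivlMr //; lra.
clearbody d.
have Dc t : nm t < d -> cvgn (psum (dcoef a) t).
  move=> td; have : cvgn (partial_sum 0 (fun i => dcoef a i * t ^+ i)); last by [].
  apply: (@abs_cvg _ K _ (A * r * 4)) => n.
  have q0 : 0 <= 2 * (r * nm t) by rewrite !mulr_ge0 ?nm_ge0 ?ltW.
  have q1 : 2 * (r * nm t) <= 3 / 4.
    have : r * nm t <= r * d by rewrite ler_pM2l // ltW.
    lra.
  apply: le_trans (ler_wpM2l _ (geo_sum_le n q0 q1)); last by rewrite mulr_ge0 // ltW.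
  rewrite mulr_sumr; apply: ler_sum => i _.
  rewrite nmM nmM nm_nat nmX exprMn exprMn.
  have i2 : i.+1%:R <= 2 ^+ i :> R by rewrite -natrX ler_nat ltn_expl.
  have -> : A * r * (2 ^+ i * (r ^+ i * nm t ^+ i)) = 2 ^+ i * (A * r ^+ i.+1) * nm t ^+ i.
    by rewrite exprS; ring.
  by rewrite ler_wpM2r ?exprn_ge0 ?nm_ge0 //; apply: ler_pM; rewrite ?nm_ge0.
have key t : nm t < d -> derive1 f (al + t) = limn (psum (dcoef a) t).
  move=> td; apply: (@derive1_of_bound _ _ _ (A * r ^+ 2 * 4 * 4) d) => //.
    by rewrite !mulr_ge0 // ltW.
  move=> h h0 hd.
  have thn : nm (t + h) <= 2 * d by apply: le_trans (nmD _ _) _; lra.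
  have tn : nm t <= 2 * d by lra.
  have lim1 : (fun N => psum a (t + h) N.+2 - psum a t N.+2 - h * psum (dcoef a) t N.+1)
     @ \oo --> f (al + t + h) - f (al + t) - h * limn (psum (dcoef a) t).
    have p1 : psum a (t + h) @ \oo --> f (al + t + h).
      by rewrite -addrA; apply: hp; apply: le_lt_trans (nmD _ _) _; lra.
    have p2 : psum a t @ \oo --> f (al + t) by apply: hp; lra.
    apply: cvgKB; first apply: cvgKB.
    - exact: (cvgKS (cvgKS p1)).
    - exact: (cvgKS (cvgKS p2)).
    - by apply: cvgKM; [exact: cvgKc|exact: (cvgKS (Dc t td))].
  rewrite -[X in nm X]subr0; apply: (nm_lim_le lim1); exists 0%N => // N _ /=; rewrite subr0.
  have -> : psum a (t + h) N.+2 - psum a t N.+2 - h * psum (dcoef a) t N.+1 =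
     \sum_(0 <= n < N) a n.+2 * newton_rem t h n.+2.
    have -> : psum a (t + h) N.+2 - psum a t N.+2 - h * psum (dcoef a) t N.+1 =
       \sum_(0 <= n < N.+2) a n * newton_rem t h n.
      have -> : h * psum (dcoef a) t N.+1 = \sum_(0 <= n < N.+2) a n * (n%:R * h * t ^+ n.-1).
        rewrite [RHS]big_nat_recl //= mul0r mul0r mulr0 add0r /psum mulr_sumr.
        by apply: eq_bigr => i _; rewrite /dcoef; ring.
      rewrite /psum -!sumrB; apply: eq_bigr => i _; rewrite /newton_rem; ring.
    rewrite big_nat_recl //= big_nat_recl //= /newton_rem /=.
    by rewrite !expr0 !expr1 -[RHS]add0r -[in RHS](add0r (\sum_(_ <= _ < _) _)); congr (_ + (_ + _)); ring.
  apply: le_trans (nm_sum _ _ _) _.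
  have q0 : 0 <= 3 * (r * (2 * d)) by rewrite !mulr_ge0 // ltW.
  have q1 : 3 * (r * (2 * d)) <= 3 / 4 by lra.
  have -> : A * r ^+ 2 * 4 * 4 * nm h ^+ 2 = (A * r ^+ 2 * 4 * nm h ^+ 2) * 4 by ring.
  apply: le_trans (ler_wpM2l _ (geo_sum_le N q0 q1)); last first.
    by rewrite !mulr_ge0 ?exprn_ge0 ?nm_ge0 // ltW.
  rewrite mulr_sumr; apply: ler_sum => n _; rewrite nmM.
  have -> : A * r ^+ 2 * 4 * nm h ^+ 2 * (3 * (r * (2 * d))) ^+ n =
     (A * r ^+ n.+2) * (nm h ^+ 2 * (4 * (3 * (2 * d)) ^+ n)).
    by rewrite !exprMn !exprS; ring.
  by apply: ler_pM; rewrite ?nm_ge0 // newton_rem_bound.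
split.
  apply: (analytic_of_cvg d0) => t t0 td; rewrite key //; exact: Dc.
rewrite -[al]addr0 key ?nm0 //; apply: limn_eq.
apply: cvgKSI; apply: (cvgK_ext (v := fun=> dcoef a 0)); last exact: cvgKc.
move=> n; rewrite /psum big_nat_recl //= expr0 mulr1 big1_seq ?addr0 // => i _.
by rewrite expr0n mulr0.
Qed.

Lemma nderiv_analytic n f al a : analytic f al a -> f al = a 0%N ->
  nderiv n f al = n`!%:R * a n.
Proof.
elim: n f a => [|n IH] f a ha f0; first by rewrite mul1r.
have [ha' f0'] := analytic_derive ha f0.
have := IH _ _ ha' f0'; rewrite /nderiv /derive1n -iterSr => ->.
by rewrite /dcoef factS mulnC natrM mulrA.
Qed.

End Derivatives.

(** * Expansions of Lerch series *)

Section Instances.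
Variables (R : realType) (K : cpxField R).
Implicit Types (f g : K -> K) (a b : nat -> K) (al t h c s x z : K).

(** Bounds that are uniform in [M] pass to the limit.  The remainder of order 0 is
recovered from that of order 1. *)
Lemma analytic_of_lim f al a (F : nat -> K -> K) (A : nat -> nat -> K) (B r e : R) :
  0 <= B -> 0 < r -> 0 < e -> r * e <= 1 ->
  (forall t, 0 < nm t -> nm t < e -> F ^~ t @ \oo --> f (al + t)) ->
  (forall i, A ^~ i @ \oo --> a i) ->
  (forall M t N, 0 < nm t -> nm t < e -> (0 < N)%N ->
     nm (F M t - psum (A M) t N) <= B * (r * nm t) ^+ N) ->
  analytic f al a.
Proof.
move=> B0 r0 e0 re hF hA hB.
have pos t N : 0 < nm t -> nm t < e -> (0 < N)%N ->
    nm (f (al + t) - psum a t N) <= B * (r * nm t) ^+ N.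
  move=> t0 te N0; rewrite -[X in nm X]subr0.
  have lim : (fun M => F M t - psum (A M) t N) @ \oo --> f (al + t) - psum a t N.
    apply: cvgKB; first exact: hF.
    by apply: cvgKsum => i _; apply: cvgKM; [exact: hA|exact: cvgKc].
  by apply: (nm_lim_le lim); exists 0%N => // M _ /=; rewrite subr0 hB.
exists (B + nm (a 0%N)), r, e; split=> //; first by rewrite addr_ge0 ?nm_ge0.
move=> t t0 te [|N].
  rewrite /psum big_geq // subr0 expr0 mulr1.
  have := pos t 1%N t0 te isT; rewrite /psum big_nat1 expr0 mulr1 expr1.
  have : r * nm t <= 1 by apply: le_trans re; rewrite ler_wpM2l ?ltW.
  have := nm_ler_sub (f (al + t)) (a 0%N); nra.
apply: le_trans (pos t N.+1 t0 te isT) _.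
by rewrite ler_wpM2r ?exprn_ge0 ?mulr_ge0 ?(ltW r0) ?(ltW t0) // lerDl nm_ge0.
Qed.

Lemma analytic_inv_pow (b : K) q al : (0 < q)%N -> al != b ->
  analytic (fun s => (s - b)^-1 ^+ q) al (fun i => inv_pow_coef K q i * (al - b)^-1 ^+ (q + i)).
Proof.
move=> q0 ab; have [B B0 hB] := sum_remainder K q.
have v0 : al - b != 0 by rewrite subr_eq0.
pose c := 1 + nm (al - b)^-1.
have c1 : 1 <= c by rewrite lerDl nm_ge0.
have c2 : 0 < 2 * c by lra.
apply: (@analytic_of_lim _ _ _ (fun _ t => (al + t - b)^-1 ^+ q)
  (fun _ i => inv_pow_coef K q i * (al - b)^-1 ^+ (q + i)) (B * c ^+ q * nm (al - b)^-1 ^+ 2) (2 * c) (2 * c)^-1).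
- by rewrite !mulr_ge0 ?exprn_ge0 ?nm_ge0 //; lra.
- by [].
- by rewrite invr_gt0.
- by rewrite mulfV // lt0r_neq0.
- by move=> t _ _; exact: cvgKc.
- by move=> i; exact: cvgKc.
move=> _ t N t0 te N0.
have := hB unit [:: tt] (fun=> 1) (fun=> al - b) c (nm (al - b)^-1 ^+ 2) t N.
rewrite !big_seq1 mul1r.
have -> : al - b + t = al + t - b by ring.
have -> : \sum_(0 <= i < N) (inv_pow_coef K q i * \sum_(k <- [:: tt]) 1 * (al - b)^-1 ^+ (q + i)) * t ^+ i
  = psum (fun i => inv_pow_coef K q i * (al - b)^-1 ^+ (q + i)) t N.
  by apply: eq_bigr => i _; rewrite big_seq1 mul1r.
apply => //.
- by move=> _; exact: nm1.
- by move=> _; rewrite lerDr.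
- have : nm t * (2 * c) <= 1 by rewrite -ler_pdivlMr // mul1r ltW.
  lra.
- lia.
Qed.

Lemma lerch_analytic z q al : nm z = 1 -> (0 < q)%N -> (q, z) <> (1%N, 1) ->
  (forall k : nat, k%:R + al != 0) ->
  analytic (lerch z q) al (fun i => inv_pow_coef K q i * lerch z (q + i) al).
Proof.
move=> z1 q0 qz v0; have [B B0 hB] := sum_remainder K q.
have [c c1 hc] := inv_shift_bound al.
have c2 : 0 < 2 * c by lra.
apply: (@analytic_of_lim _ _ _ (fun M t => lerch_part z q (al + t) M)
  (fun M i => inv_pow_coef K q i * lerch_part z (q + i) al M) (B * c ^+ q * (c ^+ 2 * 2)) (2 * c) (2 * c)^-1).
- by rewrite !mulr_ge0 ?exprn_ge0 //; lra.
- by [].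
- by rewrite invr_gt0.
- by rewrite mulfV // lt0r_neq0.
- by move=> t _ _; exact: lerch_cvg.
- move=> i; apply: cvgKM; first exact: cvgKc.
  apply: lerch_cvg => //; first lia.
  case=> e1 e2; apply: qz; rewrite e2; congr (_, _); lia.
move=> M t N t0 te N0.
have := hB nat (index_iota 0 M) (fun k => z ^+ k) (fun k => k%:R + al) c (c ^+ 2 * 2) t N.
have -> : \sum_(0 <= k < M) z ^+ k * (k%:R + al + t)^-1 ^+ q = lerch_part z q (al + t) M.
  by apply: eq_bigr => k _; rewrite addrA.
apply => //.
- by move=> k; rewrite nmX z1 expr1n.
- move=> k; apply: le_trans (hc k) _; rewrite ler_pdivrMr ?ltr0n // ler_peMr //; first lra.
  by rewrite ler1n.
- have : nm t * (2 * c) <= 1 by rewrite -ler_pdivlMr // mul1r ltW.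
  lra.
- apply: le_trans (ler_wpM2l _ (sum_inv_sq R M)); last by rewrite exprn_ge0 //; lra.
  rewrite mulr_sumr; apply: ler_sum => k _.
  rewrite -[(k.+1%:R ^+ 2)^-1]exprVn -exprMn lerXn2r ?nnegrE ?nm_ge0 ?hc //.
  by apply: le_trans (nm_ge0 _) (hc k).
- lia.
Qed.

(** The denominators on both sides of the symmetric sum are compared with [n + 1],
which bounds the sum of their inverse squares independently of [M]. *)
Lemma bilerch_analytic x q al : nm x = 1 -> (0 < q)%N ->
  (forall k : int, al + k%:~R != 0) ->
  analytic (bilerch x q) al (fun i => inv_pow_coef K q i * bilerch x (q + i) al).
Proof.
move=> x1 q0 v0; have [B B0 hB] := sum_remainder K q.
have [c1 c11 h1] := inv_shift_bound al; have [c2 c21 h2] := inv_shift_bound (- al).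
pose c := c1 + c2; have c0 : 0 < 2 * c by rewrite /c; lra.
apply: (@analytic_of_lim _ _ _ (fun M t => sym_sum M (fun k => x ^ k * (al + t + k%:~R)^-1 ^+ q))
  (fun M i => inv_pow_coef K q i * sym_sum M (fun k => x ^ k * (al + k%:~R)^-1 ^+ (q + i)))
  (B * c ^+ q * (c1 ^+ 2 * 2 + c2 ^+ 2 * 2)) (2 * c) (2 * c)^-1).
- by rewrite !mulr_ge0 ?addr_ge0 ?mulr_ge0 ?exprn_ge0 //; rewrite /c; lra.
- by [].
- by rewrite invr_gt0.
- by rewrite mulfV // lt0r_neq0.
- by move=> t _ _; exact: bilerch_cvg.
- move=> i; apply: cvgKM; first exact: cvgKc.
  by apply: bilerch_cvg => //; lia.
move=> M t N t0 te N0.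
have := hB int (sym_range M) (fun k => x ^ k) (fun k => al + k%:~R) c (c1 ^+ 2 * 2 + c2 ^+ 2 * 2) t N.
have -> : \sum_(k <- sym_range M) x ^ k * (al + k%:~R + t)^-1 ^+ q =
   sym_sum M (fun k => x ^ k * (al + t + k%:~R)^-1 ^+ q).
  by rewrite sym_sum_big; apply: eq_bigr => k _; rewrite addrAC.
have -> : psum (fun i => inv_pow_coef K q i * sym_sum M (fun k => x ^ k * (al + k%:~R)^-1 ^+ (q + i))) t N =
   \sum_(0 <= i < N) (inv_pow_coef K q i * \sum_(k <- sym_range M) x ^ k * (al + k%:~R)^-1 ^+ (q + i)) * t ^+ i.
  by apply: eq_bigr => i _; rewrite sym_sum_big.
have div_le (d : R) (n : nat) : 0 <= d -> d / n.+1%:R <= d.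
  by move=> d0; rewrite ler_pdivrMr ?ltr0n // ler_peMr // ler1n.
have neg n : nm (al + (- n%:Z)%:~R)^-1 = nm (n%:R - al)^-1.
  by rewrite mulrNz -[al - _]opprB invrN nmN.
have pos_int_term_pf n : nm (al + (n%:Z)%:~R)^-1 = nm (n%:R + al)^-1 by rewrite addrC.
apply => //.
- by move=> k; exact: nm_expz.
- case=> n; first by rewrite pos_int_term_pf; apply: le_trans (h1 n) _; apply: le_trans (div_le _ _ _) _; rewrite /c; lra.
  by rewrite NegzE neg; apply: le_trans (h2 _) _; apply: le_trans (div_le _ _ _) _; rewrite /c; lra.
- have : nm t * (2 * c) <= 1 by rewrite -ler_pdivlMr // mul1r ltW.
  lra.
- by rewrite /c; lra.
- rewrite /sym_range big_cat !big_map /=.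
  have sq (d : R) (g : nat -> R) m : (m <= M.+1)%N -> 0 <= d -> (forall n, 0 <= g n) -> (forall n, g n <= d / n.+1%:R) ->
      \sum_(m <= n < M.+1) g n ^+ 2 <= d ^+ 2 * 2.
    move=> mM d0 g0 hg; apply: le_trans (ler_wpM2l _ (sum_inv_sq R M.+1)); last by rewrite exprn_ge0.
    apply: (@le_trans _ _ (\sum_(0 <= n < M.+1) g n ^+ 2)).
      rewrite [leRHS](@big_cat_nat _ _ _ m) //= lerDr sumr_ge0 // => i _.
      by rewrite exprn_ge0.
    rewrite mulr_sumr; apply: ler_sum => k _.
    by rewrite -exprVn -exprMn lerXn2r ?nnegrE ?hg // mulr_ge0.
  apply: lerD.
    under eq_bigr => n _ do rewrite pos_int_term_pf.
    by apply: (sq c1 (fun n => nm (n%:R + al)^-1)) => // [|n]; [lra|exact: nm_ge0].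
  under eq_bigr => n _ do rewrite neg.
  by apply: (sq c2 (fun n => nm (n%:R - al)^-1)) => // [|n]; [lra|exact: nm_ge0].
- lia.
Qed.

End Instances.

(** * Partial fractions of rational functions *)

Section PartialFractions.
Variable F : fieldType.
Implicit Types (n d : {poly F}) (s z : F) (rs : seq F).

(** A triple [(b, j, c)] stands for [c / (s - b)^(j+1)]. *)
Definition pf_eval (L : seq (F * nat * F)) s : F :=
  \sum_(u <- L) u.2 * (s - u.1.1)^-1 ^+ u.1.2.+1.

Lemma prod_XsubC_split rs z :
  \prod_(w <- rs) ('X - w%:P) =
  ('X - z%:P) ^+ (count_mem z rs) * \prod_(w <- [seq w <- rs | w != z]) ('X - w%:P).
Proof.
elim: rs => [|w rs IH]; first by rewrite !big_nil mul1r.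
rewrite big_cons IH /=; case: eqP => [->|_] /=; first by rewrite add1n exprS mulrA.
by rewrite big_cons add0n mulrCA.
Qed.

(** Splitting off one root at a time: subtracting a multiple of the cofactor makes
the numerator vanish at the root, which can then be cancelled. *)
Lemma partial_fractions rs n : (size n <= size rs)%N ->
  exists2 L : seq (F * nat * F),
    forall u, u \in L -> u.1.1 \in rs /\ (u.1.2 < count_mem u.1.1 rs)%N &
    forall s, s \notin rs -> n.[s] / (\prod_(w <- rs) ('X - w%:P)).[s] = pf_eval L s.
Proof.
elim: rs n => [|z rs IH] n.
  rewrite leqn0 size_poly_eq0 => /eqP ->; exists [::] => // s _.
  by rewrite horner0 mul0r /pf_eval big_nil.
move=> /= sn; set m := count_mem z rs.
(* The cofactor does not vanish at z, so c is the coefficient of the highest pole at z. *)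
pose d2 := \prod_(w <- [seq w <- rs | w != z]) ('X - w%:P).
have d2z : d2.[z] != 0.
  rewrite -rootE root_prod_XsubC mem_filter eqxx //.
pose c := n.[z] / d2.[z].
have rz : root (n - c *: d2) z.
  by rewrite rootE hornerD hornerN hornerZ divfK // subrr.
have [n' nE] := factor_theorem _ _ rz.
have sn' : (size n' <= size rs)%N.
  have [->|n'0] := eqVneq n' 0; first by rewrite size_poly0.
  have : (size (n - c *: d2)%R <= (size rs).+1)%N.
    apply: leq_trans (size_polyD _ _) _; rewrite geq_max sn size_polyN.
    apply: leq_trans (size_scale_leq _ _) _; rewrite size_prod_XsubC ltnS size_filter.
    exact: count_size.
  by rewrite nE size_Mmonic ?monicXsubC // size_XsubC addn2 /= ltnS.
have [L LP LE] := IH n' sn'.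
exists ((z, m, c) :: L) => [u|s].
  rewrite inE => /predU1P[->|/LP[u1 u2]] /=.
    by rewrite inE eqxx add1n ltnSn.
  by rewrite inE u1 orbT; split=> //; apply: (leq_trans u2); rewrite leq_addl.
rewrite inE negb_or => /andP[sz srs].
have sz0 : s - z != 0 by rewrite subr_eq0.
have d20 : d2.[s] != 0.
  by rewrite -rootE root_prod_XsubC mem_filter negb_and srs orbT.
have -> : pf_eval ((z, m, c) :: L) s = c * (s - z)^-1 ^+ m.+1 + pf_eval L s.
  by rewrite /pf_eval big_cons.
rewrite -LE // big_cons hornerM hornerXsubC.
rewrite (prod_XsubC_split rs z) -/d2 -/m hornerM horner_exp hornerXsubC.
have -> : n.[s] = c * d2.[s] + n'.[s] * (s - z).
  by rewrite -[s - z]hornerXsubC -hornerM -nE hornerD hornerN hornerZ; ring.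
rewrite exprVn exprS; field.
by rewrite d20 sz0 expf_neq0.
Qed.

End PartialFractions.

(** * Rational functions that vanish at infinity *)

Section Rational.
Variables (R : realType) (K : cpxField R).
Implicit Types (p : {poly K}) (r : {fraction {poly K}}).

Lemma ratio_tofrac r : tofrac (frac (repr r)).2 * r = tofrac (frac (repr r)).1.
Proof.
set x := repr r; have -> : r = \pi_({fraction {poly K}})%qT x by rewrite reprK.
have dx : x.2 != 0 by exact: denom_ratioP.
unlock tofrac; rewrite -[LHS]FracField.pi_mul.
apply/eqmodP; rewrite /= FracField.equivfE /FracField.mulf.
by rewrite !numden_Ratio ?oner_neq0 ?mul1r ?mulr1 // mulrC.
Qed.

Lemma rat_reduced r : [/\ ratden r != 0, coprimep (ratnum r) (ratden r) &
  tofrac (ratden r) * r = tofrac (ratnum r)].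
Proof.
have := ratio_tofrac r; have : (frac (repr r)).2 != 0 by exact: denom_ratioP.
rewrite /ratnum /ratden; case: (frac (repr r)) => n d /= d0 dr.
set g := gcdp n d.
have g0 : g != 0 by rewrite gcdp_eq0 negb_and d0 orbT.
have dE : d %/ g * g = d by rewrite divpK // dvdp_gcdr.
have nE : n %/ g * g = n by rewrite divpK // dvdp_gcdl.
split.
- by apply: contraNneq d0 => e; rewrite -dE e mul0r.
- by apply: coprimep_div_gcd; rewrite d0 orbT.
have tg0 : tofrac g != 0 by rewrite tofrac_eq0.
by apply: (mulIf tg0); rewrite mulrAC -!tofracM dE nE.
Qed.

(** The reduced denominator of the scaled fraction divides the cofactor [d2], so
evaluation may be carried out with [d2] even though the representative of a
fraction is arbitrary. *)
Lemma rat_mul_pow r p q d2 s : ratden r = p ^+ q * d2 -> d2.[s] != 0 ->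
  rateval (tofrac p ^+ q * r) s = (ratnum r).[s] / d2.[s].
Proof.
move=> dE d2s; have [d0 cop dr] := rat_reduced r.
set a := tofrac p ^+ q * r; have [d10 cop1 dr1] := rat_reduced a.
have pq0 : p ^+ q != 0 by apply: contraNneq d0 => e; rewrite dE e mul0r.
have cross : ratden a * ratnum r = d2 * ratnum a.
  apply: (mulfI pq0); apply/eqP; rewrite -tofrac_eq !tofracM -dr -dr1 tofracXn /a dE tofracM tofracXn.
  by apply/eqP; ring.
have d1d2 : ratden a %| d2.
  have c1 : coprimep (ratden a) (ratnum a) by rewrite coprimep_sym.
  by rewrite -(Gauss_dvdpl _ c1) -cross dvdp_mulr.
have d1s : (ratden a).[s] != 0.
  apply: contraNneq d2s => e; have /dvdpP [k ->] := d1d2.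
  by rewrite hornerM e mulr0.
rewrite /rateval; apply/eqP; rewrite eqr_div //; apply/eqP.
have := congr1 (horner^~ s) cross; rewrite !hornerM => h.
by rewrite mulrC -h mulrC.
Qed.

Lemma horner_cvg p (u : nat -> K) (l : K) :
  u @ \oo --> l -> (fun n => p.[u n]) @ \oo --> p.[l].
Proof.
move=> ul; elim/poly_ind: p => [|p c IH].
  apply: (cvgK_ext (v := fun=> 0)) => [n|]; first by rewrite horner0.
  by rewrite horner0; exact: cvgKc.
apply: (cvgK_ext (v := fun n => p.[u n] * u n + c)) => [n|].
  by rewrite hornerMXaddC.
rewrite hornerMXaddC; apply: cvgKD; last exact: cvgKc.
exact: cvgKM.
Qed.

Lemma cvg_inv_nat : (fun k => k.+1%:R^-1) @ \oo --> (0 : K).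
Proof.
apply: (cvg_of_bound (b := fun n => n.+1%:R^-1)); last exact: cvg_harmonic.
by move=> n; rewrite subr0 nmV nm_nat.
Qed.

(** Dividing by the leading power isolates the leading coefficient. *)
Lemma poly_nat_cvg0 p : (fun k => p.[k.+1%:R]) @ \oo --> (0 : K) -> p = 0.
Proof.
move=> h; apply/eqP; apply: contraT => p0.
have [m sp] : exists m, size p = m.+1.
  by exists (size p).-1; rewrite prednK // lt0n size_poly_eq0.
have l1 : (fun k => p.[k.+1%:R] * k.+1%:R^-1 ^+ m) @ \oo --> (0 : K).
  apply/cvg_nm; move/cvg_nm: h => h.
  apply: (squeeze_cvgr (f := fun=> 0) _ _ h); last exact: cvg_cst.
  apply: nearW => k; rewrite nm_ge0 !subr0 nmM nmX nmV nm_nat.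
  rewrite ler_piMr ?nm_ge0 // exprn_ile1 ?invr_ge0 // invf_le1 ?ltr0n //.
  by rewrite ler1n.
have l2 : (fun k => p.[k.+1%:R] * k.+1%:R^-1 ^+ m) @ \oo -->
    (\sum_(i < m.+1) p`_i * (if i == ord_max then 1 else 0)).
  apply: (cvgK_ext (v := fun k => \sum_(i < m.+1) p`_i * k.+1%:R^-1 ^+ (m - i))) => [k|].
    rewrite horner_coef sp mulr_suml; apply: eq_bigr => i _.
    have im : (i <= m)%N by rewrite -ltnS.
    have -> : k.+1%:R^-1 ^+ m = k.+1%:R^-1 ^+ (m - i) * k.+1%:R^-1 ^+ i :> K.
      by rewrite -exprD subnK.
    rewrite -mulrA; congr (_ * _).
    by rewrite mulrCA -exprMn mulfV ?pnatr_eq0 // expr1n mulr1.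
  apply: cvgKsum => i _; apply: cvgKM; first exact: cvgKc.
  case: eqP => [->|/eqP ne].
    by apply: (cvgK_ext (v := fun=> 1)); [move=> k; rewrite subnn|exact: cvgKc].
  have [e ee] : exists e, (m - i)%N = e.+1.
    exists (m - i).-1; rewrite prednK // subn_gt0 ltn_neqAle -ltnS ltn_ord andbT.
    by apply: contraNneq ne => ime; apply/eqP/val_inj.
  rewrite ee; have -> : 0 = (0 : K) ^+ e.+1 by rewrite expr0n.
  elim: (e) => [|e' IH]; first exact: cvg_inv_nat.
  apply: (cvgK_ext (v := fun k => k.+1%:R^-1 * k.+1%:R^-1 ^+ e'.+1)) => [k|].
    by rewrite exprS.
  by rewrite exprS; apply: cvgKM; [exact: cvg_inv_nat|exact: IH].
have := cvg_lim_uniq l1 l2.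
rewrite (bigD1 ord_max) //= eqxx mulr1 big1 ?addr0 => [|i /negbTE ->]; last by rewrite mulr0.
move/esym/eqP; have -> : p`_m = lead_coef p by rewrite lead_coefE sp.
by rewrite lead_coef_eq0 (negbTE p0).
Qed.

Lemma nat_notin_eventually (rs : seq K) : exists N, forall k, (N <= k)%N -> k.+1%:R \notin rs.
Proof.
elim: rs => [|z rs [N hN]]; first by exists 0%N.
exists (maxn N (Num.trunc (nm z))) => k; rewrite geq_max => /andP[Nk zk].
rewrite inE negb_or hN // andbT; apply/eqP => e.
have h := truncnS_gt (nm z). have h2 : nm z = k.+1%:R by rewrite -e nm_nat. move: h; rewrite {1}h2 ltr_nat => h. by have := leq_trans h (zk : (_.+1 <= k.+1)%N); rewrite ltnn.
Qed.

Lemma pf_eval_cvg0 (L : seq (K * nat * K)) :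
  (fun k => pf_eval L k.+1%:R) @ \oo --> (0 : K).
Proof.
have -> : 0 = \sum_(u <- L) (0 : K) by rewrite big1.
apply: cvgKsum => -[[b j] c] _ /=.
rewrite -[X in _ --> X](mulr0 c); apply: cvgKM; first exact: cvgKc.
have h : (fun n : nat => 1 ^ n%:Z * (- b + n%:Z%:~R)^-1 ^+ j.+1) @ \oo --> (0 : K).
  apply: bilerch_term_cvg0; [exact: nm1|by []|].
  by exists (- b), false => n; rewrite expr0 mul1r addrC.
apply: (cvgK_ext _ (cvgKS h)) => n.
by rewrite exp1rz mul1r addrC.
Qed.

(** The polynomial part of the fraction tends to 0 along the positive integers. *)
Lemma proper_of_vanishing r : vanishes_at_infinity (rateval r) ->
  (size (ratnum r) < size (ratden r))%N.
Proof.
move=> hv; have [d0 cop _] := rat_reduced r.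
set n := ratnum r in cop *; set d := ratden r in d0 cop *.
have [rs dE] := closed_field_poly_normal d.
have lc0 : lead_coef d != 0 by rewrite lead_coef_eq0.
have sd : size d = (size rs).+1 by rewrite dE size_scale // size_prod_XsubC.
pose m := (lead_coef d)^-1 *: (n %% d).
have sm : (size m <= size rs)%N.
  by rewrite size_scale ?invr_eq0 // -ltnS -sd ltn_modp.
have [L _ LE] := partial_fractions sm.
have q0 : n %/ d = 0.
  apply: poly_nat_cvg0.
  have [N hN] := nat_notin_eventually rs.
  have e k : (N <= k)%N -> (n %/ d).[k.+1%:R] = rateval r k.+1%:R - pf_eval L k.+1%:R.
    move=> /hN kr; rewrite -LE // /m /rateval -/n -/d.
    have pk : (\prod_(w <- rs) ('X - w%:P)).[k.+1%:R] != 0.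
      by rewrite -rootE root_prod_XsubC.
    have dk : d.[k.+1%:R] = lead_coef d * (\prod_(w <- rs) ('X - w%:P)).[k.+1%:R].
      by rewrite {1}dE hornerZ.
    rewrite {2}(divp_eq n d) hornerD hornerM hornerZ dk.
    by field; rewrite pk lc0.
  apply/cvg_nm; apply/cvgrPdist_lt => eps eps0.
  have e2 : 0 < eps / 2 by rewrite divr_gt0.
  have re0 : 0 < rc K (eps / 2) by rewrite -(rmorph0 (rc K)) rc_lt.
  have [M M0 hM] := hv _ re0.
  have /cvg_nm /cvgrPdist_lt /(_ _ e2) hL := pf_eval_cvg0 L.
  have hL' : \forall k \near \oo, nm (pf_eval L k.+1%:R) < eps / 2.
    by apply: filterS hL => k; rewrite sub0r normrN subr0 ger0_norm ?nm_ge0.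
  have hN' : \forall k \near \oo, (N <= k)%N by exists N.
  have hM' : \forall k \near \oo, nm (rateval r k.+1%:R) < eps / 2.
    exists (Num.trunc (nm M)) => // k /= kM.
    have := hM k.+1%:R; rewrite -{1}(gtr0_norm M0) -nm_lt nm_nat.
    rewrite -{2}(nm_rc K (ltW e2)) nm_lt (gtr0_norm re0); apply.
    by apply: lt_le_trans (truncnS_gt _) _; rewrite ler_nat.
  apply: filterS3 hL' hN' hM' => k h1 h2 h3.
  rewrite sub0r normrN subr0 ger0_norm ?nm_ge0 // e //.
  by apply: le_lt_trans (nmD _ _) _; rewrite nmN; lra.
have := divp_eq n d; rewrite q0 mul0r add0r => ->; by rewrite ltn_modp.
Qed.

(** For each point [al] the cofactor [d2] describes the function with its pole at
[al] removed, including its value at [al] itself. *)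
Lemma rational_expansion r : vanishes_at_infinity (rateval r) ->
  exists (rs : seq K) (L : seq (K * nat * K)),
  [/\ forall al, poles r al <-> al \in rs,
      forall u, u \in L -> u.1.1 \in rs /\ (u.1.2 < pole_order r u.1.1)%N,
      forall s, s \notin rs -> rateval r s = pf_eval L s &
      forall al, exists d2 : {poly K},
        [/\ forall s, (s \notin rs) || (s == al) -> d2.[s] != 0,
            forall s, (s \notin rs) || (s == al) ->
              rateval (tofrac ('X - al%:P) ^+ pole_order r al * r) s = (ratnum r).[s] / d2.[s] &
            forall s, s \notin rs ->
              (ratnum r).[s] / d2.[s] = (s - al) ^+ pole_order r al * pf_eval L s]].
Proof.
move=> /proper_of_vanishing prop; have [d0 cop dr] := rat_reduced r.
set n := ratnum r in prop cop dr *; set d := ratden r in prop d0 cop dr *.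
have [rs dE] := closed_field_poly_normal d.
have lc0 : lead_coef d != 0 by rewrite lead_coef_eq0.
have sd : size d = (size rs).+1 by rewrite dE size_scale // size_prod_XsubC.
have sm : (size ((lead_coef d)^-1 *: n)%R <= size rs)%N.
  by rewrite size_scale ?invr_eq0 // -ltnS -sd.
have [L LP LE] := partial_fractions sm.
have rootd z : root d z = (z \in rs) by rewrite dE rootZ // root_prod_XsubC.
have poE z : pole_order r z = count_mem z rs.
  rewrite /pole_order -/d dE -mul_polyC mupMr ?mu_prod_XsubC //.
  by rewrite rootC.
have rE s : s \notin rs -> n.[s] / d.[s] = pf_eval L s.
  move=> srs; rewrite -LE // hornerZ {1}dE hornerZ.
  by rewrite invfM mulrCA mulrA.
exists rs, L; split=> //.
- by move=> al; rewrite /poles /= -/d rootd.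
- by move=> u /LP; rewrite poE.
move=> al; pose d2 := lead_coef d *: \prod_(w <- [seq w <- rs | w != al]) ('X - w%:P).
have dE2 : d = ('X - al%:P) ^+ pole_order r al * d2.
  by rewrite /d2 -scalerAr poE -prod_XsubC_split.
have d2s s : (s \notin rs) || (s == al) -> d2.[s] != 0.
  move=> h; rewrite -rootE /d2 rootZ // root_prod_XsubC mem_filter.
  by case/orP: h => [/negbTE ->|->]; rewrite ?andbF.
exists d2; split=> //.
- by move=> s h; apply: rat_mul_pow; [exact: dE2|exact: d2s].
move=> s srs; rewrite -rE // dE2 hornerM horner_exp hornerXsubC.
case: (eqVneq s al) srs => [->|sal] srs.
  have -> : pole_order r al = 0%N by rewrite poE; apply/count_memPn.
  by rewrite expr0 !mul1r.
by rewrite invfM [X in _ = _ * X]mulrCA mulVKf // expf_neq0 // subr_eq0.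
Qed.

End Rational.

(** * Coefficients of the integrand *)

Section Expansions.
Variables (R : realType) (K : cpxField R).
Implicit Types (x y s al t : K) (rs : seq K) (L : seq (K * nat * K)).

Lemma regular_near s : (forall k : nat, k%:R + s != 0) ->
  exists2 e : R, 0 < e & forall t, nm t < e -> forall k : nat, k%:R + (s + t) != 0.
Proof.
move=> hs; have [c c1 hc] := inv_shift_bound s.
have c0 : 0 < c by lra.
exists c^-1; first by rewrite invr_gt0.
move=> t tc k; apply/eqP => e.
have te : t = - (k%:R + s) by apply/eqP; rewrite -addr_eq0 addrC -addrA e.
have := hc k; rewrite nmV -[nm _]nmN -te.
have t0 : 0 < nm t by rewrite nm_gt0 te oppr_eq0.
have k1 : 1 <= k.+1%:R :> R by rewrite ler1n.
have : c / k.+1%:R <= c by rewrite ler_pdivrMr ?ltr0n // ler_peMr // ltW.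
move=> h1 h2; have := le_trans h2 h1.
by rewrite -[leRHS]invrK lef_pV2 ?posrE ?invr_gt0 // leNgt tc.
Qed.

Lemma notin_near rs al : exists2 e : R, 0 < e &
  forall t, nm t < e -> (al \notin rs) || (0 < nm t) -> al + t \notin rs.
Proof.
elim: rs => [|z rs [e e0 IH]]; first by exists 1.
have [->|zal] := eqVneq z al.
  exists e => // t te; rewrite !inE eqxx /= => t0.
  rewrite negb_or IH ?t0 ?orbT // andbT -subr_eq0 addrC addKr -nm_gt0 //.
exists (Num.min e (nm (z - al))).
  by rewrite lt_min e0 nm_gt0 subr_eq0.
move=> t; rewrite lt_min => /andP[te tz] h; rewrite inE negb_or; apply/andP; split.
  by apply: contraTneq tz => <-; rewrite [al + t]addrC addrK ltxx.
apply: IH => //; move: h; rewrite inE negb_or; case/orP=> [/andP[_ ->]//|->]; exact: orbT.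
Qed.

(** The coefficients of the expansion at [al] of [(s - al)^q] times the sum of
partial fractions. *)
Definition pf_coef L q al n : K :=
  \sum_(u <- L) u.2 * (if u.1.1 == al then (n == q - u.1.2.+1)%N%:R
    else if (n < q)%N then 0
    else inv_pow_coef K u.1.2.+1 (n - q) * (al - u.1.1)^-1 ^+ (u.1.2.+1 + (n - q))).

Lemma pf_eval_analytic L q al : (forall u, u \in L -> u.1.1 = al -> (u.1.2 < q)%N) ->
  analytic (fun s => (s - al) ^+ q * pf_eval L s) al (pf_coef L q al).
Proof.
elim: L => [|[[b j] c] L IH] hL.
  apply: (analytic_eq _ _ (analytic_zero al)) => [s|n].
    by rewrite /pf_eval big_nil mulr0.
  by rewrite /pf_coef big_nil.
have IHL : analytic (fun s => (s - al) ^+ q * pf_eval L s) al (pf_coef L q al).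
  by apply: IH => u uL; apply: hL; rewrite inE uL orbT.
pose a n : K := if b == al then (n == q - j.+1)%N%:R else if (n < q)%N then 0
    else inv_pow_coef K j.+1 (n - q) * (al - b)^-1 ^+ (j.+1 + (n - q)).
have h1 : analytic (fun s => (s - al) ^+ q * (s - b)^-1 ^+ j.+1) al a.
  rewrite /a; case: eqP => [bal|/eqP bal].
    have jq : (j < q)%N by apply: (hL (b, j, c)); rewrite ?mem_head.
    apply: (@analytic_ext _ _ _ (fun s => (s - al) ^+ (q - j.+1))); last exact: analytic_pow.
    exists 1 => // t t0 _; rewrite bal.
    have -> : al + t - al = t by rewrite addrC addKr.
    have tn0 : t != 0 by rewrite -nm_gt0.
    have -> : t ^+ q = t ^+ (q - j.+1) * t ^+ j.+1 by rewrite -exprD subnK.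
    by rewrite -mulrA -exprMn mulfV // expr1n mulr1.
  have alb : al != b by rewrite eq_sym.
  exact: (analytic_shift q (analytic_inv_pow (ltn0Sn j) alb)).
apply: (analytic_eq _ _ (analytic_add (analytic_scale c h1) IHL)) => [s|n].
  by rewrite /pf_eval big_cons /=; ring.
by rewrite /pf_coef big_cons.
Qed.

Lemma phi_deriv_lerch j y s : nm y = 1 -> (j.+1, y) <> (1%N, 1) ->
  (forall k : nat, k%:R + s != 0) ->
  phi_deriv j y s = (-1) ^+ j * j`!%:R * lerch y j.+1 s.
Proof.
move=> y1 jy hs; rewrite /phi_deriv; case: eqP => [->|yn1].
  congr (_ * series_sum 0 _); apply/funext => k.
  by rewrite expr1n !mul1r exprVn.
have y1n : (1%N, y) <> (1%N, 1) by case=> /yn1.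
have -> : phi y = lerch y 1.
  by apply/funext => z; congr (series_sum 0 _); apply/funext => k; rewrite expr1.
have h := lerch_analytic y1 (isT : (0 < 1)%N) y1n hs.
rewrite (nderiv_analytic _ h) /inv_pow_coef ?addn0 ?bin0 ?mul1r // addn1 /= binn mulr1 add1n; ring.
Qed.

Lemma integrandE p x y f s : nm x = 1 -> nm y = 1 -> (p.+1, y) <> (1%N, 1) ->
  (forall k : nat, k%:R + (s + 2^-1) != 0) ->
  integrand p.+1 x y f s = bilerch x 1 s * lerch y p.+1 (s + 2^-1) * f s.
Proof.
move=> x1 y1 py hs; rewrite /integrand /= Phi_bilerch // phi_deriv_lerch //.
have s1 : (-1) ^+ p * (-1) ^+ p = 1 :> K by rewrite -expr2 sqrr_sign.
have f0 : p`!%:R != 0 :> K by rewrite pnatr_eq0 -lt0n fact_gt0.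
transitivity (((-1) ^+ p * (-1) ^+ p) * (bilerch x 1 s * lerch y p.+1 (s + 2^-1) * f s)); last by rewrite s1 mul1r.
by field.
Qed.

(** The coefficients of the integrand without its rational factor, at a point where
it is regular. *)
Definition taylor_coef x y p al j : K :=
  cauchy_prod (fun i => inv_pow_coef K 1 i * bilerch x (1 + i) al)
    (fun i => inv_pow_coef K p.+1 i * lerch y (p.+1 + i) (al + 2^-1)) j.

Lemma sum_diag (g : nat -> K) (c : K) (j M : nat) : (j <= M)%N ->
  \sum_(0 <= i < M.+1) g i * (c * (M - i == M.+1 - j.+1)%N%:R) = c * g j.
Proof.
move=> jM; rewrite (bigD1_seq j) ?iota_uniq ?mem_index_iota //=.
rewrite subSS eqxx mulr1 mulrC big1_seq ?addr0 // => i /andP[/eqP ij].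
rewrite mem_index_iota => /= hi.
by case: eqP => [E|_]; [exfalso; lia|rewrite !mulr0].
Qed.

(** Multiplying by a power that clears all poles at [al] turns the residue into one
coefficient of a product; the partial fractions at other points only
contribute beyond it. *)
Lemma Res_integrand p x y L (f : K -> K) al : nm x = 1 -> nm y = 1 -> (p.+1, y) <> (1%N, 1) ->
  (forall k : int, al + k%:~R != 0) -> (forall k : nat, k%:R + (al + 2^-1) != 0) ->
  (exists2 e : R, 0 < e & forall t, 0 < nm t -> nm t < e -> f (al + t) = pf_eval L (al + t)) ->
  Res (integrand p.+1 x y f) al =
  \sum_(u <- L) u.2 * (if u.1.1 == al then taylor_coef x y p al u.1.2 else 0).
Proof.
move=> x1 y1 py hint hhalf [e e0 fL].
pose M := (\max_(u <- L) u.1.2)%N.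
have LM u : u \in L -> (u.1.2 <= M)%N by move=> uL; rewrite /M (big_rem u uL) /= leq_maxl.
have [e' e'0 hreg] := regular_near hhalf.
have gT : analytic (fun s => lerch y p.+1 (s + 2^-1)) al (fun i => inv_pow_coef K p.+1 i * lerch y (p.+1 + i) (al + 2^-1)).
  have [C [r [d [C0 r0 d0 rd h]]]] := lerch_analytic y1 (ltn0Sn p) py hhalf.
  exists C, r, d; split=> // t t0 td N.
  by have := h t t0 td N; rewrite addrAC.
have gG := analytic_mul (bilerch_analytic x1 (isT : (0 < 1)%N) hint) gT.
have gL : analytic (fun s => (s - al) ^+ M.+1 * pf_eval L s) al (pf_coef L M.+1 al).
  by apply: pf_eval_analytic => u /LM h _; rewrite ltnS.
have gF : analytic (fun s => (s - al) ^+ M.+1 * integrand p.+1 x y f s) al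
   (cauchy_prod (taylor_coef x y p al) (pf_coef L M.+1 al)).
  apply: (analytic_ext _ (analytic_mul gG gL)).
  exists (Num.min e e'); first by rewrite lt_min e0.
  move=> t t0; rewrite lt_min => /andP[te te'].
  rewrite integrandE //; last by move=> k; rewrite addrAC; exact: hreg.
  by rewrite fL //; ring.
rewrite (Res_analytic gF) /cauchy_prod.
under eq_bigr => i _ do rewrite mulr_sumr.
rewrite exchange_big /=; apply: eq_big_seq => u uL.
case: eqP => [ual|_]; last first.
  rewrite mulr0 big1_seq // => i; rewrite mem_index_iota => /= hi.
  have -> : (M - i < M.+1)%N by rewrite ltnS leq_subr.
  by rewrite !mulr0.
have uM := LM u uL.
exact: sum_diag.
Qed.

Lemma fact_neq0 n : n`!%:R != 0 :> K.
Proof. by rewrite pnatr_eq0 -lt0n fact_gt0. Qed.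

Lemma taylor_pf L (rs : seq K) f h i : (forall u, u \in L -> u.1.1 \in rs) ->
  (forall s, s \notin rs -> f s = pf_eval L s) -> h \notin rs ->
  nderiv i f h / i`!%:R = pf_coef L 0 h i.
Proof.
move=> LP fL hrs.
have nL u : u \in L -> u.1.1 != h.
  by move=> /LP; apply: contraTneq => ->.
have g : analytic f h (pf_coef L 0 h).
  have h0 : analytic (fun s => (s - h) ^+ 0 * pf_eval L s) h (pf_coef L 0 h).
    by apply: pf_eval_analytic => u /nL /eqP.
  apply: (analytic_ext _ h0); have [e e0 he] := notin_near rs h.
  exists e => // t t0 te; rewrite expr0 mul1r fL // he // hrs //.
have f0 : f h = pf_coef L 0 h 0.
  rewrite (fL _ hrs) /pf_eval /pf_coef; apply: eq_big_seq => u uL.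
  by rewrite (negbTE (nL u uL)) /inv_pow_coef bin0 !mul1r addn0.
by rewrite (nderiv_analytic i g f0) mulrC (mulKf (fact_neq0 i)).
Qed.

(** Expansions ignore the centre; continuity along one sequence recovers the value. *)
Lemma analytic_center f al a : analytic f al a ->
  (fun k => f (al + k.+1%:R^-1)) @ \oo --> f al -> f al = a 0%N.
Proof.
case=> C [r [e [C0 r0 e0 re h]]] fc.
pose g t := if t == 0 then a 0%N else f (al + t).
have l2 : (fun k => f (al + k.+1%:R^-1)) @ \oo --> a 0%N.
  have [N hN] : exists N, forall k, (N <= k)%N -> k.+1%:R^-1 < e.
    exists (Num.trunc e^-1) => k kN; rewrite invf_plt ?posrE ?ltr0n //.
    by apply: lt_le_trans (truncnS_gt _) _; rewrite ler_nat.
  apply/cvg_nm; apply/cvgrPdist_lt => d d0.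
  have /cvgrPdist_lt /(_ (d / (C * r + 1))) hd : (fun k => k.+1%:R^-1) @ \oo --> (0 : R) by exact: cvg_harmonic.
  have q0 : 0 < C * r + 1 by rewrite ltr_wpDl // mulr_ge0 // ltW.
  have hN' : \forall k \near \oo, (N <= k)%N by exists N.
  apply: filterS2 (hd (divr_gt0 d0 q0)) hN' => k; rewrite !sub0r !normrN => hk Nk.
  rewrite ger0_norm ?nm_ge0 //; rewrite ger0_norm ?invr_ge0 // in hk.
  have nk : nm (k.+1%:R^-1 : K) = k.+1%:R^-1 by rewrite nmV nm_nat.
  have := h (k.+1%:R^-1) _ _ 1%N; rewrite nk invr_gt0 ltr0n hN // /psum big_nat1 expr0 mulr1 expr1.
  move=> /(_ isT isT) h1; apply: le_lt_trans h1 _.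
  move: hk; rewrite ltr_pdivlMr // => hk.
  have : 0 < k.+1%:R^-1 :> R by rewrite invr_gt0 ltr0n.
  set w := k.+1%:R^-1 in hk *; nra.
exact: cvg_lim_uniq fc l2.
Qed.

(** Here [f] is the rational function with its pole at [al] removed. *)
Lemma taylor_scaled L (rs : seq K) (f : K -> K) (n d : {poly K}) al q i :
  (forall u, u \in L -> u.1.1 \in rs) ->
  (forall u, u \in L -> u.1.1 = al -> (u.1.2 < q)%N) ->
  (forall s, (s \notin rs) || (s == al) -> d.[s] != 0) ->
  (forall s, (s \notin rs) || (s == al) -> f s = n.[s] / d.[s]) ->
  (forall s, s \notin rs -> n.[s] / d.[s] = (s - al) ^+ q * pf_eval L s) ->
  nderiv i f al / i`!%:R = pf_coef L q al i.
Proof.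
move=> LP Lq dn0 fE nE.
have [e e0 he] := notin_near rs al.
have g : analytic f al (pf_coef L q al).
  apply: (analytic_ext _ (pf_eval_analytic Lq)); exists e => // t t0 te.
  have trs : al + t \notin rs by rewrite he // t0 orbT.
  by rewrite fE ?trs // nE.
suff f0 : f al = pf_coef L q al 0.
  by rewrite (nderiv_analytic i g f0) mulrC (mulKf (fact_neq0 i)).
apply: (analytic_center g).
have lu : (fun k => al + k.+1%:R^-1) @ \oo --> al.
  by rewrite -[X in _ --> X]addr0; apply: cvgKD; [exact: cvgKc|exact: cvg_inv_nat].
have [N hN] : exists N, forall k, (N <= k)%N -> k.+1%:R^-1 < e.
  exists (Num.trunc e^-1) => k kN; rewrite invf_plt ?posrE ?ltr0n //.
  by apply: lt_le_trans (truncnS_gt _) _; rewrite ler_nat.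
have lim : (fun k => n.[al + k.+1%:R^-1] / d.[al + k.+1%:R^-1]) @ \oo --> f al.
  rewrite fE ?eqxx ?orbT //; apply: cvgKM; first exact: horner_cvg.
  by apply: cvgV; [rewrite dn0 // eqxx orbT|exact: horner_cvg].
apply: cvg_trans lim; apply: near_eq_cvg; exists N => // k /= Nk.
have nk : nm (k.+1%:R^-1 : K) = k.+1%:R^-1 by rewrite nmV nm_nat.
by rewrite fE // he ?nk ?hN // invr_gt0 ltr0n orbT.
Qed.

End Expansions.

(** * One partial fraction *)

Section Assembly.
Variables (R : realType) (K : cpxField R).
Variables (x y : K) (p : nat).
Hypotheses (x1 : nm x = 1) (y1 : nm y = 1) (py : (p.+1, y) <> (1%N, 1)).
Implicit Types (b c : K) (L : seq (K * nat * K)) (rs : seq K).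

Lemma pair_neq_gt q : (p.+1 <= q)%N -> (q, y) <> (1%N, 1).
Proof. by move=> pq [e1 e2]; apply: py; rewrite e2; congr (_, _); lia. Qed.

Definition pole_pos_term b j (n : nat) : K :=
  x ^- n * y ^- n.+1 * (n%:R - b)^-1 ^+ j.+1 * (ti p.+1 y - tsum n p.+1 y).
Definition pole_neg_term b j (n : nat) : K :=
  (x * y) ^+ n * (- n%:R - b)^-1 ^+ j.+1
    * (ti p.+1 y * y^-1 + (-1) ^+ p.+1 * tsum n p.+1 y^-1).
Definition pole_half_term b j (l : nat) : K :=
  \sum_(0 <= m < p.+1) ti_coef m x * ((x * y) ^+ l *
    (inv_pow_coef K j.+1 (p - m) * (- l%:R - 2^-1 - b)^-1 ^+ (j.+1 + (p - m)))).
(** The coefficient of [(s - b)^j] in the Laurent expansion at [b] of the integrand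
without its rational factor. *)
Definition laurent_coef b j : K := (-1) ^+ j * laurent_sum x b p j (fun q => lerch y q (b + 2^-1)).

Lemma sum_pole_half_term b j N :
  \sum_(0 <= l < N) pole_half_term b j l = (-1) ^+ j.+1 * half_sum x y b p j N.
Proof.
rewrite /half_sum /partial_sum mulr_sumr; apply: eq_bigr => l _.
rewrite /pole_half_term big_nat_rev /= mulrCA mulr_sumr mulr_sumr; apply: eq_big_nat => i /andP[_ hi].
rewrite add0n subSS subKn //.
have -> : - l%:R - 2^-1 - b = - (l%:R + (b + 2^-1)) :> K by ring.
rewrite invrN (exprNn (_ + _)^-1) /inv_pow_coef addnS /= exprD.
have -> : 'C(i + j, j) = 'C(i + j, i) by rewrite -(bin_sub (leq_addl i j)) addnK.
have s1 : (-1) ^+ i * (-1) ^+ i = 1 :> K by rewrite -expr2 sqrr_sign.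
rewrite [(j.+1 + i)%N]addnC addnS addSn.
transitivity (ti_coef (p - i) x * (((-1) ^+ i * (-1) ^+ i) * (-1) ^+ j.+1 * (x * y) ^+ l *
   ('C(i + j, i)%:R * (l%:R + (b + 2^-1))^-1 ^+ (i + j).+1))); first by ring.
by rewrite s1; ring.
Qed.

Lemma pole_pos_termE b j n :
  pole_pos_term b j n = (-1) ^+ j.+1 * (x ^ (- n%:Z) * (b + (- n%:Z)%:~R)^-1 ^+ j.+1
     * lerch y p.+1 (2^-1 - (- n%:Z)%:~R)).
Proof.
have -> : b + (- n%:Z)%:~R = - (n%:R - b) by rewrite mulrNz opprB.
have -> : 2^-1 - (- n%:Z)%:~R = n%:R + 2^-1 :> K by rewrite mulrNz opprK addrC.
rewrite lerch_pos_half // -exprnN invrN (exprNn (_ - _)^-1) /pole_pos_term.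
have s1 : (-1) ^+ j.+1 * (-1) ^+ j.+1 = 1 :> K by rewrite -expr2 sqrr_sign.
transitivity (((-1) ^+ j.+1 * (-1) ^+ j.+1) * (x ^- n * y ^- n.+1 * (n%:R - b)^-1 ^+ j.+1 * (ti p.+1 y - tsum n p.+1 y))).
  by rewrite s1 mul1r.
ring.
Qed.

Lemma pole_neg_termE b j n :
  pole_neg_term b j n = (-1) ^+ j.+1 * (x ^ n%:Z * (b + n%:Z%:~R)^-1 ^+ j.+1
     * lerch y p.+1 (2^-1 - n%:Z%:~R)).
Proof.
have -> : 2^-1 - n%:Z%:~R = 2^-1 - n%:R :> K by [].
have -> : b + n%:Z%:~R = - (- n%:R - b) by rewrite opprB opprK.
rewrite lerch_neg_half // invrN (exprNn (_ - _)^-1) /pole_neg_term exprMn -exprnP.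
have s1 : (-1) ^+ j.+1 * (-1) ^+ j.+1 = 1 :> K by rewrite -expr2 sqrr_sign.
transitivity (((-1) ^+ j.+1 * (-1) ^+ j.+1) * (x ^+ n * y ^+ n * (- n%:R - b)^-1 ^+ j.+1
    * (ti p.+1 y * y^-1 + (-1) ^+ p.+1 * tsum n p.+1 y^-1))).
  by rewrite s1 mul1r.
ring.
Qed.

(** [mittag_leffler] with each pole contribution written as in the series of the
formula, for the rational function [1 / (s - b)^(j+1)]. *)
Lemma core_term b j :
  (forall k : int, b + k%:~R = 0 -> k = 0) ->
  (forall l : nat, l%:R + (b + 2^-1) = 0 -> l = 0%N) ->
  (fun N => \sum_(0 <= n < N.+1) pole_pos_term b j n + \sum_(1 <= n < N.+1) pole_neg_term b j n
     + \sum_(0 <= l < N) pole_half_term b j l) @ \oo --> - laurent_coef b j.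
Proof.
move=> ha hh; have h := mittag_leffler (j := j) x1 y1 py ha hh.
apply: (cvgK_ext (v := fun N => (-1) ^+ j.+1 * (pole_sum x y b p j N + half_sum x y b p j N))).
  move=> N; rewrite mulrDr sum_pole_half_term; congr (_ + _).
  rewrite /pole_sum /sym_sum big_ltn //= [in RHS]big_ltn //= !mulrDr.
  rewrite pole_pos_termE oppr0 -!addrA; congr (_ + _).
  rewrite addrC !mulr_sumr; congr (_ + _); apply: eq_bigr => n _.
    by rewrite pole_neg_termE.
  by rewrite pole_pos_termE.
have -> : - laurent_coef b j = (-1) ^+ j.+1 * laurent_sum x b p j (fun q => lerch y q (b + 2^-1)).
  by rewrite /laurent_coef exprS; ring.
by apply: cvgKM; [exact: cvgKc|exact: h].
Qed.

Lemma inv_pow_coef1 i : inv_pow_coef K 1 i = (-1) ^+ i.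
Proof. by rewrite /inv_pow_coef addn1 /= binn mulr1. Qed.

Lemma sign_split (i j : nat) : (i <= j)%N -> (-1) ^+ j = (-1) ^+ (j - i) * (-1) ^+ i :> K.
Proof. by move=> ij; rewrite -exprD subnK. Qed.

Lemma laurent_coef_regular b j : b != 0 -> b + 2^-1 != 0 -> laurent_coef b j = taylor_coef x y p b j.
Proof.
move=> b0 bh; rewrite /laurent_coef /laurent_sum (negbTE b0) (negbTE bh) !mul0r subr0 addr0.
rewrite /taylor_coef /cauchy_prod [RHS]big_nat_rev /= mulr_sumr; apply: eq_big_nat => i /andP[_ hi].
rewrite add0n subSS subKn // inv_pow_coef1 /inv_pow_coef add1n (sign_split (hi : (i <= j)%N)); ring.
Qed.

Lemma bin_shift i : 'C((i + p.+1).-1, i) = 'C(i + p, p).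
Proof. by rewrite addnS /= -(bin_sub (leq_addl i p)) addnK. Qed.

(** The last term comes from the pole of order [p + 1] at -1/2, the sum from the
half-integer poles other than -1/2. *)
Lemma laurent_coef_half j : laurent_coef (- 2^-1) j =
  \sum_(0 <= i < j.+1) (-1) ^+ i * 'C(i + p, p)%:R * Li (i + p.+1) y * ti_coef (j - i) x
  + ti_coef (p.+1 + j) x.
Proof.
have h0 : (- 2^-1 : K) != 0 by rewrite oppr_eq0 invr_eq0 pnatr_eq0.
rewrite /laurent_coef /laurent_sum (negbTE h0) addNr eqxx mul0r subr0 mul1r mulrDr; congr (_ + _).
  rewrite mulr_sumr; apply: eq_big_nat => i /andP[_ hi].
  rewrite ti_coefE // Li_lerch //; [|lia|apply: pair_neq_gt; lia].
  rewrite bin_shift [(i + p.+1)%N]addnC (sign_split (hi : (i <= j)%N)); ring.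
by rewrite ti_coefE // mulrA -exprD addnC addnS.
Qed.

(** The last term comes from the simple pole at 0, the sum from the other integer
poles. *)
Lemma laurent_coef_zero j : laurent_coef 0 j =
  \sum_(0 <= i < j.+1) (-1) ^+ i * 'C(i + p, p)%:R * (ti (i + p.+1) y * y^-1) * Li_coef (j - i) x
  + 'C(j.+1 + p, p)%:R * (-1) ^+ j.+1 * ti (j.+1 + p.+1) y * y^-1.
Proof.
have h0 : (0 + 2^-1 : K) != 0 by rewrite add0r invr_eq0 pnatr_eq0.
have yn0 := nm_neq0 y1.
have tiE q : (p.+1 <= q)%N -> ti q y * y^-1 = lerch y q 2^-1.
  move=> pq; rewrite ti_lerch //; [|lia|exact: pair_neq_gt].
  by rewrite mulrAC mulfV // mul1r.
rewrite /laurent_coef /laurent_sum (negbTE h0) eqxx mul0r addr0 mul1r mulrBr add0r; congr (_ + _).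
  rewrite mulr_sumr; apply: eq_big_nat => i /andP[_ hi].
  rewrite Li_coefE // tiE; last by lia.
  rewrite bin_shift [(i + p.+1)%N]addnC (sign_split (hi : (i <= j)%N)); ring.
have -> : 'C(j + p.+1, j.+1) = 'C(j.+1 + p, p).
  by rewrite -[in RHS](bin_sub (leq_addl j.+1 p)) addnK addSnnS.
rewrite -[RHS]mulrA tiE; last by lia.
by rewrite [(j.+1 + p.+1)%N]addnC exprS; ring.
Qed.

Lemma double_sum_diag (W U : nat -> K) (q j : nat) : (j < q)%N ->
  \sum_(0 <= m < q) \sum_(0 <= k < q | (m + k < q)%N)
     W k * U m * (q - m - k - 1 == q - j.+1)%N%:R =
  \sum_(0 <= i < j.+1) W i * U (j - i)%N.
Proof.
move=> jq.
transitivity (\sum_(0 <= m < j.+1) W (j - m)%N * U m).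
  rewrite (big_cat_nat _ (n := j.+1)) //= [X in _ + X]big1_seq ?addr0; last first.
    move=> m; rewrite mem_index_iota => /= hm; rewrite big1_seq // => k /andP[mk _].
    by case: eqP => [E|_]; [exfalso; lia|rewrite mulr0].
  apply: eq_big_nat => m /andP[_ hm].
  have km : (j - m)%N \in index_iota 0 q by rewrite mem_index_iota; lia.
  rewrite big_mkcond (bigD1_seq _ km) ?iota_uniq //=.
  have -> : (m + (j - m) < q)%N by lia.
  have -> : (q - m - (j - m) - 1 == q - j.+1)%N by lia.
  rewrite mulr1 big1_seq ?addr0 // => k /andP[/eqP kj]; rewrite mem_index_iota => /= hk.
  case: ifP => // mk; case: eqP => [E|_]; last by rewrite mulr0.
  by exfalso; lia.
rewrite big_nat_rev /=; apply: eq_big_nat => i /andP[_ hi].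
by rewrite add0n subSS subKn.
Qed.

End Assembly.

(** * The two residue formulas *)

Section Final.
Variables (R : realType) (K : cpxField R).
Variables (x y : K) (p : nat).
Hypotheses (x1 : nm x = 1) (y1 : nm y = 1) (py : (p.+1, y) <> (1%N, 1)).

Section Data.
Variables (rs : seq K) (L : seq (K * nat * K)) (f : K -> K).
Hypotheses (LP : forall u, u \in L -> u.1.1 \in rs)
  (fL : forall s, s \notin rs -> f s = pf_eval L s).

Local Notation pt := (pole_pos_term x y p).
Local Notation nt := (pole_neg_term x y p).
Local Notation ht := (pole_half_term x y p).

Lemma pos_int_term_pf n : n%:R \notin rs ->
  pos_int_term p.+1 x y f n = \sum_(u <- L) u.2 * pt u.1.1 u.1.2 n.
Proof.
move=> nrs; rewrite /pos_int_term fL // /pf_eval mulr_sumr mulr_suml.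
by apply: eq_bigr => u _; rewrite /pole_pos_term; ring.
Qed.

Lemma neg_int_term_pf n : - n%:R \notin rs ->
  neg_int_term p.+1 x y f n = \sum_(u <- L) u.2 * nt u.1.1 u.1.2 n.
Proof.
move=> nrs; rewrite /neg_int_term fL // /pf_eval mulr_sumr mulr_suml.
by apply: eq_bigr => u _; rewrite /pole_neg_term; ring.
Qed.

Lemma half_int_term_pf l : - l%:R - 2^-1 \notin rs ->
  half_int_term p.+1 x y f l = \sum_(u <- L) u.2 * ht u.1.1 u.1.2 l.
Proof.
move=> hrs; rewrite /half_int_term /pole_half_term.
under [RHS]eq_bigr => u _ do rewrite mulr_sumr.
rewrite exchange_big /=; apply: eq_big_nat => m /andP[_ hm].
have -> : (p.+1 - m - 1 = p - m)%N by lia.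
rewrite -[_ * _ / _]mulrA (taylor_pf (p - m) LP fL hrs) /pf_coef !mulr_sumr.
apply: eq_big_seq => u uL.
have -> : (u.1.1 == - l%:R - 2^-1) = false.
  by apply: contraNF hrs => /eqP <-; exact: LP.
by rewrite ltn0 subn0; ring.
Qed.

(** Linear combination of [core_term]; the three partial sums must be taken
together, since they may diverge separately for a single fraction. *)
Lemma full_limit :
  (forall u, u \in L -> forall k : int, u.1.1 + k%:~R = 0 -> k = 0) ->
  (forall u, u \in L -> forall l : nat, l%:R + (u.1.1 + 2^-1) = 0 -> l = 0%N) ->
  (fun N => \sum_(0 <= n < N.+1) (\sum_(u <- L) u.2 * pt u.1.1 u.1.2 n)
     + \sum_(1 <= n < N.+1) (\sum_(u <- L) u.2 * nt u.1.1 u.1.2 n)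
     + \sum_(0 <= l < N) (\sum_(u <- L) u.2 * ht u.1.1 u.1.2 l)) @ \oo -->
  - \sum_(u <- L) u.2 * laurent_coef x y p u.1.1 u.1.2.
Proof.
move=> ha hh.
apply: (cvgK_ext (v := fun N => \sum_(u <- L | u \in L) u.2 *
   (\sum_(0 <= n < N.+1) pt u.1.1 u.1.2 n + \sum_(1 <= n < N.+1) nt u.1.1 u.1.2 n
     + \sum_(0 <= l < N) ht u.1.1 u.1.2 l))).
  move=> N; rewrite -big_seq; under [RHS]eq_bigr => u _ do rewrite !mulrDr !mulr_sumr.
  rewrite !big_split /=; congr (_ + _ + _); exact: exchange_big.
have -> : - \sum_(u <- L) u.2 * laurent_coef x y p u.1.1 u.1.2 =
   \sum_(u <- L | u \in L) u.2 * - laurent_coef x y p u.1.1 u.1.2.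
  by rewrite -big_seq -sumrN; apply: eq_bigr => u _; rewrite mulrN.
apply: cvgKsum => u uL; apply: cvgKM; first exact: cvgKc.
apply: core_term => //; [exact: ha|exact: hh].
Qed.

(** Fractions with their pole at -1/2 give the last term of [laurent_coef_half]; the
others give the contribution of the pole at -1/2 that the series over the
half-integers, starting at [n = 1], leaves out. *)
Lemma scaled_half_sum q al : al = - 2^-1 ->
  (forall u, u \in L -> u.1.1 = al -> (u.1.2 < q)%N) ->
  \sum_(0 <= m < p.+1 + q) ti_coef m x * pf_coef L q al (p.+1 + q - m - 1)%N =
  \sum_(u <- L) u.2 * (if u.1.1 == al then ti_coef (p.+1 + u.1.2) x else ht u.1.1 u.1.2 0).
Proof.
move=> alE Lq; rewrite /pf_coef.
under eq_bigr => m _ do rewrite mulr_sumr.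
rewrite exchange_big /=; apply: eq_big_seq => u uL.
under eq_bigr => m _ do rewrite mulrCA.
rewrite -mulr_sumr; congr (_ * _).
case: eqP => [ual|_].
  have jq := Lq u uL ual; set j := u.1.2 in jq *; clearbody j.
  have km : (p.+1 + j)%N \in index_iota 0 (p.+1 + q) by rewrite mem_index_iota; lia.
  rewrite (bigD1_seq _ km) ?iota_uniq //= [X in _ + X]big1_seq ?addr0.
    have -> : (p.+1 + q - (p.+1 + j) - 1 == q - j.+1)%N by lia.
    by rewrite mulr1.
  move=> m /andP[/eqP mj]; rewrite mem_index_iota => /= hm.
  by case: eqP => [E|_]; [exfalso; lia|rewrite mulr0].
rewrite (big_cat_nat _ (n := p.+1)) //= ?leq_addr // [X in _ + X]big1_seq ?addr0; last first.
  move=> m; rewrite mem_index_iota => /= hm.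
  have -> : (p.+1 + q - m - 1 < q)%N by lia.
  by rewrite mulr0.
rewrite /pole_half_term; apply: eq_big_nat => m /andP[_ hm].
have -> : (p.+1 + q - m - 1 < q)%N = false by lia.
have -> : (p.+1 + q - m - 1 - q = p - m)%N by lia.
by rewrite alE oppr0 sub0r mul1r.
Qed.

Lemma scaled_double_sum q al (W U : nat -> K) :
  (forall u, u \in L -> u.1.1 = al -> (u.1.2 < q)%N) ->
  \sum_(0 <= m < q) \sum_(0 <= k < q | (m + k < q)%N)
     W k * U m * pf_coef L q al (q - m - k - 1)%N =
  \sum_(u <- L) u.2 * (if u.1.1 == al then \sum_(0 <= i < u.1.2.+1) W i * U (u.1.2 - i)%N else 0).
Proof.
move=> Lq; rewrite /pf_coef.
under eq_bigr => m _ do under eq_bigr => k _ do rewrite mulr_sumr.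
under eq_bigr => m _ do rewrite exchange_big /=.
rewrite exchange_big /=; apply: eq_big_seq => u uL.
case: eqP => [ual|_].
  rewrite -(double_sum_diag W U (Lq u uL ual)) mulr_sumr; apply: eq_bigr => m _.
  by rewrite mulr_sumr; apply: eq_bigr => k _; rewrite mulrCA.
rewrite mulr0 big1_seq // => m; rewrite mem_index_iota => /= hm.
rewrite big1 // => k mk; have -> : (q - m - k - 1 < q)%N by lia.
by rewrite !mulr0.
Qed.

(** The analogue at 0: the index [k = 0] supplies the term [n = 0] missing from the
series over the positive integers, and [k = j + 1] the last term of
[laurent_coef_zero]. *)
Lemma scaled_zero_sum q al : al = 0 ->
  (forall u, u \in L -> u.1.1 = al -> (u.1.2 < q)%N) ->
  \sum_(0 <= k < q.+1) 'C(k + p, p)%:R * (-1) ^+ k * ti (k + p.+1) y * y^-1 * pf_coef L q al (q - k)%N =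
  \sum_(u <- L) u.2 * (if u.1.1 == al then
     'C(u.1.2.+1 + p, p)%:R * (-1) ^+ u.1.2.+1 * ti (u.1.2.+1 + p.+1) y * y^-1
     else pt u.1.1 u.1.2 0).
Proof.
move=> alE Lq; rewrite /pf_coef.
under eq_bigr => m _ do rewrite mulr_sumr.
rewrite exchange_big /=; apply: eq_big_seq => u uL.
under eq_bigr => m _ do rewrite mulrCA.
rewrite -mulr_sumr; congr (_ * _).
case: eqP => [ual|_].
  have jq := Lq u uL ual; set j := u.1.2 in jq *; clearbody j.
  have km : j.+1 \in index_iota 0 q.+1 by rewrite mem_index_iota; lia.
  rewrite (bigD1_seq _ km) ?iota_uniq //= [X in _ + X]big1_seq ?addr0.
    by rewrite eqxx mulr1.
  move=> m /andP[/eqP mj]; rewrite mem_index_iota => /= hm.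
  by case: eqP => [E|_]; [exfalso; lia|rewrite mulr0].
rewrite big_ltn // [X in _ + X]big1_seq ?addr0; last first.
  move=> m; rewrite mem_index_iota => /= hm.
  have -> : (q - m < q)%N by lia.
  by rewrite mulr0.
rewrite subn0 ltnn subnn addn0 add0n binn /inv_pow_coef bin0 alE /pole_pos_term /tsum big_geq //.
by rewrite !expr0 expr1 invr1; ring.
Qed.

Lemma residue_sum (A : set K) (al : K) (h : K -> nat -> K) (F : K -> K) :
  (forall b, A b <-> b \in rs) ->
  (forall b, A b -> b <> al -> F b = \sum_(u <- L) u.2 * (if u.1.1 == b then h b u.1.2 else 0)) ->
  \sum_(b \in A `\ al) F b = \sum_(u <- L) u.2 * (if u.1.1 == al then 0 else h u.1.1 u.1.2).
Proof.
move=> Ars hF.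
pose s := [seq b <- undup rs | b != al].
have su : uniq s by rewrite filter_uniq // undup_uniq.
have sE b : b \in s = (b != al) && (b \in rs) by rewrite mem_filter mem_undup.
rewrite (fsbigE s) //; first last.
- by move=> i [/Ars ir ial]; rewrite sE ir andbT negbK => /eqP e; case: ial.
- by move=> b /=; rewrite sE => /andP[/eqP bal brs]; split=> //; apply/Ars.
transitivity (\sum_(b <- s) \sum_(u <- L) u.2 * (if u.1.1 == b then h b u.1.2 else 0)).
  rewrite big_seq_cond [RHS]big_seq; apply: eq_big => b.
    apply/andP/idP => [[]//|bs]; split=> //; rewrite inE.
    by move: bs; rewrite sE => /andP[/eqP bal brs]; split=> //; apply/Ars.
  rewrite sE => /andP[/andP[/eqP bal brs] _]; apply: hF => //; exact/Ars.
rewrite exchange_big /=; apply: eq_big_seq => u uL.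
rewrite -mulr_sumr; congr (_ * _).
case: eqP => [ual|/eqP ual].
  rewrite big1_seq // => b /=; rewrite sE => /andP[bal _].
  by case: eqP => // e; rewrite -e ual eqxx in bal.
have us : u.1.1 \in s by rewrite sE ual LP.
rewrite (bigD1_seq _ us) //= eqxx big1_seq ?addr0 // => b /andP[bu _].
by rewrite eq_sym (negbTE bu).
Qed.

End Data.

Lemma bin_succ_sub1 k : ('C(k + p.+1 - 1, p.+1 - 1) = 'C(k + p, p))%N.
Proof. by rewrite addnS !subn1. Qed.

(** Each fraction with its pole at -1/2 is excluded from the residues on the left,
and its Laurent coefficient reappears on the right within the finite sums. *)
Lemma residue_formula_half (r : {fraction {poly K}}) (q : nat)
    (r_half : forall n : nat, (1 <= n)%N -> ~ poles r (- (n%:R + 2^-1)))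
    (r_int : forall k : int, ~ poles r k%:~R)
    (r_o1 : vanishes_at_infinity (rateval r))
    (hq : pole_order r (- 2^-1) = q) :
  let Rq := rateval (tofrac ('X + (2^-1)%:P) ^+ q * r) in
  series_converges 0 (pos_int_term p.+1 x y (rateval r)) ->
  series_converges 1 (neg_int_term p.+1 x y (rateval r)) ->
  series_converges 1 (half_int_term p.+1 x y (rateval r)) ->
   - (\sum_(alpha \in poles r `\ (- 2^-1)) Res (integrand p.+1 x y (rateval r)) alpha)
   = series_sum 0 (pos_int_term p.+1 x y (rateval r))
     + series_sum 1 (neg_int_term p.+1 x y (rateval r))
     + \sum_(0 <= m < p.+1 + q)
         ti_coef m x * (nderiv (p.+1 + q - m - 1) Rq (- 2^-1)
                        / ((p.+1 + q - 1 - m)`!)%:R)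
     + \sum_(0 <= m < q) \sum_(0 <= k < q | (m + k < q)%N)
         (-1) ^+ k * 'C(k + p.+1 - 1, p.+1 - 1)%:R * Li (k + p.+1) y * ti_coef m x
           * (nderiv (q - m - k - 1) Rq (- 2^-1)
              / ((q - m - k - 1)`!)%:R)
     + series_sum 1 (half_int_term p.+1 x y (rateval r)).
Proof.
move=> Rq cpos cneg chalf; rewrite -{}hq in Rq *.
have [rs [L [prs LP fL hscaled]]] := rational_expansion r_o1.
set al : K := - 2^-1 in hscaled *; set q0 := pole_order r al in Rq *.
have LP' u : u \in L -> u.1.1 \in rs by case/LP.
have Lq u : u \in L -> u.1.1 = al -> (u.1.2 < q0)%N by case/LP => _ h e; rewrite /q0 -e.
have [d2 [d2n d2E d2L]] := hscaled al.
have RqE : Rq = rateval (tofrac ('X - al%:P) ^+ q0 * r) by rewrite /Rq /al polyCN opprK.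
have taylor i : nderiv i Rq al / i`!%:R = pf_coef L q0 al i.
  by rewrite RqE; apply: (taylor_scaled i LP' Lq d2n d2E d2L).
have intN (k : int) : k%:~R \notin rs by apply/negP => /prs; exact: r_int.
have natN (n : nat) : n%:R \notin rs by exact: (intN n%:Z).
have nnatN (n : nat) : - n%:R \notin rs by have := intN (- n%:Z); rewrite mulrNz.
have halfN (l : nat) : (0 < l)%N -> - l%:R - 2^-1 \notin rs.
  by move=> l0; rewrite -opprD; apply/negP => /prs; exact: r_half.
have ha u : u \in L -> forall k : int, u.1.1 + k%:~R = 0 -> k = 0.
  move=> uL k /eqP; rewrite addr_eq0 -mulrNz => /eqP e.
  by have := intN (- k); rewrite -e LP'.
have hh u : u \in L -> forall l : nat, l%:R + (u.1.1 + 2^-1) = 0 -> l = 0%N.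
  move=> uL l e; apply/eqP; rewrite eqn0Ngt; apply/negP => l0.
  have := halfN l l0; have -> : - l%:R - 2^-1 = u.1.1.
    by apply/eqP; rewrite -subr_eq0 -oppr_eq0; apply/eqP; rewrite -[RHS]e; ring.
  by rewrite LP'.
(* The term l = 0 of the half-integer sums, for which the function itself may be singular. *)
pose H0 := \sum_(u <- L) u.2 * pole_half_term x y p u.1.1 u.1.2 0.
have lim1 := cvgKS (full_limit ha hh).
have lim2 : (fun N => partial_sum 0 (pos_int_term p.+1 x y (rateval r)) N.+2
    + partial_sum 1 (neg_int_term p.+1 x y (rateval r)) N.+2
    + (H0 + partial_sum 1 (half_int_term p.+1 x y (rateval r)) N.+1)) @ \oo -->
    series_sum 0 (pos_int_term p.+1 x y (rateval r))
     + series_sum 1 (neg_int_term p.+1 x y (rateval r))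
     + (H0 + series_sum 1 (half_int_term p.+1 x y (rateval r))).
  apply: cvgKD; first apply: cvgKD.
  - exact: (cvgKS (cvgKS cpos)).
  - exact: (cvgKS (cvgKS cneg)).
  - apply: cvgKD; first exact: cvgKc.
    exact: (cvgKS chalf).
have key : series_sum 0 (pos_int_term p.+1 x y (rateval r))
     + series_sum 1 (neg_int_term p.+1 x y (rateval r))
     + (H0 + series_sum 1 (half_int_term p.+1 x y (rateval r))) =
     - \sum_(u <- L) u.2 * laurent_coef x y p u.1.1 u.1.2.
  apply: (cvg_lim_uniq lim2); apply: (cvgK_ext _ lim1) => N.
  congr (_ + _ + _).
  - by apply: eq_bigr => n _; rewrite (pos_int_term_pf fL).
  - by apply: eq_bigr => n _; rewrite (neg_int_term_pf fL).
  - rewrite [RHS]big_ltn //; congr (_ + _); apply: eq_big_nat => l /andP[l0 _].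
    by rewrite (half_int_term_pf LP' fL) // halfN.
have X1 : \sum_(0 <= m < p.+1 + q0) ti_coef m x * (nderiv (p.+1 + q0 - m - 1) Rq al
                        / ((p.+1 + q0 - 1 - m)`!)%:R) =
   \sum_(u <- L) u.2 * (if u.1.1 == al then ti_coef (p.+1 + u.1.2) x else pole_half_term x y p u.1.1 u.1.2 0).
  rewrite -(scaled_half_sum (erefl al) Lq); apply: eq_bigr => m _.
  have -> : (p.+1 + q0 - 1 - m = p.+1 + q0 - m - 1)%N by lia.
  by rewrite taylor.
have X2 : \sum_(0 <= m < q0) \sum_(0 <= k < q0 | (m + k < q0)%N)
         (-1) ^+ k * 'C(k + p.+1 - 1, p.+1 - 1)%:R * Li (k + p.+1) y * ti_coef m x
           * (nderiv (q0 - m - k - 1) Rq al / ((q0 - m - k - 1)`!)%:R) =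
   \sum_(u <- L) u.2 * (if u.1.1 == al then \sum_(0 <= i < u.1.2.+1)
      (-1) ^+ i * 'C(i + p, p)%:R * Li (i + p.+1) y * ti_coef (u.1.2 - i)%N x else 0).
  rewrite -(scaled_double_sum (fun i => (-1) ^+ i * 'C(i + p, p)%:R * Li (i + p.+1) y)
    (fun m => ti_coef m x) Lq).
  by apply: eq_bigr => m _; apply: eq_bigr => k _; rewrite taylor bin_succ_sub1.
have res : \sum_(alpha \in poles r `\ al) Res (integrand p.+1 x y (rateval r)) alpha =
   \sum_(u <- L) u.2 * (if u.1.1 == al then 0 else taylor_coef x y p u.1.1 u.1.2).
  apply: (residue_sum LP' prs) => b /prs brs bal.
  have [e e0 he] := notin_near rs b.
  apply: Res_integrand => //.
  - move=> k; apply/negP; rewrite addr_eq0 -mulrNz => /eqP eb.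
    by have := intN (- k); rewrite -eb brs.
  - move=> [|k]; apply/eqP => eb.
      by apply: bal; apply/eqP; rewrite -subr_eq0 opprK -[X in X == 0]add0r eb.
    have := halfN k.+1 isT; have -> : - k.+1%:R - 2^-1 = b.
      by apply/eqP; rewrite -subr_eq0 -oppr_eq0; apply/eqP; rewrite -[RHS]eb; ring.
    by rewrite brs.
  - by exists e => // t t0 te; rewrite fL // he // t0 orbT.
rewrite X1 X2 res.
have -> : series_sum 1 (half_int_term p.+1 x y (rateval r)) =
  - \sum_(u <- L) u.2 * laurent_coef x y p u.1.1 u.1.2 - H0
  - series_sum 0 (pos_int_term p.+1 x y (rateval r))
  - series_sum 1 (neg_int_term p.+1 x y (rateval r)).
  by rewrite -key; ring.
move: (series_sum 0 _) (series_sum 1 _) => s0 s1.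
set Y1 := \sum_(u <- L) _; set Y2 := \sum_(u <- L) _; set Y3 := \sum_(u <- L) _; set Y4 := \sum_(u <- L) _.
suff -> : Y1 = Y4 + H0 - Y2 - Y3 by ring.
rewrite /Y1 /Y2 /Y3 /Y4 /H0 -!big_split -!sumrB /=; apply: eq_big_seq => u uL.
case: eqP => [ual|/eqP ual].
  rewrite ual laurent_coef_half //.
  have -> : pole_half_term x y p al u.1.2 0 = 0; last by ring.
  rewrite /pole_half_term big1 // => m _.
  have -> : - 0%:R - 2^-1 - al = 0 by rewrite /al oppr0 sub0r subrr.
  by rewrite invr0 expr0n /= !mulr0.
rewrite laurent_coef_regular //; first ring.
  by apply: contraTneq (LP' u uL) => ->; exact: (natN 0%N).
by apply: contraNneq ual => e; rewrite -subr_eq0 opprK e.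
Qed.

End Final.

Section FinalZero.
Variables (R : realType) (K : cpxField R).
Variables (x y : K) (p : nat).
Hypotheses (x1 : nm x = 1) (y1 : nm y = 1) (py : (p.+1, y) <> (1%N, 1)).

Lemma residue_formula_zero (r : {fraction {poly K}}) (q : nat)
    (r_half : forall n : nat, ~ poles r (- (n%:R + 2^-1)))
    (r_int : forall k : int, k != 0 -> ~ poles r k%:~R)
    (r_o1 : vanishes_at_infinity (rateval r))
    (hq : pole_order r 0 = q) :
  let Rq := rateval (tofrac 'X ^+ q * r) in
  series_converges 1 (pos_int_term p.+1 x y (rateval r)) ->
  series_converges 1 (neg_int_term p.+1 x y (rateval r)) ->
  series_converges 0 (half_int_term p.+1 x y (rateval r)) ->
   - (\sum_(alpha \in poles r `\ 0) Res (integrand p.+1 x y (rateval r)) alpha)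
   = series_sum 1 (pos_int_term p.+1 x y (rateval r))
     + series_sum 1 (neg_int_term p.+1 x y (rateval r))
     + \sum_(0 <= k < q.+1)
         'C(k + p.+1 - 1, p.+1 - 1)%:R * (-1) ^+ k * ti (k + p.+1) y * y^-1
           * (nderiv (q - k) Rq 0 / ((q - k)`!)%:R)
     + \sum_(0 <= m < q) \sum_(0 <= k < q | (m + k < q)%N)
         (-1) ^+ k * 'C(k + p.+1 - 1, p.+1 - 1)%:R * (ti (k + p.+1) y * y^-1)
           * Li_coef m x
           * (nderiv (q - m - k - 1) Rq 0 / ((q - m - k - 1)`!)%:R)
     + series_sum 0 (half_int_term p.+1 x y (rateval r)).
Proof.
move=> Rq cpos cneg chalf; rewrite -{}hq in Rq *.
have [rs [L [prs LP fL hscaled]]] := rational_expansion r_o1.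
set q0 := pole_order r 0 in Rq *.
have LP' u : u \in L -> u.1.1 \in rs by case/LP.
have Lq u : u \in L -> u.1.1 = 0 -> (u.1.2 < q0)%N by case/LP => _ h e; rewrite /q0 -e.
have [d2 [d2n d2E d2L]] := hscaled 0.
have RqE : Rq = rateval (tofrac ('X - 0%:P) ^+ q0 * r) by rewrite /Rq polyC0 subr0.
have taylor i : nderiv i Rq 0 / i`!%:R = pf_coef L q0 0 i.
  by rewrite RqE; apply: (taylor_scaled i LP' Lq d2n d2E d2L).
have intN (k : int) : k != 0 -> k%:~R \notin rs.
  by move=> k0; apply/negP => /prs; exact: r_int.
have natN (n : nat) : (0 < n)%N -> n%:R \notin rs.
  by move=> n0; apply: (intN n%:Z); rewrite eqz_nat -lt0n.
have nnatN (n : nat) : (0 < n)%N -> - n%:R \notin rs.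
  by move=> n0; have := intN (- n%:Z); rewrite mulrNz oppr_eq0 eqz_nat -lt0n; apply.
have halfN (l : nat) : - l%:R - 2^-1 \notin rs.
  by rewrite -opprD; apply/negP => /prs; exact: r_half.
have ha u : u \in L -> forall k : int, u.1.1 + k%:~R = 0 -> k = 0.
  move=> uL k /eqP; rewrite addr_eq0 -mulrNz => /eqP e; apply/eqP; apply: contraT => k0.
  by have := intN (- k); rewrite oppr_eq0 => /(_ k0); rewrite -e LP'.
have hh u : u \in L -> forall l : nat, l%:R + (u.1.1 + 2^-1) = 0 -> l = 0%N.
  move=> uL l e.
  have := halfN l; have -> : - l%:R - 2^-1 = u.1.1.
    by apply/eqP; rewrite -subr_eq0 -oppr_eq0; apply/eqP; rewrite -[RHS]e; ring.
  by rewrite LP'.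
(* The term n = 0 of the integer sums, where the function itself may be singular. *)
pose H0 := \sum_(u <- L) u.2 * pole_pos_term x y p u.1.1 u.1.2 0.
have lim1 := full_limit x1 y1 py ha hh.
have lim2 : (fun N => H0 + partial_sum 1 (pos_int_term p.+1 x y (rateval r)) N.+1
    + partial_sum 1 (neg_int_term p.+1 x y (rateval r)) N.+1
    + partial_sum 0 (half_int_term p.+1 x y (rateval r)) N) @ \oo -->
    H0 + series_sum 1 (pos_int_term p.+1 x y (rateval r))
     + series_sum 1 (neg_int_term p.+1 x y (rateval r))
     + series_sum 0 (half_int_term p.+1 x y (rateval r)).
  apply: cvgKD; first apply: cvgKD; first apply: cvgKD.
  - exact: cvgKc.
  - exact: (cvgKS cpos).
  - exact: (cvgKS cneg).
  - exact: chalf.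
have key : H0 + series_sum 1 (pos_int_term p.+1 x y (rateval r))
     + series_sum 1 (neg_int_term p.+1 x y (rateval r))
     + series_sum 0 (half_int_term p.+1 x y (rateval r)) =
     - \sum_(u <- L) u.2 * laurent_coef x y p u.1.1 u.1.2.
  apply: (cvg_lim_uniq lim2); apply: (cvgK_ext _ lim1) => N.
  congr (_ + _ + _).
  - rewrite [RHS]big_ltn //; congr (_ + _); apply: eq_big_nat => n /andP[n0 _].
    by rewrite (pos_int_term_pf x y p fL) // natN.
  - by apply: eq_big_nat => n /andP[n0 _]; rewrite (neg_int_term_pf x y p fL) // nnatN.
  - by apply: eq_bigr => l _; rewrite (half_int_term_pf x y p LP' fL).
have X1 : \sum_(0 <= k < q0.+1)
         'C(k + p.+1 - 1, p.+1 - 1)%:R * (-1) ^+ k * ti (k + p.+1) y * y^-1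
           * (nderiv (q0 - k) Rq 0 / ((q0 - k)`!)%:R) =
   \sum_(u <- L) u.2 * (if u.1.1 == 0 then
     'C(u.1.2.+1 + p, p)%:R * (-1) ^+ u.1.2.+1 * ti (u.1.2.+1 + p.+1) y * y^-1
     else pole_pos_term x y p u.1.1 u.1.2 0).
  rewrite -(scaled_zero_sum x y p (erefl 0) Lq); apply: eq_bigr => m _.
  by rewrite taylor bin_succ_sub1.
have X2 : \sum_(0 <= m < q0) \sum_(0 <= k < q0 | (m + k < q0)%N)
         (-1) ^+ k * 'C(k + p.+1 - 1, p.+1 - 1)%:R * (ti (k + p.+1) y * y^-1) * Li_coef m x
           * (nderiv (q0 - m - k - 1) Rq 0 / ((q0 - m - k - 1)`!)%:R) =
   \sum_(u <- L) u.2 * (if u.1.1 == 0 then \sum_(0 <= i < u.1.2.+1)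
      (-1) ^+ i * 'C(i + p, p)%:R * (ti (i + p.+1) y * y^-1) * Li_coef (u.1.2 - i)%N x else 0).
  rewrite -(scaled_double_sum (fun i => (-1) ^+ i * 'C(i + p, p)%:R * (ti (i + p.+1) y * y^-1))
    (fun m => Li_coef m x) Lq).
  by apply: eq_bigr => m _; apply: eq_bigr => k _; rewrite taylor bin_succ_sub1.
have res : \sum_(alpha \in poles r `\ 0) Res (integrand p.+1 x y (rateval r)) alpha =
   \sum_(u <- L) u.2 * (if u.1.1 == 0 then 0 else taylor_coef x y p u.1.1 u.1.2).
  apply: (residue_sum LP' prs) => b /prs brs b0.
  have [e e0 he] := notin_near rs b.
  apply: Res_integrand => //.
  - move=> k; apply/negP; rewrite addr_eq0 -mulrNz => /eqP eb.
    have [k0|k0] := eqVneq k 0; first by apply: b0; rewrite eb k0.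
    by have := intN (- k); rewrite oppr_eq0 => /(_ k0); rewrite -eb brs.
  - move=> k; apply/eqP => eb.
    have := halfN k; have -> : - k%:R - 2^-1 = b.
      by apply/eqP; rewrite -subr_eq0 -oppr_eq0; apply/eqP; rewrite -[RHS]eb; ring.
    by rewrite brs.
  - by exists e => // t t0 te; rewrite fL // he // t0 orbT.
rewrite X1 X2 res.
have -> : series_sum 0 (half_int_term p.+1 x y (rateval r)) =
  - \sum_(u <- L) u.2 * laurent_coef x y p u.1.1 u.1.2 - H0
  - series_sum 1 (pos_int_term p.+1 x y (rateval r))
  - series_sum 1 (neg_int_term p.+1 x y (rateval r)).
  by rewrite -key; ring.
move: (series_sum 1 (pos_int_term _ _ _ _)) (series_sum 1 (neg_int_term _ _ _ _)) => s0 s1.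
set Y1 := \sum_(u <- L) _; set Y2 := \sum_(u <- L) _; set Y3 := \sum_(u <- L) _; set Y4 := \sum_(u <- L) _.
suff -> : Y1 = Y4 + H0 - Y2 - Y3 by ring.
rewrite /Y1 /Y2 /Y3 /Y4 /H0 -!big_split -!sumrB /=; apply: eq_big_seq => u uL.
case: eqP => [ual|/eqP ual].
  rewrite ual laurent_coef_zero //.
  have -> : pole_pos_term x y p 0 u.1.2 0 = 0; last by ring.
  by rewrite /pole_pos_term subr0 invr0 expr0n /= mulr0 mul0r.
rewrite laurent_coef_regular //; first ring.
apply: contraTneq (LP' u uL) => e.
have := halfN 0%N; rewrite oppr0 sub0r.
by have -> : - 2^-1 = u.1.1 by apply/eqP; rewrite eq_sym -addr_eq0 e.
Qed.

End FinalZero.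

Theorem theorem6p1 (R : realType) (x y : R[i]) (p1 : nat)
    (r1 r2 : {fraction {poly R[i]}}) (q1 q2 : nat)
    (hx : root_of_unity x) (hy : root_of_unity y)
    (hp1 : (1 <= p1)%N) (hp1y : (p1, y) <> (1%N, 1))
    (r1_half : forall n : nat, (1 <= n)%N -> ~ poles r1 (- (n%:R + 2^-1)))
    (r1_int : forall k : int, ~ poles r1 k%:~R)
    (r2_half : forall n : nat, ~ poles r2 (- (n%:R + 2^-1)))
    (r2_int : forall k : int, k != 0 -> ~ poles r2 k%:~R)
    (r1_o1 : vanishes_at_infinity (rateval r1))
    (r2_o1 : vanishes_at_infinity (rateval r2))
    (hq1 : pole_order r1 (- 2^-1) = q1)
    (hq2 : pole_order r2 0 = q2) :
  let R1 := rateval (tofrac ('X + (2^-1)%:P) ^+ q1 * r1) in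
  let R2 := rateval (tofrac 'X ^+ q2 * r2) in
  (series_converges 0 (pos_int_term p1 x y (rateval r1)) ->
   series_converges 1 (neg_int_term p1 x y (rateval r1)) ->
   series_converges 1 (half_int_term p1 x y (rateval r1)) ->
   - (\sum_(alpha \in poles r1 `\ (- 2^-1))
        Res (integrand p1 x y (rateval r1)) alpha)
   = series_sum 0 (pos_int_term p1 x y (rateval r1))
     + series_sum 1 (neg_int_term p1 x y (rateval r1))
     + \sum_(0 <= m < p1 + q1)
         ti_coef m x * (nderiv (p1 + q1 - m - 1) R1 (- 2^-1)
                        / ((p1 + q1 - 1 - m)`!)%:R)
     + \sum_(0 <= m < q1) \sum_(0 <= k < q1 | (m + k < q1)%N)
         (-1) ^+ k * 'C(k + p1 - 1, p1 - 1)%:R * Li (k + p1) y * ti_coef m x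
           * (nderiv (q1 - m - k - 1) R1 (- 2^-1)
              / ((q1 - m - k - 1)`!)%:R)
     + series_sum 1 (half_int_term p1 x y (rateval r1)))
  /\
  (series_converges 1 (pos_int_term p1 x y (rateval r2)) ->
   series_converges 1 (neg_int_term p1 x y (rateval r2)) ->
   series_converges 0 (half_int_term p1 x y (rateval r2)) ->
   - (\sum_(alpha \in poles r2 `\ 0)
        Res (integrand p1 x y (rateval r2)) alpha)
   = series_sum 1 (pos_int_term p1 x y (rateval r2))
     + series_sum 1 (neg_int_term p1 x y (rateval r2))
     + \sum_(0 <= k < q2.+1)
         'C(k + p1 - 1, p1 - 1)%:R * (-1) ^+ k * ti (k + p1) y * y^-1
           * (nderiv (q2 - k) R2 0 / ((q2 - k)`!)%:R)
     + \sum_(0 <= m < q2) \sum_(0 <= k < q2 | (m + k < q2)%N)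
         (-1) ^+ k * 'C(k + p1 - 1, p1 - 1)%:R * (ti (k + p1) y * y^-1)
           * Li_coef m x
           * (nderiv (q2 - m - k - 1) R2 0 / ((q2 - m - k - 1)`!)%:R)
     + series_sum 0 (half_int_term p1 x y (rateval r2))).
Proof.
have x1 : @nm R (complex_cpxField R) x = 1 by apply: (@nm_unity R (complex_cpxField R)).
have y1 : @nm R (complex_cpxField R) y = 1 by apply: (@nm_unity R (complex_cpxField R)).
case: p1 hp1 hp1y => [//|p] _ py R1 R2; split.
  exact: (@residue_formula_half R (complex_cpxField R) x y p x1 y1 py r1 q1 r1_half r1_int r1_o1 hq1).
exact: (@residue_formula_zero R (complex_cpxField R) x y p x1 y1 py r2 q2 r2_half r2_int r2_o1 hq2).
Qed.
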